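(* Let $k$ be a commutative ring. For every $A_{[0,\infty[}$-algebra $A$ over $k$, the (contravariant) functor $$\mathsf{CgaCdg}\to\mathsf{Sets},\qquad C\mapsto\mathsf{Tw}(C,A)$$ is representable. Denote by $BA$ (the bar construction of $A$) a representative. Moreover, the assignment $A\mapsto BA$ extends to a fully faithful covariant functor $$B:\mathsf{Alg}_{[0,\infty[}\to\mathsf{CgaCdg}$$ such that the isomorphism $\mathsf{Tw}(?,A)\cong\mathsf{CgaCdg}(?,BA)$ is natural in $A$.
   Context: $k$ is a commutative associative unital ring; graded means $\mathbf Z$-graded; $\otimes=\otimes_k$; the Koszul sign rule is $(f\otimes g)(u\otimes v)=(-1)^{|g||u|}f(u)\otimes g(v)$. An $A_{[0,\infty[}$-algebra over $k$ (curved $A_\infty$-algebra) is a graded $k$-module $A$ with graded morphisms $m_i:A^{\otimes i}\to A$, $i\ge 0$, of degree $2-i$, such that for each $p\ge 0$, $\sum_{j+n+l=p}(-1)^{jn+l}m_{j+1+l}(\mathbf 1^{\otimes j}\otimes m_n\otimes\mathbf 1^{\otimes l})=0$. A morphism $f:A\to A'$ is a family $f_i:A^{\otimes i}\to A'$, $i\ge 1$, of degree $1-i$, such that for all $p\ge 0$ $$\sum_{j+n+l=p}(-1)^{jn+l}f_{j+1+l}(\mathbf 1^{\otimes j}\otimes m_n\otimes\mathbf 1^{\otimes l})=\sum_{1\le r\le p,\ i_1+\dots+i_r=p}(-1)^{s}m'_r(f_{i_1}\otimes\dots\otimes f_{i_r}),$$ where $s=\sum_{2\le u\le r}\big((1-i_u)\sum_{1\le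 v\le u-1}i_v\big)$, and where the right-hand side is $m'_0$ if $p=0$. Composition: $(f'f)_p=\sum_{1\le r\le p,\ i_1+\dots+i_r=p}(-1)^sf'_r(f_{i_1}\otimes\dots\otimes f_{i_r})$ with the same $s$. This gives the category $\mathsf{Alg}_{[0,\infty[}$. $\mathsf{CgaCdg}$ is the category of cocomplete graded-augmented counital dg $k$-coalgebras: objects $(C,d,\Delta,\varepsilon,\eta)$ with $(C,d,\Delta,\eta)$ a counital dg coalgebra (coassociative graded coalgebra with counit $\eta:C\to k$ and a square-zero degree $1$ coderivation $d$) and $(C,\Delta,\varepsilon,\eta)$ an augmented graded coalgebra with augmentation $\varepsilon:k\to C$ (not required to satisfy $d\varepsilon=0$) which is cocomplete: the reduced coalgebra $\overline C=\mathrm{cok}\,\varepsilon$ is the colimit of the kernels of the iterated comultiplications $\overline\Delta^{(n)}:\overline C\to\overline C^{\otimes n}$, $n\ge2$. Morphisms are coalgebra morphisms compatible with augmentations, counits and codifferentials. For such $C$ and $A$, let $\mathrm{Hom}^\bullet_k(C,A)$ be the graded module of homogeneous $k$-linear maps; it is an $A_{[0,\infty[}$-algebra with $b_0=m_0\eta$, $b_1(f)=m_1f-(-1)^{|f|}fd_C$, $b_n(f_1,\dots,f_n)=m_n(f_1\otimes\dots\otimes f_n)\Delta^{(n)}$ for $n\ge2$, where $\Delta^{(n)}:C\to C^{\otimes n}$ is the iterated comultiplication. The set $\mathsf{Tw}(C,A)$ of twisting cochains consists of the $\tau\in\mathrm{Hom}^1_k(C,A)$ with $\tau\varepsilon=0$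 and $\sum_{n\ge0}b_n(\tau^{\otimes n})=0$ (pointwise a finite sum). It is contravariantly functorial in $C$ by precomposition and covariant in $A$: a morphism $f:A\to A'$ induces the map $\mathsf{Tw}(C,A)\to\mathsf{Tw}(C,A')$ obtained by applying the components $f_i$ of $f$ to $\tau^{\otimes i}\Delta^{(i)}$ and summing over $i\ge1$, that is $\tau\mapsto\sum_{i\ge1}f_i\,\tau^{\otimes i}\Delta^{(i)}$ up to the usual sign conventions of $A_\infty$-theory. *)

(* Defs.v *)
From HB Require Import structures.
From mathcomp Require Import all_boot all_order all_algebra.
From mathcomp Require Import boolp.

Set Implicit Arguments.
Unset Strict Implicit.
Unset Printing Implicit Defensive.

Import GRing.Theory.
Local Open Scope ring_scope.
Local Open Scope quotient_scope.

Section Cokernel.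
Variables (k : comPzRingType) (U V : lmodType k) (f : {linear U -> V}).

Definition im_pred : {pred V} := fun x => `[< exists u, x = f u >].

Lemma im_pred_closed : zmod_closed im_pred.
Proof.
split; first by apply/asboolP; exists 0; rewrite raddf0.
move=> _ _ /asboolP[u ->] /asboolP[v ->]; apply/asboolP.
by exists (u - v); rewrite raddfB.
Qed.

HB.instance Definition _ := GRing.isZmodClosed.Build V im_pred im_pred_closed.

Definition coker : Type := Quotient.quot im_pred.
HB.instance Definition _ := GRing.Zmodule.on coker.
HB.instance Definition _ := Quotient.on coker.

Definition coker_pi (x : V) : coker := \pi_(Quotient.quot im_pred) x.

Lemma coker_piP x y : reflect (exists u, x - y = f u) (coker_pi x == coker_pi y).
Proof. by rewrite /coker_pi -Quotient.idealrBE; apply: asboolP. Qed.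

Definition coker_scale (a : k) (x : coker) : coker := coker_pi (a *: repr x).

Lemma coker_reprK (x : coker) : coker_pi (repr x) = x.
Proof. exact: reprK. Qed.

Lemma coker_piB : zmod_morphism coker_pi.
Proof. by move=> x y; rewrite /coker_pi raddfB. Qed.

Lemma coker_piD x y : coker_pi (x + y) = coker_pi x + coker_pi y.
Proof. by rewrite /coker_pi raddfD. Qed.

Lemma coker_pi_scale a x : coker_scale a (coker_pi x) = coker_pi (a *: x).
Proof.
apply/eqP/coker_piP.
have /eqP/coker_piP[u hu] := coker_reprK (coker_pi x).
by exists (a *: u); rewrite -scalerBr hu linearZ.
Qed.

Fact coker_scaleA a b x :
  coker_scale a (coker_scale b x) = coker_scale (a * b) x.
Proof. by rewrite -[x]coker_reprK !coker_pi_scale scalerA. Qed.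
Fact coker_scale1 : left_id 1 coker_scale.
Proof. by move=> x; rewrite -[x]coker_reprK coker_pi_scale scale1r. Qed.
Fact coker_scaleDr : right_distributive coker_scale +%R.
Proof.
move=> a x y; rewrite -[x]coker_reprK -[y]coker_reprK -coker_piD.
by rewrite !coker_pi_scale scalerDr coker_piD.
Qed.
Fact coker_scaleDl x : {morph coker_scale^~ x : a b / a + b}.
Proof.
by move=> a b; rewrite -[x]coker_reprK !coker_pi_scale scalerDl coker_piD.
Qed.

HB.instance Definition _ := GRing.Zmodule_isLmodule.Build k coker
  coker_scaleA coker_scale1 coker_scaleDr coker_scaleDl.

End Cokernel.

Section TensorPower.
Variables (k : comPzRingType) (V : lmodType k) (n : nat).

Definition fsum := seq (k * n.-tuple V).

Definition fsum_eval (W : lmodType k) (g : n.-tuple V -> W) (s : fsum) : W :=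
  \sum_(y <- s) y.1 *: g y.2.

Definition tset (t : n.-tuple V) (i : 'I_n) (x : V) : n.-tuple V :=
  [tuple if j == i then x else tnth t j | j < n].

Definition tmultilinear (W : lmodType k) (g : n.-tuple V -> W) : Prop :=
  forall t i a x y,
    g (tset t i (a *: x + y)) = a *: g (tset t i x) + g (tset t i y).

(* Two formal combinations represent the same tensor iff no multilinear map   *)
(* separates them, i.e. iff they agree modulo the multilinearity relations.   *)
Definition tequiv (s t : fsum) : bool :=
  `[< forall (W : lmodType k) (g : n.-tuple V -> W),
        tmultilinear g -> fsum_eval g s = fsum_eval g t >].

Lemma tequiv_is_equiv : equiv_class_of tequiv.
Proof.
split=> [s|s t|t s u]; first exact/asboolP.
  by apply/asboolP/asboolP => h W g hg; rewrite h.
by move=> /asboolP h1 /asboolP h2; apply/asboolP => W g hg; rewrite h1 ?h2.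
Qed.

Canonical tequiv_equiv := EquivRelPack tequiv_is_equiv.
Canonical tequiv_encModRel := defaultEncModRel tequiv.

(* The n-th tensor power of V over k (with V^{(x) 0} = k). *)
Definition tpow : Type := {eq_quot tequiv}.
HB.instance Definition _ : EqQuotient fsum tequiv tpow := EqQuotient.on tpow.
HB.instance Definition _ := Choice.on tpow.

Definition tpi (s : fsum) : tpow := \pi_tpow s.

Lemma tpiP s t :
  (forall (W : lmodType k) (g : n.-tuple V -> W),
     tmultilinear g -> fsum_eval g s = fsum_eval g t) <-> tpi s = tpi t.
Proof.
by split=> [h|/eqmodP/asboolP//]; apply/eqmodP/asboolP.
Qed.

Lemma trepr_eval (W : lmodType k) (g : n.-tuple V -> W) s :
  tmultilinear g -> fsum_eval g (repr (tpi s)) = fsum_eval g s.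
Proof. by move=> hg; have /tpiP -> := reprK (tpi s). Qed.

Lemma fsum_eval_cat (W : lmodType k) (g : n.-tuple V -> W) s t :
  fsum_eval g (s ++ t) = fsum_eval g s + fsum_eval g t.
Proof. by rewrite /fsum_eval big_cat. Qed.

Definition fscale (a : k) (s : fsum) : fsum := [seq (a * y.1, y.2) | y <- s].

Lemma fsum_eval_scale (W : lmodType k) (g : n.-tuple V -> W) a s :
  fsum_eval g (fscale a s) = a *: fsum_eval g s.
Proof.
rewrite /fsum_eval big_map scaler_sumr; apply: eq_bigr => y _.
by rewrite scalerA.
Qed.

Definition tadd (x y : tpow) : tpow := tpi (repr x ++ repr y).
Definition tscale (a : k) (x : tpow) : tpow := tpi (fscale a (repr x)).

Lemma tpi_add s t : tadd (tpi s) (tpi t) = tpi (s ++ t).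
Proof. by apply/tpiP => W g hg; rewrite !fsum_eval_cat !trepr_eval. Qed.

Lemma tpi_scale a s : tscale a (tpi s) = tpi (fscale a s).
Proof. by apply/tpiP => W g hg; rewrite !fsum_eval_scale trepr_eval. Qed.

Lemma treprK (x : tpow) : tpi (repr x) = x. Proof. exact: reprK. Qed.

Fact taddA : associative tadd.
Proof.
move=> x y z; rewrite -[x]treprK -[y]treprK -[z]treprK !tpi_add.
by rewrite catA.
Qed.
Fact taddC : commutative tadd.
Proof.
move=> x y; rewrite -[x]treprK -[y]treprK !tpi_add.
by apply/tpiP => W g hg; rewrite !fsum_eval_cat addrC.
Qed.
Fact tadd0 : left_id (tpi [::]) tadd.
Proof. by move=> x; rewrite -[x]treprK tpi_add. Qed.
Fact taddN : left_inverse (tpi [::]) (tscale (-1)) tadd.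
Proof.
move=> x; rewrite -[x]treprK tpi_scale tpi_add.
apply/tpiP => W g hg.
by rewrite fsum_eval_cat fsum_eval_scale scaleN1r addNr /fsum_eval big_nil.
Qed.

HB.instance Definition _ := GRing.isZmodule.Build tpow taddA taddC tadd0 taddN.

Fact tscaleA a b x : tscale a (tscale b x) = tscale (a * b) x.
Proof.
rewrite -[x]treprK !tpi_scale; apply/tpiP => W g hg.
by rewrite !fsum_eval_scale scalerA.
Qed.
Fact tscale1 : left_id 1 tscale.
Proof.
move=> x; rewrite -[x]treprK tpi_scale; apply/tpiP => W g hg.
by rewrite fsum_eval_scale scale1r.
Qed.
Fact tscaleDr : right_distributive tscale +%R.
Proof.
move=> a x y; rewrite -[x]treprK -[y]treprK [_ + _]tpi_add !tpi_scale.
rewrite [RHS]tpi_add; apply/tpiP => W g hg.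
by rewrite !(fsum_eval_cat, fsum_eval_scale) scalerDr.
Qed.
Fact tscaleDl x : {morph tscale^~ x : a b / a + b}.
Proof.
move=> a b; rewrite -[x]treprK !tpi_scale [RHS]tpi_add; apply/tpiP => W g hg.
by rewrite !(fsum_eval_cat, fsum_eval_scale) scalerDl.
Qed.

HB.instance Definition _ := GRing.Zmodule_isLmodule.Build k tpow
  tscaleA tscale1 tscaleDr tscaleDl.

Lemma tpiD s t : tpi s + tpi t = tpi (s ++ t).
Proof. exact: tpi_add. Qed.

Lemma tpiZ a s : a *: tpi s = tpi (fscale a s).
Proof. exact: tpi_scale. Qed.

Definition tpure (t : n.-tuple V) : tpow := tpi [:: (1, t)].

(* The linear map on tensors induced by a multilinear map g; it is evaluated  *)
(* on a representative, hence meaningful only when g is multilinear.          *)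
Definition tlift (W : lmodType k) (g : n.-tuple V -> W) (x : tpow) : W :=
  fsum_eval g (repr x).

Lemma tlift_is_linear (W : lmodType k) (g : n.-tuple V -> W) :
  tmultilinear g -> linear (tlift g).
Proof.
move=> hg a x y; rewrite /tlift -[x]treprK -[y]treprK.
rewrite tpiZ tpiD !trepr_eval //.
by rewrite fsum_eval_cat fsum_eval_scale.
Qed.

Lemma tlift_pure (W : lmodType k) (g : n.-tuple V -> W) t :
  tmultilinear g -> tlift g (tpure t) = g t.
Proof.
by move=> hg; rewrite /tlift trepr_eval // /fsum_eval big_seq1 scale1r.
Qed.

Lemma tpow_sum (x : tpow) : x = \sum_(y <- repr x) y.1 *: tpure y.2.
Proof.
rewrite -[LHS]treprK; move: (repr x : fsum) => s.
elim: s => [|y s IH]; first exact/esym/big_nil.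
rewrite big_cons -IH tpiZ tpiD.
by apply/tpiP => W g hg; rewrite /fsum_eval !big_cons /= mulr1.
Qed.

Lemma tpow_ext (W : lmodType k) (f g : {linear tpow -> W}) :
  (forall t, f (tpure t) = g (tpure t)) -> f =1 g.
Proof.
move=> fg x; rewrite (tpow_sum x) !linear_sum; apply: eq_bigr => y _.
by rewrite !linearZ /= fg.
Qed.

Lemma tpure_multilinear : tmultilinear tpure.
Proof.
move=> t i a x y; rewrite tpiZ tpiD.
apply/tpiP => W g hg.
by rewrite /fsum_eval !(big_cons, big_nil) /= !(mulr1, scale1r, addr0) hg.
Qed.

End TensorPower.

Section TensorMap.
Variables (k : comPzRingType) (n : nat).

Definition tmap (V W : lmodType k) (f : V -> W) : tpow V n -> tpow W n :=
  tlift (fun t => tpure (map_tuple f t)).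

Lemma map_tset (V W : lmodType k) (f : V -> W) (t : n.-tuple V) i x :
  map_tuple f (tset t i x) = tset (map_tuple f t) i (f x).
Proof. apply/eq_from_tnth => j; rewrite tnth_map !tnth_mktuple tnth_map.
by case: (j == i).
Qed.

Lemma tmap_multilinear (V W : lmodType k) (f : {linear V -> W}) :
  tmultilinear (fun t : n.-tuple V => tpure (map_tuple f t)).
Proof. by move=> t i a x y; rewrite !map_tset linearP tpure_multilinear. Qed.

Lemma tmap_is_linear (V W : lmodType k) (f : {linear V -> W}) :
  linear (tmap f).
Proof. exact/tlift_is_linear/tmap_multilinear. Qed.

HB.instance Definition _ (V W : lmodType k) (f : {linear V -> W}) :=
  GRing.isLinear.Build k (tpow V n) (tpow W n) _ (tmap f) (tmap_is_linear f).

Lemma tmap_pure (V W : lmodType k) (f : {linear V -> W}) t :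
  tmap f (tpure t) = tpure (map_tuple f t).
Proof. exact/tlift_pure/tmap_multilinear. Qed.

Lemma tmap_id (V : lmodType k) (x : tpow V n) : tmap idfun x = x.
Proof.
apply: (@tpow_ext _ _ _ _ (tmap idfun) idfun) => t /=.
by rewrite (tmap_pure idfun); congr tpure; apply: val_inj; rewrite /= map_id.
Qed.

Lemma tmap_comp (U V W : lmodType k) (g : {linear V -> W}) (f : {linear U -> V})
  (x : tpow U n) : tmap (g \o f) x = tmap g (tmap f x).
Proof.
apply: (@tpow_ext _ _ _ _ (tmap (g \o f)) (tmap g \o tmap f)) => t /=.
rewrite (tmap_pure (g \o f)) !tmap_pure; congr tpure.
by apply: val_inj; rewrite /= map_comp.
Qed.

End TensorMap.

Section Graded.
Variable k : comPzRingType.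

(* A Z-graded module is given by its total module V = (+)_p V_p together with *)
(* the projections onto the homogeneous components.                           *)
Record gmod := GMod {
  gcar :> lmodType k;
  gproj : int -> {linear gcar -> gcar};
  gprojE : forall p q x, gproj p (gproj q x) = if p == q then gproj q x else 0;
  gproj_sum : forall x, exists s : seq int, uniq s /\ x = \sum_(p <- s) gproj p x
}.

Definition homog (V : gmod) (p : int) (x : V) : bool := gproj V p x == x.

Definition has_degree (V W : gmod) (e : int) (f : V -> W) : Prop :=
  forall p x, homog p x -> homog (p + e) (f x).

Definition thomog (V : gmod) (n : nat) (p : int) (x : tpow V n) : Prop :=
  exists2 s : seq (k * n.-tuple V), x = \sum_(y <- s) y.1 *: tpure y.2 &
    forall y, y \in s -> exists2 e : 'I_n -> int,
      \sum_i e i = p & forall i, homog (e i) (tnth y.2 i).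

Definition gsupp (V : gmod) (x : V) : seq int := sval (cid (gproj_sum x)).

(* The sign produced when a map of degree e moves past x, extended additively *)
(* from homogeneous x, where it is (-1)^(e |x|).                              *)
Definition ksgn (V : gmod) (e : int) (x : V) : V :=
  \sum_(p <- gsupp x) (-1) ^+ `|(e * p)%R|%N *: gproj V p x.

Lemma ksgn_homog (V : gmod) (e p : int) (x : V) :
  homog p x -> ksgn e x = (-1) ^+ `|(e * p)%R|%N *: x.
Proof.
move=> /eqP hx; rewrite /ksgn /gsupp; case: cid => s /= [us hs].
have hq q : gproj V q x = if q == p then x else 0 by rewrite -hx gprojE hx.
rewrite [in RHS]hs scaler_sumr; apply: eq_bigr => q _; rewrite hq.
by case: eqP => [->|]; rewrite ?scaler0.
Qed.

(* (f_1 (x) ... (x) f_r)(t_1 (x) ... (x) t_r), where fs lists the pairs       *)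
(* (|f_u|, f_u): t_u picks up the sign for all the maps on its right. The     *)
(* arguments are either vectors (sgn := ksgn) or words (sgn := wsgn).         *)
Fixpoint ktens (T W : Type) (sgn : int -> T -> T)
    (fs : seq (int * (T -> W))) (ts : seq T) : seq W :=
  match fs, ts with
  | f :: fs', t :: ts' => f.2 (sgn (\sum_(g <- fs') g.1) t) :: ktens sgn fs' ts'
  | _, _ => [::]
  end.

Definition wsgn (V : gmod) (e : int) (w : seq V) : seq V := map (ksgn e) w.

(* A family of maps g_i : V^{(x) i} -> W, i >= 0, is encoded by a single      *)
(* function g on words, g_i being its restriction to words of length i.       *)
Definition multilinear (V W : gmod) (g : seq V -> W) : Prop :=
  forall s t a x y,
    g (s ++ (a *: x + y) :: t) = a *: g (s ++ x :: t) + g (s ++ y :: t).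

Definition multi_degree (V W : gmod) (e : nat -> int) (g : seq V -> W) : Prop :=
  forall w : seq (int * V), all (fun y => homog y.1 y.2) w ->
    homog (\sum_(y <- w) y.1 + e (size w)) (g [seq y.2 | y <- w]).

(* sum over j + n + l = p of                                                  *)
(*   (-1)^(jn + l) g_(j+1+l) (1^{(x) j} (x) m_n (x) 1^{(x) l})                *)
(* evaluated at the word s of length p, for m_n of degree 2 - n.              *)
Definition insert_sum (V W : gmod) (g : seq V -> W) (m : seq V -> V)
    (s : seq V) : W :=
  let p := size s in
  \sum_(j < p.+1) \sum_(n < p.+1 | (j + n <= p)%N)
    (-1) ^+ (j * n + (p - j - n))%N *:
      g (wsgn (2%:Z - n%:Z) (take j s)
           ++ m (take n (drop j s)) :: drop (j + n) s).

(* The exponent sum_(2 <= u <= r) (1 - i_u) sum_(v < u) i_v; indices of the   *)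
(* sequence start at 0 and the term of index 0 vanishes.                      *)
Definition block_sign (i : seq nat) : int :=
  \sum_(u < size i) (1 - (nth 0%N i u)%:Z) * (sumn (take u i))%:Z.

(* sum over r and i_1 + ... + i_r = p, all i_u >= 1, of                       *)
(*   (-1)^s g_r (f_(i_1) (x) ... (x) f_(i_r))                                 *)
(* evaluated at the word s of length p, for f_i of degree 1 - i. The empty    *)
(* word has the single decomposition r = 0, with value g_0.                   *)
Definition block_sum (V W X : gmod) (g : seq W -> X) (f : seq V -> W)
    (s : seq V) : X :=
  let p := size s in
  \sum_(r < p.+1) \sum_(t : r.-tuple 'I_p.+1 |
      all (fun i : 'I_p.+1 => 0 < i)%N t && (sumn (map val t) == p))
    let i := map val t in
    (-1) ^+ `|block_sign i|%N *:
      g (ktens (@wsgn V) [seq (1 - n%:Z, f) | n <- i] (reshape i s)).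

End Graded.

Section AInf.
Variable k : comPzRingType.

Record ainf := AInf {
  acar :> gmod k;
  amul : seq acar -> acar;
  amul_multilinear : multilinear amul;
  amul_degree : multi_degree (fun n => 2%:Z - n%:Z) amul;
  amul_rel : forall s, insert_sum amul amul s = 0
}.

(* ahom_nil is a normalisation: the family f_i starts at i = 1. *)
Record ainf_hom (A A' : ainf) := AInfHom {
  ahom :> seq A -> A';
  ahom_nil : ahom [::] = 0;
  ahom_multilinear : multilinear ahom;
  ahom_degree : multi_degree (fun n => 1 - n%:Z) ahom;
  ahom_rel : forall s, insert_sum ahom (@amul A) s = block_sum (@amul A') ahom s
}.

(* A morphism is determined by its components, so at most one h satisfies     *)
(* either of the following.                                                   *)
Definition is_ainf_id (A : ainf) (h : ainf_hom A A) : Prop :=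
  forall s, h s = if s is [:: x] then x else 0.

Definition is_ainf_comp (A A' A'' : ainf) (f' : ainf_hom A' A'')
    (f : ainf_hom A A') (h : ainf_hom A A'') : Prop :=
  forall s, h s = block_sum f' f s.

End AInf.

Arguments amul {k} a _.

Section Coalgebra.
Variable k : comPzRingType.

Section Comul.
Variables (V : lmodType k) (D : V -> tpow V 2).

(* comul_l n is D (x) 1^{(x) n}; comul_r is 1 (x) D. *)
Definition comul_l (n : nat) : tpow V n.+1 -> tpow V n.+2 :=
  tlift (fun t : n.+1.-tuple V =>
    tlift (fun u : 2.-tuple V =>
      tpure ([tuple of u ++ behead t] : n.+2.-tuple V)) (D (thead t))).

Definition comul_r : tpow V 2 -> tpow V 3 :=
  tlift (fun t : 2.-tuple V =>
    tlift (fun u : 2.-tuple V => tpure [tuple of thead t :: u])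
      (D (tnth t ord_max))).

(* The iterated comultiplication D^(n+1) : V -> V^{(x) n+1}, with D^(1) = 1   *)
(* and D^(2) = D. *)
Fixpoint iter_comul (n : nat) : V -> tpow V n.+1 :=
  match n with
  | 0 => fun c => tpure [tuple c]
  | n'.+1 => fun c => comul_l (iter_comul n' c)
  end.

End Comul.

(* The comultiplication induced by D on the cokernel of the augmentation. *)
Definition red_comul (V : lmodType k) (e : {linear k^o -> V})
    (D : V -> tpow V 2) (x : coker e) : tpow (coker e) 2 :=
  tmap (coker_pi e) (D (repr x)).

(* k is graded in degree 0; the augmentation ceps need not commute with the   *)
(* differential. In ccocomplete, the kernels of the iterated reduced          *)
(* comultiplications form an increasing chain of submodules, so that their    *)
(* colimit is their union.                                                    *)
Record cgacdg := CgaCdg {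
  ccar :> gmod k;
  cdif : {linear ccar -> ccar};
  comul : {linear ccar -> tpow ccar 2};
  ceps : {linear k^o -> ccar};
  ceta : {linear ccar -> k^o};
  comul_degree : forall p c, homog p c -> thomog p (comul c);
  ceta_degree : forall p c, homog p c -> p != 0 -> ceta c = 0;
  ceps_degree : homog 0 (ceps 1);
  cdif_degree : has_degree 1 cdif;
  comulA : forall c, comul_l comul (comul c) = comul_r comul (comul c);
  counit_l : forall c,
    tlift (fun t : 2.-tuple ccar => ceta (thead t) *: tnth t ord_max)
      (comul c) = c;
  counit_r : forall c,
    tlift (fun t : 2.-tuple ccar => ceta (tnth t ord_max) *: thead t)
      (comul c) = c;
  cdifK : forall c, cdif (cdif c) = 0;
  cdif_coder : forall c, comul (cdif c) =
    tlift (fun t : 2.-tuple ccar =>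
        tpure [tuple cdif (thead t); tnth t ord_max]
        + tpure [tuple ksgn 1 (thead t); cdif (tnth t ord_max)])
      (comul c);
  ceps_comul : comul (ceps 1) = tpure [tuple ceps 1; ceps 1];
  ceps_counit : ceta (ceps 1) = 1;
  ccocomplete : forall x : coker ceps,
    exists2 n, (2 <= n)%N & iter_comul (red_comul comul) n.-1 x = 0
}.

Record cga_hom (C D : cgacdg) := CgaHom {
  chom :> {linear C -> D};
  chom_degree : has_degree 0 chom;
  chom_comul : forall c, comul D (chom c) = tmap chom (comul C c);
  chom_eta : forall c, ceta D (chom c) = ceta C c;
  chom_eps : forall a, chom (ceps C a) = ceps D a;
  chom_dif : forall c, chom (cdif C c) = cdif D (chom c)
}.

Definition cga_id (C : cgacdg) : cga_hom C C.
Proof.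
exists idfun => //= [p x|c]; first by rewrite addr0.
by rewrite tmap_id.
Defined.

Definition cga_comp (C D E : cgacdg) (g : cga_hom D E) (f : cga_hom C D) :
  cga_hom C E.
Proof.
exists (g \o f) => [p x hx|c|c|a|c] /=.
- by rewrite -[p + 0]addr0; apply/(chom_degree g)/(chom_degree f).
- by rewrite !chom_comul tmap_comp.
- by rewrite !chom_eta.
- by rewrite !chom_eps.
- by rewrite !chom_dif.
Defined.

End Coalgebra.

Section Twisting.
Variable k : comPzRingType.

(* The operation b_n (f_1, ..., f_n) of the A-infinity algebra Hom(C, A); fs  *)
(* lists the pairs (|f_u|, f_u) and n = size fs.                              *)
Definition hom_mul (C : cgacdg k) (A : ainf k) (fs : seq (int * (C -> A)))
    (c : C) : A :=
  match fs with
  | [::] => ceta C c *: amul A [::]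
  | [:: f] => amul A [:: f.2 c] - (-1) ^+ `|f.1|%N *: f.2 (cdif C c)
  | _ :: _ :: fs' =>
      tlift (fun t : (size fs').+2.-tuple C => amul A (ktens (@ksgn k C) fs t))
        (iter_comul (comul C) (size fs').+1 c)
  end.

(* Only finitely many terms of the series u are nonzero and their sum is x. *)
Definition fin_sum (V : nmodType) (u : nat -> V) (x : V) : Prop :=
  exists2 N : nat, (forall n, (N <= n)%N -> u n = 0) & x = \sum_(n < N) u n.

Record tw (C : cgacdg k) (A : ainf k) := Tw {
  twf :> {linear C -> A};
  tw_degree : has_degree 1 twf;
  tw_eps : forall a, twf (ceps C a) = 0;
  tw_eq : forall c,
    fin_sum (fun n => hom_mul (nseq n (1%:Z, twf : C -> A)) c) 0
}.

(* t' is the image of t under the map Tw(C, A) -> Tw(C, A') induced by f:     *)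
(* t' = sum_(i >= 1) f_i t^{(x) i} Delta^(i), the i-th term being indexed by  *)
(* i - 1. With these sign conventions for A-infinity algebras and their       *)
(* morphisms, only the Koszul signs of t^{(x) i} occur.                       *)
Definition tw_push (C : cgacdg k) (A A' : ainf k) (f : ainf_hom A A')
    (t : tw C A) (t' : tw C A') : Prop :=
  forall c, fin_sum (fun n =>
    tlift (fun v : n.+1.-tuple C =>
        f (ktens (@ksgn k C) (nseq n.+1 (1%:Z, t : C -> A)) v))
      (iter_comul (comul C) n c)) (t' c).

(* theta is an isomorphism of functors from CgaCdg(?, B) to Tw(?, A). *)
Definition represents_tw (A : ainf k) (B : cgacdg k)
    (theta : forall C, cga_hom C B -> tw C A) : Prop :=
  (forall C, bijective (theta C)) /\
  (forall (C C' : cgacdg k) (phi : cga_hom C B) (psi : cga_hom C' C) (c : C'),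
     theta C' (cga_comp phi psi) c = theta C phi (psi c)).

(* In both laws h is unique; its existence says that the identity family and  *)
(* the composite family are morphisms of A-infinity algebras.                 *)
Definition is_ainf_functor (B : ainf k -> cgacdg k)
    (F : forall A A', ainf_hom A A' -> cga_hom (B A) (B A')) : Prop :=
  (forall A, exists2 h : ainf_hom A A, is_ainf_id h & F A A h = cga_id (B A)) /\
  (forall (A A' A'' : ainf k) (f' : ainf_hom A' A'') (f : ainf_hom A A'),
     exists2 h : ainf_hom A A'',
       is_ainf_comp f' f h & F A A'' h = cga_comp (F A' A'' f') (F A A' f)).

Definition fully_faithful (B : ainf k -> cgacdg k)
    (F : forall A A', ainf_hom A A' -> cga_hom (B A) (B A')) : Prop :=
  forall A A', bijective (F A A').

Definition natural_in_ainf (B : ainf k -> cgacdg k)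
    (theta : forall A C, cga_hom C (B A) -> tw C A)
    (F : forall A A', ainf_hom A A' -> cga_hom (B A) (B A')) : Prop :=
  forall (A A' : ainf k) (f : ainf_hom A A') (C : cgacdg k)
    (phi : cga_hom C (B A)),
    tw_push f (theta A C phi) (theta A' C (cga_comp (F A A' f) phi)).

End Twisting.

(* Main.v *)
Require Import Defs.
From HB Require Import structures.
From mathcomp Require Import all_boot all_order all_algebra.
From mathcomp Require Import boolp zify ring.

(** Let [SA] be the shift of [A]: the same module, with degrees lowered by
one. The bar construction of [A] is the tensor coalgebra [tens SA], with
deconcatenation as comultiplication. Linear maps out of [tens V] are the
multilinear functions of words, so a family of operations (g_i) on [A], one
for each length, is one linear map [ohat A g] out of [tens SA]; precomposing
with the desuspensions makes its degree independent of the length and absorbs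
all signs. The multiplications (m_i) become a map [bar_op : tens SA -> SA] of
degree 1, and the components (f_i) of a morphism become a map of degree 0.

Everything rests on one recursion: a tensor is its scalar part plus the sum,
over its deconcatenations, of the first letter put back in front of the
remainder ([wdecomp]). Two maps into [tens V] that satisfy the same such
recursion agree, by comparing components of increasing length ([corec_uniq]).
Consequently a map tau from a cocomplete coalgebra C to V, of degree 0 and
vanishing on the augmentation, is the letter component of a unique coalgebra
map [Phi], given by Phi c = eta c + sum tau(c_1) :: Phi(c_2); cocompleteness
makes the sum finite ([phin_finite]). In the same way [bar_op] is the letter
component of a coderivation [coder], whose square vanishes as soon as the
letter component of the square does ([coderK]), and this last condition is the
A-infinity relation ([ohat_coder], [bar_op_coder]). Finally [Phi] commutes
with codifferentials if and only if the letter components of both composites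
agree ([Phi_dif]), which is the twisting equation ([tw_eqE]). So coalgebra
maps from C to [bar A] are the twisting cochains on C ([bar_represents]).

For C = bar A this describes the maps from [bar A] to [bar A']: they are the
twisting cochains on [bar A] with values in [A'], that is, families f for
which a certain equation between [coder] and [Phi] holds. Read on words, its
two sides are the two sides of the relation of a morphism ([ohat_coder],
[block_sumE]), so that these families are the morphisms from [A] to [A']
([ainf_relE]); composites of such maps are read off in the same way
([bar_map_word]). Any other choice of representatives is isomorphic to [bar]
compatibly with the universal twisting cochains, and the functor is
transported along these isomorphisms ([bar_functor]). *)

Set Implicit Arguments.
Unset Strict Implicit.
Unset Printing Implicit Defensive.

Import GRing.Theory.
Local Open Scope ring_scope.
Local Open Scope quotient_scope.

(** * Linear maps *)

Section Linear.
Variable k : comPzRingType.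
Implicit Types U V W X : lmodType k.

Definition mklin U V (f : U -> V) (hf : linear f) : {linear U -> V} :=
  HB.pack f (GRing.isLinear.Build k U V *:%R f hf).

Section LinTheory.
Variables (U V : lmodType k) (f : U -> V) (hf : linear f).

Lemma lin0 : f 0 = 0. Proof. exact: (linear0 (mklin hf)). Qed.
Lemma linD x y : f (x + y) = f x + f y.
Proof. exact: (linearD (mklin hf)). Qed.
Lemma linZ a x : f (a *: x) = a *: f x.
Proof. exact: (linearZZ (mklin hf)). Qed.
Lemma linN x : f (- x) = - f x.
Proof. exact: (linearN (mklin hf)). Qed.
Lemma lin_sum I (r : seq I) (P : pred I) (F : I -> U) :
  f (\sum_(i <- r | P i) F i) = \sum_(i <- r | P i) f (F i).
Proof. exact: (linear_sum (mklin hf)). Qed.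

End LinTheory.

Lemma linear_eq_fun U V (f g : {linear U -> V}) : f =1 g -> f = g.
Proof.
move=> /funext; case: f g => [f cf] [g cg] /= fg; subst g.
congr GRing.Linear.Pack.
case: cf cg => [[a1] [b1]] [[a2] [b2]].
by rewrite (Prop_irrelevance a1 a2) (Prop_irrelevance b1 b2).
Qed.

Lemma lin_id U : linear (fun x : U => x).
Proof. by []. Qed.

Lemma lin_comp U V W (g : V -> W) (f : U -> V) :
  linear g -> linear f -> linear (fun x => g (f x)).
Proof. by move=> hg hf a x y; rewrite hf hg. Qed.

Lemma lin_zero U V : linear (fun _ : U => 0 : V).
Proof. by move=> a x y; rewrite scaler0 addr0. Qed.

Lemma lin_add U V (f g : U -> V) :
  linear f -> linear g -> linear (fun x => f x + g x).
Proof. by move=> hf hg a x y; rewrite hf hg scalerDr addrACA. Qed.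

Lemma lin_scale U V b (f : U -> V) : linear f -> linear (fun x => b *: f x).
Proof.
by move=> hf a x y; rewrite hf scalerDr !scalerA mulrC.
Qed.

Lemma lin_opp U V (f : U -> V) : linear f -> linear (fun x => - f x).
Proof. by move=> hf a x y; rewrite hf opprD scalerN. Qed.

Lemma lin_bigsum U V I (r : seq I) (P : pred I) (F : I -> U -> V) :
  (forall i, linear (F i)) -> linear (fun x => \sum_(i <- r | P i) F i x).
Proof.
move=> hF a x y; rewrite scaler_sumr -big_split /=.
by apply: eq_bigr => i _; rewrite hF.
Qed.

Lemma sum_cut (V : nmodType) (u : nat -> V) N m : (N <= m)%N ->
  (forall n, (N <= n)%N -> u n = 0) -> \sum_(n < m) u n = \sum_(n < N) u n.
Proof.
move=> Nm hu; rewrite (big_ord_widen _ _ Nm) [RHS]big_mkcond.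
by apply: eq_bigr => i _; case: ltnP => // /hu.
Qed.

Definition bilinear_map U V W (h : U -> V -> W) : Prop :=
  (forall y, linear (h^~ y)) /\ (forall x, linear (h x)).

Lemma bilin_comp (U U' V V' : lmodType k) W (h : U' -> V' -> W)
  (f : U -> U') (g : V -> V') :
  bilinear_map h -> linear f -> linear g ->
  bilinear_map (fun u v => h (f u) (g v)).
Proof.
by move=> [hl hr] hf hg; split=> [v|u];
  [exact: (lin_comp (hl _) hf) | exact: (lin_comp (hr _) hg)].
Qed.

Lemma bilin_scale U V (f : U -> k^o) :
  linear f -> bilinear_map (fun u (v : V) => f u *: v).
Proof.
move=> hf; split=> [v|u]; last exact: lin_scale.
by move=> a x y; rewrite hf scalerDl scalerA.
Qed.

(** * Sweedler sums *)

Section Tlift.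
Variables (V W X : lmodType k) (n : nat).

Lemma tlift_lin (g : n.-tuple V -> W) (f : W -> X) x :
  linear f -> f (tlift g x) = tlift (fun t => f (g t)) x.
Proof.
move=> hf; rewrite /tlift /fsum_eval (lin_sum hf).
by apply: eq_bigr => y _; rewrite linZ.
Qed.

Lemma tlift_add (g h : n.-tuple V -> W) x :
  tlift (fun t => g t + h t) x = tlift g x + tlift h x.
Proof.
by rewrite /tlift /fsum_eval -big_split; apply: eq_bigr => y _;
  rewrite scalerDr.
Qed.

Lemma tlift_eq (g h : n.-tuple V -> W) x : g =1 h -> tlift g x = tlift h x.
Proof. by move=> gh; apply: eq_bigr => y _; rewrite gh. Qed.

Lemma tlift_param (g : X -> n.-tuple V -> W) x :
  (forall t, linear (g^~ t)) -> linear (fun a => tlift (g a) x).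
Proof. by move=> hg; apply: lin_bigsum => y; apply: lin_scale. Qed.

End Tlift.

(** Both sides are the same finite double sum over chosen representatives. *)
Lemma tlift_exchange U V W m n (G : m.-tuple U -> n.-tuple V -> W) x y :
  tlift (fun s => tlift (fun t => G s t) y) x =
  tlift (fun t => tlift (fun s => G s t) x) y.
Proof.
rewrite /tlift /fsum_eval.
under eq_bigr do rewrite scaler_sumr.
rewrite exchange_big; apply: eq_bigr => t _; rewrite scaler_sumr.
by apply: eq_bigr => s _; rewrite !scalerA mulrC.
Qed.

Definition tens2 V (x y : V) : tpow V 2 := tpure [tuple x; y].

(** At [comul c] this is the Sweedler sum of the h(c_1, c_2). *)
Definition lift2 V W (h : V -> V -> W) : tpow V 2 -> W :=
  tlift (fun t => h (thead t) (tnth t ord_max)).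

Section Sweedler.
Variable V : lmodType k.

Lemma tuple2_eta (t : 2.-tuple V) : t = [tuple thead t; tnth t ord_max].
Proof.
case/tupleP: t => x t; case/tupleP: t => y t; rewrite (tuple0 t).
by apply: eq_from_tnth => i; case: i => [[|[|i]] hi].
Qed.

Lemma tmulti2 W (h : V -> V -> W) : bilinear_map h ->
  tmultilinear (fun t : 2.-tuple V => h (thead t) (tnth t ord_max)).
Proof.
move=> [h1 h2] t [[|[|i]] hi] a x y //; rewrite /thead !tnth_mktuple /=.
- exact: h1.
- exact: h2.
Qed.

Lemma lift2_pure W (h : V -> V -> W) x y : bilinear_map h ->
  lift2 h (tens2 x y) = h x y.
Proof. by move=> hh; rewrite /lift2 tlift_pure //; apply: tmulti2. Qed.

Lemma lift2_is_linear W (h : V -> V -> W) : bilinear_map h -> linear (lift2 h).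
Proof. by move=> hh; apply/tlift_is_linear/tmulti2. Qed.

Lemma lift2_lin W (X : lmodType k) (h : V -> V -> W)
  (f : W -> X) x : linear f ->
  f (lift2 h x) = lift2 (fun u v => f (h u v)) x.
Proof. exact: tlift_lin. Qed.

Lemma lift2_add W (g h : V -> V -> W) x :
  lift2 (fun u v => g u v + h u v) x = lift2 g x + lift2 h x.
Proof. exact: tlift_add. Qed.

Lemma lift2_sub W (g h : V -> V -> W) x :
  lift2 (fun u v => g u v - h u v) x = lift2 g x - lift2 h x.
Proof.
rewrite lift2_add; congr (_ + _).
exact/esym/(lift2_lin h x (lin_opp (@lin_id W))).
Qed.

Lemma lift2_eq W (g h : V -> V -> W) x : g =2 h -> lift2 g x = lift2 h x.
Proof. by move=> gh; apply: tlift_eq => t; apply: gh. Qed.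

Lemma lift2_0 W x : lift2 (fun _ _ : V => 0 : W) x = 0.
Proof. by rewrite /lift2 /tlift /fsum_eval big1 // => y _; rewrite scaler0. Qed.

Lemma lift2_param (U : lmodType k) W (g : U -> V -> V -> W) x :
  (forall u v, linear (fun a => g a u v)) -> linear (fun a => lift2 (g a) x).
Proof. by move=> hg; apply: tlift_param. Qed.

Lemma lift2_id x : lift2 (@tens2 V) x = x.
Proof.
rewrite [RHS]tpow_sum; apply: eq_bigr => y _.
by rewrite /tens2 -tuple2_eta.
Qed.

Lemma tens2_bilinear : bilinear_map (@tens2 V).
Proof.
have hp := @tpure_multilinear k V 2.
have e0 (x y z : V) : tset [tuple x; y] ord0 z = [tuple z; y].
  by apply: eq_from_tnth => -[[|[|i]] hi] //; rewrite tnth_mktuple.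
have e1 (x y z : V) : tset [tuple x; y] ord_max z = [tuple x; z].
  by apply: eq_from_tnth => -[[|[|i]] hi] //; rewrite tnth_mktuple.
split=> [y|y] a u v; first by have := hp [tuple u; y] ord0 a u v; rewrite !e0.
by have := hp [tuple y; u] ord_max a u v; rewrite !e1.
Qed.

End Sweedler.

Lemma lift2_tmap (V V' : lmodType k) W (f : {linear V -> V'})
  (h : V' -> V' -> W) x :
  bilinear_map h ->
  lift2 h (tmap f x) = lift2 (fun u v => h (f u) (f v)) x.
Proof.
move=> hh; rewrite /tmap (tlift_lin _ _ (lift2_is_linear hh)).
apply: tlift_eq => t; rewrite [map_tuple _ _]tuple2_eta.
by rewrite -/(tens2 _ _) lift2_pure // /thead !tnth_map.
Qed.

(** ** Coassociativity *)

Section Coassoc.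
Variables (V : lmodType k) (D : V -> tpow V 2).

Definition trilinear W (h : V -> V -> V -> W) : Prop :=
  [/\ forall y z, linear (fun x => h x y z),
      forall x z, linear (fun y => h x y z) & forall x y, linear (h x y)].

(** Coassociativity tested on trilinear maps, the form used in Sweedler
computations. *)
Definition coassociative := forall W (h : V -> V -> V -> W), trilinear h ->
  forall c, lift2 (fun a b => lift2 (fun a1 a2 => h a1 a2 b) (D a)) (D c) =
    lift2 (fun a b => lift2 (fun b1 b2 => h a b1 b2) (D b)) (D c).

Definition tens3 (x y z : V) : tpow V 3 := tpure [tuple x; y; z].

Let i1 : 'I_3 := inord 1.
Definition lift3 W (h : V -> V -> V -> W) : tpow V 3 -> W :=
  tlift (fun t => h (thead t) (tnth t i1) (tnth t ord_max)).

Lemma tmulti3 W (h : V -> V -> V -> W) : trilinear h ->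
  tmultilinear (fun t : 3.-tuple V => h (thead t) (tnth t i1) (tnth t ord_max)).
Proof.
move=> [h1 h2 h3] t i a x y; rewrite /thead !tnth_mktuple.
have -> : i1 = Ordinal (isT : 1 < 3)%N by apply: val_inj; rewrite /= inordK.
case: i => [[|[|[|i]]] hi] //=; [exact: h1 | exact: h2 | exact: h3].
Qed.

Lemma lift3_pure W (h : V -> V -> V -> W) x y z : trilinear h ->
  lift3 h (tens3 x y z) = h x y z.
Proof.
move=> hh; rewrite /lift3 tlift_pure; last exact: tmulti3.
by congr h; rewrite (tnth_nth x) /= inordK.
Qed.

Lemma tens3_trilinear : trilinear tens3.
Proof.
have hp := @tpure_multilinear k V 3.
have e0 (x y z t : V) : tset [tuple x; y; z] ord0 t = [tuple t; y; z].
  by apply: eq_from_tnth => -[[|[|[|i]]] hi] //; rewrite tnth_mktuple.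
have e1 (x y z t : V) :
    tset [tuple x; y; z] (Ordinal (isT : 1 < 3)%N) t = [tuple x; t; z].
  by apply: eq_from_tnth => -[[|[|[|i]]] hi] //; rewrite tnth_mktuple.
have e2 (x y z t : V) : tset [tuple x; y; z] ord_max t = [tuple x; y; t].
  by apply: eq_from_tnth => -[[|[|[|i]]] hi] //; rewrite tnth_mktuple.
split=> y z a u v.
- by have := hp [tuple u; y; z] ord0 a u v; rewrite !e0.
- by have := hp [tuple y; u; z] (Ordinal (isT : 1 < 3)%N) a u v; rewrite !e1.
- by have := hp [tuple y; z; u] ord_max a u v; rewrite !e2.
Qed.

Lemma comul_lE x :
  comul_l D (n := 1) x =
  lift2 (fun a b => lift2 (fun a1 a2 => tens3 a1 a2 b) (D a)) x.
Proof.
apply: tlift_eq => t; apply: tlift_eq => u; congr tpure; apply: val_inj => /=.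
by rewrite {1}(tuple2_eta t) {1}(tuple2_eta u).
Qed.

Lemma comul_rE x :
  comul_r D x = lift2 (fun a b => lift2 (fun b1 b2 => tens3 a b1 b2) (D b)) x.
Proof.
apply: tlift_eq => t; apply: tlift_eq => u; congr tpure; apply: val_inj => /=.
by rewrite {1}(tuple2_eta u).
Qed.

Lemma coassocP :
  coassociative <-> (forall c, comul_l D (n := 1) (D c) = comul_r D (D c)).
Proof.
split=> [hc c|hc W h hh c].
  by rewrite comul_lE comul_rE hc //; apply: tens3_trilinear.
have hl : linear (lift3 h) by apply/tlift_is_linear/tmulti3.
have := congr1 (lift3 h) (hc c); rewrite comul_lE comul_rE !(lift2_lin _ _ hl).
move=> e; transitivity (lift2
    (fun u v => lift3 h (lift2 (fun a1 a2 => tens3 a1 a2 v) (D u))) (D c)).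
  by apply: lift2_eq => a b; rewrite (lift2_lin _ _ hl); apply: lift2_eq => x y;
    rewrite lift3_pure.
rewrite e; apply: lift2_eq => a b; rewrite (lift2_lin _ _ hl).
by apply: lift2_eq => x y; rewrite lift3_pure.
Qed.

End Coassoc.
End Linear.

(** * The tensor coalgebra *)

Section TensorModule.
Variables (k : comPzRingType) (V : lmodType k).

(** The condition [multilinear], for modules without a grading. *)
Definition mlin (W : lmodType k) (g : seq V -> W) : Prop :=
  forall s t a x y,
    g (s ++ (a *: x + y) :: t) = a *: g (s ++ x :: t) + g (s ++ y :: t).

Definition wsum := seq (k * seq V).

Definition weval (W : lmodType k) (g : seq V -> W) (s : wsum) : W :=
  \sum_(y <- s) y.1 *: g y.2.

Definition wequiv (s t : wsum) : bool :=
  `[< forall (W : lmodType k) (g : seq V -> W),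
        mlin g -> weval g s = weval g t >].

Lemma wequiv_is_equiv : equiv_class_of wequiv.
Proof.
split=> [s|s t|t s u]; first exact/asboolP.
  by apply/asboolP/asboolP => h W g hg; rewrite h.
by move=> /asboolP h1 /asboolP h2; apply/asboolP => W g hg; rewrite h1 ?h2.
Qed.

Canonical wequiv_equiv := EquivRelPack wequiv_is_equiv.
Canonical wequiv_encModRel := defaultEncModRel wequiv.

(** All tensor powers of V at once: words modulo the multilinearity relations,
so that linear maps out of [tens] are multilinear functions of words. *)
Definition tens : Type := {eq_quot wequiv}.
HB.instance Definition _ : EqQuotient wsum wequiv tens := EqQuotient.on tens.
HB.instance Definition _ := Choice.on tens.

Definition wpi (s : wsum) : tens := \pi_tens s.

Lemma wpiP s t :
  (forall (W : lmodType k) (g : seq V -> W),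
     mlin g -> weval g s = weval g t) <-> wpi s = wpi t.
Proof. by split=> [h|/eqmodP/asboolP//]; apply/eqmodP/asboolP. Qed.

Lemma wrepr_eval (W : lmodType k) (g : seq V -> W) s :
  mlin g -> weval g (repr (wpi s)) = weval g s.
Proof. by move=> hg; have /wpiP -> := reprK (wpi s). Qed.

Lemma wreprK (x : tens) : wpi (repr x) = x. Proof. exact: reprK. Qed.

Lemma weval_cat (W : lmodType k) (g : seq V -> W) s t :
  weval g (s ++ t) = weval g s + weval g t.
Proof. by rewrite /weval big_cat. Qed.

Definition wscale (a : k) (s : wsum) : wsum := [seq (a * y.1, y.2) | y <- s].

Lemma weval_scale (W : lmodType k) (g : seq V -> W) a s :
  weval g (wscale a s) = a *: weval g s.
Proof.
rewrite /weval big_map scaler_sumr; apply: eq_bigr => y _.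
by rewrite scalerA.
Qed.

Definition tens_add (x y : tens) : tens := wpi (repr x ++ repr y).
Definition tens_scale (a : k) (x : tens) : tens := wpi (wscale a (repr x)).

Lemma wpi_add s t : tens_add (wpi s) (wpi t) = wpi (s ++ t).
Proof. by apply/wpiP => W g hg; rewrite !weval_cat !wrepr_eval. Qed.

Lemma wpi_scale a s : tens_scale a (wpi s) = wpi (wscale a s).
Proof. by apply/wpiP => W g hg; rewrite !weval_scale wrepr_eval. Qed.

Fact tens_addA : associative tens_add.
Proof.
by move=> x y z; rewrite -[x]wreprK -[y]wreprK -[z]wreprK !wpi_add catA.
Qed.
Fact tens_addC : commutative tens_add.
Proof.
move=> x y; rewrite -[x]wreprK -[y]wreprK !wpi_add.
by apply/wpiP => W g hg; rewrite !weval_cat addrC.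
Qed.
Fact tens_add0 : left_id (wpi [::]) tens_add.
Proof. by move=> x; rewrite -[x]wreprK wpi_add. Qed.
Fact tens_addN : left_inverse (wpi [::]) (tens_scale (-1)) tens_add.
Proof.
move=> x; rewrite -[x]wreprK wpi_scale wpi_add; apply/wpiP => W g hg.
by rewrite weval_cat weval_scale scaleN1r addNr /weval big_nil.
Qed.

HB.instance Definition _ :=
  GRing.isZmodule.Build tens tens_addA tens_addC tens_add0 tens_addN.

Fact tens_scaleA a b x : tens_scale a (tens_scale b x) = tens_scale (a * b) x.
Proof.
rewrite -[x]wreprK !wpi_scale; apply/wpiP => W g hg.
by rewrite !weval_scale scalerA.
Qed.
Fact tens_scale1 : left_id 1 tens_scale.
Proof.
move=> x; rewrite -[x]wreprK wpi_scale; apply/wpiP => W g hg.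
by rewrite weval_scale scale1r.
Qed.
Fact tens_scaleDr : right_distributive tens_scale +%R.
Proof.
move=> a x y; rewrite -[x]wreprK -[y]wreprK [_ + _]wpi_add !wpi_scale.
rewrite [RHS]wpi_add; apply/wpiP => W g hg.
by rewrite !(weval_cat, weval_scale) scalerDr.
Qed.
Fact tens_scaleDl x : {morph tens_scale^~ x : a b / a + b}.
Proof.
move=> a b; rewrite -[x]wreprK !wpi_scale [RHS]wpi_add; apply/wpiP => W g hg.
by rewrite !(weval_cat, weval_scale) scalerDl.
Qed.

HB.instance Definition _ := GRing.Zmodule_isLmodule.Build k tens
  tens_scaleA tens_scale1 tens_scaleDr tens_scaleDl.

Lemma wpiD s t : wpi s + wpi t = wpi (s ++ t). Proof. exact: wpi_add. Qed.
Lemma wpiZ a s : a *: wpi s = wpi (wscale a s). Proof. exact: wpi_scale. Qed.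

Definition word (w : seq V) : tens := wpi [:: (1, w)].

Definition wlift (W : lmodType k) (g : seq V -> W) (x : tens) : W :=
  weval g (repr x).

Section Wlift.
Variables (W : lmodType k) (g : seq V -> W) (hg : mlin g).

Lemma wlift_is_linear : linear (wlift g).
Proof.
move=> a x y; rewrite /wlift -[x]wreprK -[y]wreprK wpiZ wpiD !wrepr_eval //.
by rewrite weval_cat weval_scale.
Qed.

Lemma wlift_word w : wlift g (word w) = g w.
Proof. by rewrite /wlift wrepr_eval // /weval big_seq1 scale1r. Qed.

End Wlift.

Lemma word_mlin : mlin word.
Proof.
move=> s t a x y; rewrite wpiZ wpiD; apply/wpiP => W g hg.
by rewrite /weval !(big_cons, big_nil) /= !(mulr1, scale1r, addr0) hg.
Qed.

Lemma tens_sum (x : tens) : x = \sum_(y <- repr x) y.1 *: word y.2.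
Proof.
rewrite -[LHS]wreprK; move: (repr x : wsum) => s.
elim: s => [|y s IH]; first exact/esym/big_nil.
rewrite big_cons -IH wpiZ wpiD; apply/wpiP => W g hg.
by rewrite /weval !big_cons /= mulr1.
Qed.

Lemma tens_ext (W : lmodType k) (f g : tens -> W) : linear f -> linear g ->
  (forall w, f (word w) = g (word w)) -> f =1 g.
Proof.
move=> hf hg fg x; rewrite (tens_sum x) (lin_sum hf) (lin_sum hg).
by apply: eq_bigr => y _; rewrite (linZ hf) (linZ hg) fg.
Qed.

Definition wcons (x : V) : tens -> tens := wlift (fun w => word (x :: w)).

Lemma wcons_mlin x : mlin (fun w => word (x :: w)).
Proof. by move=> s t a u v; rewrite -!cat_cons word_mlin. Qed.

Lemma wconsr x : linear (wcons x).
Proof. exact/wlift_is_linear/wcons_mlin. Qed.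

Lemma wconsl y : linear (wcons^~ y).
Proof. by apply: lin_bigsum => w; apply: lin_scale => a u v;
  apply: (word_mlin [::]). Qed.

Lemma wcons_word x w : wcons x (word w) = word (x :: w).
Proof. exact/wlift_word/wcons_mlin. Qed.

Lemma wcons0 y : wcons 0 y = 0. Proof. exact: (lin0 (wconsl y)). Qed.

(** Induction on words, for equalities of linear maps. *)
Lemma tens_ind_ext (W : lmodType k) (f g : tens -> W) : linear f -> linear g ->
  f (word [::]) = g (word [::]) ->
  (forall x y, f y = g y -> f (wcons x y) = g (wcons x y)) -> f =1 g.
Proof.
move=> hf hg f0 fS; apply: tens_ext => //; elim=> [|x w IH] //.
by rewrite -wcons_word fS.
Qed.

(** Primitive recursion over words gives linear maps as soon as the step is
linear in the letter and, jointly, in the tail and the recursive value. *)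
Section Para.
Variables (W : lmodType k) (z : W) (step : V -> tens -> W -> W).
Hypothesis step_l : forall y r, linear (fun x => step x y r).
Hypothesis step_r : forall x a y r y' r',
  step x (a *: y + y') (a *: r + r') = a *: step x y r + step x y' r'.

Fixpoint para (w : seq V) : W :=
  if w is x :: w' then step x (word w') (para w') else z.

Lemma para_mlin : mlin para.
Proof.
elim=> [|u s IH] t a x y /=; first exact: step_l.
by rewrite IH word_mlin step_r.
Qed.

Definition wpara : tens -> W := wlift para.

Lemma wpara_linear : linear wpara. Proof. exact/wlift_is_linear/para_mlin. Qed.

Lemma wpara_nil : wpara (word [::]) = z.
Proof. exact/wlift_word/para_mlin. Qed.

Lemma wpara_cons x y : wpara (wcons x y) = step x y (wpara y).
Proof.
move: y; apply: tens_ext => [||w].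
- by apply: lin_comp (@wconsr x); apply: wpara_linear.
- by move=> a y y'; rewrite wpara_linear step_r.
- by rewrite wcons_word /wpara !(wlift_word para_mlin).
Qed.

End Para.

Definition wcounit : tens -> k^o := wpara (1 : k^o) (fun _ _ _ => 0).

Lemma wcounit_hyp : (forall (y : tens) (r : k^o),
  linear (fun x : V => 0 : k^o)) /\
  (forall (x : V) a (y : tens) (r : k^o) (y' : tens) (r' : k^o),
     (0 : k^o) = a *: 0 + 0).
Proof. by split=> *; [apply: lin_zero | rewrite scaler0 addr0]. Qed.

Lemma wcounit_linear : linear wcounit.
Proof. by apply: wpara_linear; case: wcounit_hyp. Qed.

Lemma wcounit_nil : wcounit (word [::]) = 1.
Proof. by apply: wpara_nil; case: wcounit_hyp. Qed.

Lemma wcounit_cons x y : wcounit (wcons x y) = 0.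
Proof. by apply: wpara_cons; case: wcounit_hyp. Qed.

(** The projection onto the words of length 1. *)
Definition wletter : tens -> V := wpara 0 (fun x y _ => wcounit y *: x).

Lemma wletter_hyp : (forall (y : tens) (r : V),
  linear (fun x : V => wcounit y *: x)) /\
  (forall (x : V) a (y : tens) (r : V) (y' : tens) (r' : V),
     wcounit (a *: y + y') *: x = a *: (wcounit y *: x) + wcounit y' *: x).
Proof.
split=> [y r|x a y r y' r']; first exact: lin_scale.
by rewrite wcounit_linear scalerDl scalerA.
Qed.

Lemma wletter_linear : linear wletter.
Proof. by apply: wpara_linear; case: wletter_hyp. Qed.

Lemma wletter_nil : wletter (word [::]) = 0.
Proof. by apply: wpara_nil; case: wletter_hyp. Qed.

Lemma wletter_cons x y : wletter (wcons x y) = wcounit y *: x.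
Proof. by apply: wpara_cons; case: wletter_hyp. Qed.

Definition wlen (n : nat) : tens -> tens :=
  wlift (fun w => if size w == n then word w else 0).

Lemma wlen_mlin n : mlin (fun w => if size w == n then word w else 0).
Proof.
move=> s t a x y; rewrite !size_cat /=; case: ifP => _; first exact: word_mlin.
by rewrite scaler0 addr0.
Qed.

Lemma wlen_linear n : linear (wlen n).
Proof. exact/wlift_is_linear/wlen_mlin. Qed.

Lemma wlen_word n w : wlen n (word w) = if size w == n then word w else 0.
Proof. exact/wlift_word/wlen_mlin. Qed.

Lemma wlen_nil n : wlen n (word [::]) = if n == 0%N then word [::] else 0.
Proof. by rewrite wlen_word eq_sym. Qed.

Lemma wlen0 y : wlen 0 y = wcounit y *: word [::].
Proof.
move: y; apply: tens_ext => [||w]; first exact: wlen_linear.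
  by move=> a x y; rewrite wcounit_linear scalerDl scalerA.
case: w => [|x w]; first by rewrite wlen_word wcounit_nil scale1r.
by rewrite wlen_word -wcons_word wcounit_cons scale0r.
Qed.

Lemma wlen_cons0 x y : wlen 0 (wcons x y) = 0.
Proof. by rewrite wlen0 wcounit_cons scale0r. Qed.

Lemma wlen_consS n x y : wlen n.+1 (wcons x y) = wcons x (wlen n y).
Proof.
move: y; apply: tens_ext => [||w].
- by apply: lin_comp (@wconsr x); apply: wlen_linear.
- by apply: lin_comp; [apply: wconsr | apply: wlen_linear].
- rewrite wcons_word !wlen_word /= eqSS; case: ifP => _;
    first by rewrite wcons_word.
  by rewrite (lin0 (wconsr x)).
Qed.

Lemma wlen_finite (y : tens) : exists N, forall n, (N <= n)%N -> wlen n y = 0.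
Proof.
exists (\max_(u <- repr y) (size u.2).+1) => n; rewrite {2}(tens_sum y).
move: (repr y : wsum) => s hn.
rewrite (lin_sum (wlen_linear n)) big_seq big1 // => u us.
rewrite (linZ (wlen_linear n)) wlen_word; case: eqP; last by rewrite scaler0.
move=> e; have /(leq_trans (leq_bigmax_seq _ us isT)) := hn.
by rewrite /= e ltnn.
Qed.

Lemma wlen_sum (y : tens) N : (forall n, (N <= n)%N -> wlen n y = 0) ->
  y = \sum_(n < N) wlen n y.
Proof.
move=> hN; have [M hM] : exists M, y = \sum_(n < M) wlen n y.
  have e n : wlen n y = \sum_(u <- repr y) u.1 *: wlen n (word u.2).
    rewrite {1}(tens_sum y) (lin_sum (wlen_linear n)).
    by apply: eq_bigr => u _; rewrite (linZ (wlen_linear n)).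
  exists (\max_(u <- (repr y : wsum)) (size u.2).+1).
  rewrite [RHS](eq_bigr _ (fun (n : 'I__) _ => e n)).
  rewrite exchange_big [LHS]tens_sum big_seq [RHS]big_seq.
  apply: eq_bigr => u us.
  have hu := leq_bigmax_seq (F := fun u : k * seq V => (size u.2).+1) _ us isT.
  rewrite (bigD1 (Ordinal hu)) //= wlen_word eqxx big1 ?addr0 //.
  move=> i /negP hi; rewrite wlen_word.
  by case: eqP => [e'|]; [case: hi; apply/eqP/val_inj | rewrite scaler0].
case: (leqP N M) => [NM|/ltnW MN]; first by rewrite {1}hM (sum_cut NM hN).
rewrite {1}hM; apply/esym/(sum_cut (u := wlen^~ y) MN) => i Mi.
rewrite hM (lin_sum (wlen_linear i)) big1 // => j _.
have wlenD (z : tens) m n : m != n -> wlen m (wlen n z) = 0.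
  move=> mn; move: z; apply: (@tens_ext _ _ (fun=> 0)) => [||w].
  - by apply: lin_comp; apply: wlen_linear.
  - exact: lin_zero.
  - rewrite wlen_word; case: eqP => [e|_];
      last by rewrite (lin0 (wlen_linear m)).
    by rewrite wlen_word e eq_sym (negbTE mn).
by apply: wlenD; rewrite gtn_eqF // (leq_trans (ltn_ord j)).
Qed.

Lemma wlen_eq0 (y : tens) : (forall n, wlen n y = 0) -> y = 0.
Proof. by move=> h; rewrite (@wlen_sum y 0) ?big_ord0. Qed.

(** ** Deconcatenation *)

Let dstep (x : V) (y : tens) (r : tpow tens 2) : tpow tens 2 :=
  tens2 (word [::]) (wcons x y) + lift2 (fun u v => tens2 (wcons x u) v) r.

Let dstep_bil x : bilinear_map (fun u v => tens2 (wcons x u) v).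
Proof.
have [hl hr] := tens2_bilinear tens.
by split=> [v|u]; [exact: (lin_comp (hl v) (@wconsr x)) | apply: hr].
Qed.

(** Deconcatenation: the cut is in front of the first letter or further on. *)
Definition wdelta : tens -> tpow tens 2 :=
  wpara (tens2 (word [::]) (word [::])) dstep.

Let dstep_l y r : linear (fun x => dstep x y r).
Proof.
have [hl hr] := tens2_bilinear tens.
apply: lin_add; first by exact: (lin_comp (hr _) (@wconsl y)).
by apply: lift2_param => u v; exact: (lin_comp (hl v) (@wconsl u)).
Qed.

Let dstep_r x a y r y' r' :
  dstep x (a *: y + y') (a *: r + r') = a *: dstep x y r + dstep x y' r'.
Proof.
have [hl hr] := tens2_bilinear tens.
by rewrite /dstep wconsr hr (lift2_is_linear (dstep_bil x)) scalerDr addrACA.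
Qed.

Lemma wdelta_linear : linear wdelta. Proof. exact: wpara_linear. Qed.

Lemma wdelta_nil : wdelta (word [::]) = tens2 (word [::]) (word [::]).
Proof. exact: wpara_nil. Qed.

Lemma lift2_wdelta_nil (W : lmodType k) (h : tens -> tens -> W) :
  bilinear_map h -> lift2 h (wdelta (word [::])) = h (word [::]) (word [::]).
Proof. by move=> hh; rewrite wdelta_nil lift2_pure. Qed.

Lemma lift2_wdelta_cons (W : lmodType k) (h : tens -> tens -> W) x y :
  bilinear_map h -> lift2 h (wdelta (wcons x y)) =
    h (word [::]) (wcons x y) + lift2 (fun u v => h (wcons x u) v) (wdelta y).
Proof.
move=> hh; rewrite [wdelta _]wpara_cons // (linD (lift2_is_linear hh)).
rewrite lift2_pure // (lift2_lin _ _ (lift2_is_linear hh)); congr (_ + _).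
by apply: lift2_eq => u v; rewrite lift2_pure.
Qed.

Lemma lift2_wdelta_linear (W : lmodType k) (h : tens -> tens -> W) :
  bilinear_map h -> linear (fun y => lift2 h (wdelta y)).
Proof. by move=> hh; exact: (lin_comp (lift2_is_linear hh) wdelta_linear). Qed.

Lemma wcounit_l_bil : bilinear_map (fun u v : tens => wcounit u *: v).
Proof. exact: bilin_scale wcounit_linear. Qed.

Lemma wcounit_r_bil : bilinear_map (fun u v : tens => wcounit v *: u).
Proof. by case: wcounit_l_bil => hl hr; split=> [v|u];
  [apply: hr | apply: hl]. Qed.

Lemma wdelta_counit_l y : lift2 (fun u v => wcounit u *: v) (wdelta y) = y.
Proof.
have hb := wcounit_l_bil.
move: y; apply: (@tens_ind_ext _ _ id); first exact: lift2_wdelta_linear.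
- by [].
- by rewrite lift2_wdelta_nil // wcounit_nil scale1r.
move=> x y _; rewrite lift2_wdelta_cons // wcounit_nil scale1r.
rewrite (lift2_eq (h := fun _ _ => 0)) ?lift2_0 ?addr0 // => u v.
by rewrite wcounit_cons scale0r.
Qed.

Lemma wdelta_counit_r y : lift2 (fun u v => wcounit v *: u) (wdelta y) = y.
Proof.
have hb := wcounit_r_bil.
move: y; apply: (@tens_ind_ext _ _ id); first exact: lift2_wdelta_linear.
- by [].
- by rewrite lift2_wdelta_nil // wcounit_nil scale1r.
move=> x y /(congr1 (wcons x)) IH; rewrite lift2_wdelta_cons // wcounit_cons.
rewrite scale0r add0r -[RHS]IH (lift2_lin _ _ (wconsr x)).
by apply: lift2_eq => u v; rewrite (linZ (wconsr x)).
Qed.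

Lemma wcons_bilinear : bilinear_map wcons.
Proof. by split; [exact: wconsl | exact: wconsr]. Qed.

Lemma wletter_bil : bilinear_map (fun u v => wcons (wletter u) v).
Proof. exact: (bilin_comp wcons_bilinear wletter_linear (@lin_id _ _)). Qed.

(** What makes maps into the tensor coalgebra accessible to recursion: every
nonempty word is its first letter followed by a remainder, and [wletter] on
the left factor selects exactly this deconcatenation. *)
Lemma wdecomp y :
  y = wcounit y *: word [::] +
    lift2 (fun u v => wcons (wletter u) v) (wdelta y).
Proof.
have hb := wletter_bil.
move: y; apply: (@tens_ind_ext _ id) => [//||| x y _].
- apply: lin_add; last exact: lift2_wdelta_linear.
  by move=> a x y; rewrite wcounit_linear scalerDl scalerA.
- by rewrite lift2_wdelta_nil // wcounit_nil scale1r wletter_nil wcons0 addr0.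
rewrite lift2_wdelta_cons // wletter_nil wcons0 wcounit_cons scale0r !add0r.
rewrite -{1}[y]wdelta_counit_l (lift2_lin _ _ (wconsr x));
  apply: lift2_eq => u v.
by rewrite wletter_cons (linZ (wconsr x)) (linZ (wconsl v)).
Qed.

Lemma wdelta_coassoc : coassociative wdelta.
Proof.
move=> W h hh.
have bil1 h' b : trilinear h' -> bilinear_map (fun x y => h' x y b : W).
  by case=> h1 h2 h3; split=> [y|x]; [apply: h1 | apply: h2].
have bil2 h' a : trilinear h' -> bilinear_map (h' a : _ -> _ -> W).
  by case=> h1 h2 h3; split=> [y|x]; [apply: h2 | apply: h3].
have bilL h' : trilinear h' ->
    bilinear_map (fun a b => lift2 (fun x y => h' x y b : W) (wdelta a)).
  move=> ht; split=> [b|a]; first exact/lift2_wdelta_linear/bil1.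
  by apply: lift2_param => u v; case: ht.
have bilR h' : trilinear h' ->
    bilinear_map (fun a b => lift2 (h' a : _ -> _ -> W) (wdelta b)).
  move=> ht; split=> [b|a]; last exact/lift2_wdelta_linear/bil2.
  by apply: lift2_param => u v; case: ht.
have bilC h' x : trilinear h' -> trilinear (fun u => h' (wcons x u) : _ ->
  _ -> W).
  move=> [h1 h2 h3]; split=> [y z|u z|u v]; [|exact: h2|exact: h3].
  exact: (lin_comp (h1 y z) (@wconsr x)).
apply: tens_ext; [exact/lift2_wdelta_linear/bilL |
  exact/lift2_wdelta_linear/bilR |].
move=> w; elim: w h hh => [|x w IH] h hh.
  rewrite lift2_wdelta_nil; last exact: bilL.
  rewrite lift2_wdelta_nil; last exact: bil1.
  rewrite lift2_wdelta_nil; last exact: bilR.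
  by rewrite lift2_wdelta_nil //; apply: bil2.
rewrite -wcons_word lift2_wdelta_cons; last exact: bilL.
rewrite lift2_wdelta_nil; last exact: bil1.
rewrite lift2_wdelta_cons; last exact: bilR.
rewrite lift2_wdelta_cons; last exact: bil2.
rewrite -addrA; congr (_ + _).
rewrite -(IH (fun u => h (wcons x u))); last exact: bilC.
rewrite -lift2_add; apply: lift2_eq => a b.
by rewrite lift2_wdelta_cons //; apply: bil1.
Qed.

Lemma lift2_wdelta_word (W : lmodType k) (h : tens -> tens -> W) w :
  bilinear_map h -> lift2 h (wdelta (word w)) =
    \sum_(i < (size w).+1) h (word (take i w)) (word (drop i w)).
Proof.
elim: w h => [|x w IH] h hh.
  by rewrite lift2_wdelta_nil // big_ord_recl big_ord0 addr0.
rewrite -wcons_word lift2_wdelta_cons // big_ord_recl /= wcons_word.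
congr (_ + _); rewrite IH; last first.
  case: hh => hl hr; split=> [v|u]; [|exact: hr].
  exact: (lin_comp (hl v) (@wconsr x)).
by apply: eq_bigr => i _; rewrite wcons_word.
Qed.

End TensorModule.

(** ** Uniqueness of corecursion *)

Section Corec.
Variables (k : comPzRingType) (V C : lmodType k) (D : C -> tpow C 2).

(** Think of [K x] as putting the letter x in front and of [p n] as the
component of length n. The equation expresses the component of length n + 1 of
a solution by the component of length n, and leaves none of length 0. *)
Lemma corec_uniq (P : lmodType k) (K : V -> P -> P) (p : nat -> P -> P)
    (tau : C -> V) (delta : C -> P) :
  (forall x, linear (K x)) -> (forall n, linear (p n)) ->
  (forall x z, p 0 (K x z) = 0) ->
    (forall n x z, p n.+1 (K x z) = K x (p n z)) ->
  (forall z, (forall n, p n z = 0) -> z = 0) ->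
  (forall c, delta c = lift2 (fun a b => K (tau a) (delta b)) (D c)) ->
  forall c, delta c = 0.
Proof.
move=> hK hp p0 pS psep hd c; apply: psep => n; elim: n c => [|n IH] c.
  rewrite hd (lift2_lin _ _ (hp 0%N)) -[RHS](lift2_0 _ (D c)).
  by apply: lift2_eq => a b; rewrite p0.
rewrite hd (lift2_lin _ _ (hp n.+1)) -[RHS](lift2_0 _ (D c)).
by apply: lift2_eq => a b; rewrite pS IH (lin0 (hK _)).
Qed.

Lemma corec_uniq1 (tau : C -> V) (delta : C -> tens V) :
  (forall c, delta c = lift2 (fun a b => wcons (tau a) (delta b)) (D c)) ->
  forall c, delta c = 0.
Proof.
apply: (@corec_uniq _ (@wcons _ _) (@wlen _ _)).
- exact: wconsr.
- exact: wlen_linear.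
- exact: wlen_cons0.
- exact: wlen_consS.
- exact: wlen_eq0.
Qed.

(** Lengths are measured in the left tensor factor. *)
Lemma corec_uniq2 (tau : C -> V) (delta : C -> tpow (tens V) 2) :
  (forall c, delta c = lift2 (fun a b =>
     lift2 (fun u v => tens2 (wcons (tau a) u) v) (delta b)) (D c)) ->
  forall c, delta c = 0.
Proof.
have [hl hr] := tens2_bilinear (tens V).
have bilf f : linear f -> bilinear_map (fun u v : tens V => tens2 (f u) v).
  by move=> hf; split=> [v|u]; [exact: (lin_comp (hl v) hf) | apply: hr].
have linf f : linear f -> linear (lift2 (fun u v : tens V => tens2 (f u) v)).
  by move/bilf; apply: lift2_is_linear.
have liftK f g (z : tpow (tens V) 2) : linear f -> linear g ->
    lift2 (fun u v => tens2 (f u) v) (lift2 (fun u v => tens2 (g u) v) z) =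
    lift2 (fun u v => tens2 (f (g u)) v) z.
  move=> hf hg; rewrite (lift2_lin _ _ (linf _ hf)); apply: lift2_eq => u v.
  by rewrite lift2_pure //; apply: bilf.
apply: (@corec_uniq _ (fun x => lift2 (fun u v => tens2 (wcons x u) v))
  (fun n => lift2 (fun u v => tens2 (wlen n u) v))).
- by move=> x; apply/linf/wconsr.
- by move=> n; apply/linf/wlen_linear.
- move=> x z; rewrite liftK; [|exact: wlen_linear|exact: wconsr].
  rewrite (lift2_eq (h := fun _ _ => 0)) ?lift2_0 // => u v.
  by rewrite wlen_cons0 (lin0 (hl v)).
- move=> n x z; rewrite !liftK; try exact: wlen_linear; try exact: wconsr.
  by apply: lift2_eq => u v; rewrite wlen_consS.
move=> z hz.
(* Truncation of the left factor; it fixes z for large N and is a sum of the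
maps assumed to kill z. *)
pose f N (y : tens V) := \sum_(n < N) wlen n y.
have hf N : linear (f N) by apply: lin_bigsum => i; apply: wlen_linear.
have hfz N : lift2 (fun u v => tens2 (f N u) v) z = 0.
  transitivity (\sum_(n < N) lift2 (fun u v : tens V => tens2 (wlen n u) v) z).
    elim: N => [|N IH].
      rewrite big_ord0 (lift2_eq (h := fun _ _ => 0)) ?lift2_0 // => u v.
      by rewrite /f big_ord0 (lin0 (hl v)).
    rewrite big_ord_recr /= -IH -lift2_add; apply: lift2_eq => u v.
    by rewrite /f big_ord_recr /= (linD (hl v)).
  by rewrite big1.
have [N hN] : exists N, forall m, (N <= m)%N ->
    lift2 (fun u v => tens2 (f m u) v) z = z.
  rewrite (tpow_sum z); move: (repr z) => s; elim: s => [|y s [N IH]].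
    exists 0%N => m _; rewrite big_nil.
    by rewrite (lin0 (linf _ (hf m))).
  have [M hM] := wlen_finite (thead y.2).
  exists (maxn N M) => m; rewrite geq_max => /andP[Nm Mm].
  rewrite big_cons (linD (linf _ (hf m))) IH // (linZ (linf _ (hf m))).
  congr (_ *: _ + _); rewrite (tuple2_eta y.2) lift2_pure; last exact: bilf.
  rewrite {1}/f /= -wlen_sum // => n mn; apply: hM; exact: leq_trans mn.
by rewrite -(hN N (leqnn N)).
Qed.

End Corec.

(** * Graded modules and Koszul signs *)

Section Graded.
Variable k : comPzRingType.
Implicit Types V W : gmod k.

Definition ksign (e : int) : k := (-1) ^+ `|e|%N.

Lemma ksignD e e' : ksign (e + e') = ksign e * ksign e'.
Proof.
rewrite /ksign -exprD -[LHS]signr_odd -[RHS]signr_odd; congr (_ ^+ _).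
congr nat_of_bool; lia.
Qed.

Lemma ksignK e : ksign e * ksign e = 1.
Proof. by rewrite /ksign -exprD addnn -mul2n exprM sqrrN !expr1n. Qed.

Lemma ksign_odd e e' : odd `|e - e'| = false -> ksign e = ksign e'.
Proof.
move=> h; rewrite /ksign -[LHS]signr_odd -[RHS]signr_odd; congr (_ ^+ _).
congr nat_of_bool; lia.
Qed.

Lemma ksign_0 : ksign 0 = 1. Proof. by rewrite /ksign expr0. Qed.
Lemma ksign_1 : ksign 1 = -1. Proof. by rewrite /ksign expr1. Qed.

Section GSum.
Variables (V : gmod k) (W : lmodType k).

Lemma gsuppP (x : V) : uniq (gsupp x) /\ x = \sum_(p <- gsupp x) gproj V p x.
Proof. by rewrite /gsupp; case: cid. Qed.

Lemma gproj_supp (x : V) p : p \notin gsupp x -> gproj V p x = 0.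
Proof.
case: (gsuppP x) => _ hx hp; rewrite hx linear_sum big_seq big1 // => q hq.
by rewrite gprojE; case: eqP => // e; rewrite e hq in hp.
Qed.

(** A linear map prescribed on each homogeneous component. *)
Definition gsum (L : int -> V -> W) (x : V) : W :=
  \sum_(p <- gsupp x) L p (gproj V p x).

Variable L : int -> V -> W.
Hypothesis hL : forall p, linear (L p).

Lemma gsum_sup x s : uniq s -> {subset gsupp x <= s} ->
  gsum L x = \sum_(p <- s) L p (gproj V p x).
Proof.
move=> us hs; have [ux _] := gsuppP x.
rewrite /gsum [RHS](bigID (mem (gsupp x))) /= [X in _ + X]big1 ?addr0;
  last first.
  by move=> p /gproj_supp ->; rewrite (lin0 (hL p)).
rewrite -[RHS]big_filter; apply: perm_big; apply: uniq_perm => // [|p].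
  exact: filter_uniq.
by rewrite mem_filter; apply/idP/andP => [hp|[]//]; split=> //; apply: hs.
Qed.

Lemma gsum_linear : linear (gsum L).
Proof.
move=> a x y; pose s := undup (gsupp x ++ gsupp y ++ gsupp (a *: x + y)).
have us : uniq s := undup_uniq _.
have hs z : {subset gsupp z <= gsupp x ++ gsupp y ++ gsupp (a *: x + y)} ->
    gsum L z = \sum_(p <- s) L p (gproj V p z).
  by move=> h; apply: gsum_sup => // p /h; rewrite mem_undup.
rewrite !hs; try by move=> p; rewrite !mem_cat => ->; rewrite ?orbT.
rewrite scaler_sumr -big_split; apply: eq_bigr => p _ /=.
by rewrite linearP hL.
Qed.

Lemma gsum_homog p x : homog p x -> gsum L x = L p x.
Proof.
move=> /eqP hx; rewrite (@gsum_sup _ (undup (p :: gsupp x))) ?undup_uniq //;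
  last first.
  by move=> q hq; rewrite mem_undup inE hq orbT.
rewrite (bigD1_seq p) ?undup_uniq ?mem_undup ?inE ?eqxx //= hx.
rewrite big1 ?addr0 // => q /negbTE qp.
by rewrite -hx gprojE qp (lin0 (hL q)).
Qed.

End GSum.

Lemma homog_gproj V p (x : V) : homog p (gproj V p x).
Proof. by rewrite /homog gprojE eqxx. Qed.

Lemma homog0 V p : homog p (0 : V). Proof. by rewrite /homog linear0. Qed.

Lemma homogP V p a (x y : V) : homog p x -> homog p y -> homog p (a *: x + y).
Proof. by rewrite /homog => /eqP hx /eqP hy; rewrite linearP hx hy. Qed.

Lemma homogZ V p a (x : V) : homog p x -> homog p (a *: x).
Proof. by move=> hx; rewrite -[_ *: _]addr0; apply: homogP => //;
  apply: homog0. Qed.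

Lemma homogD V p (x y : V) : homog p x -> homog p y -> homog p (x + y).
Proof. by move=> hx hy; rewrite -[x]scale1r; apply: homogP. Qed.

Lemma homog_sum V p I (r : seq I) (P : pred I) (F : I -> V) :
  (forall i, P i -> homog p (F i)) -> homog p (\sum_(i <- r | P i) F i).
Proof. by move=> hF; elim/big_rec: _ => [|i x hi hx];
  [exact: homog0 | exact: homogD (hF i hi) hx]. Qed.

Lemma homog_ext V (W : lmodType k) (f g : V -> W) : linear f -> linear g ->
  (forall p x, homog p x -> f x = g x) -> f =1 g.
Proof.
move=> hf hg fg x; have [_ ->] := gsuppP x.
rewrite (lin_sum hf) (lin_sum hg); apply: eq_bigr => p _.
by apply: fg (homog_gproj _ _).
Qed.

(** ** The sign operators *)

Lemma ksgn_linear V e : linear (@ksgn k V e).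
Proof. by apply: (@gsum_linear V V (fun p y => ksign (e * p) *: y)) => p;
  apply: lin_scale. Qed.

Lemma ksgnH V e p (x : V) : homog p x -> ksgn e x = ksign (e * p) *: x.
Proof. exact: ksgn_homog. Qed.

Lemma ksgnD V e e' (x : V) : ksgn e (ksgn e' x) = ksgn (e + e') x.
Proof.
move: x; apply: homog_ext;
  first exact: lin_comp (ksgn_linear _) (ksgn_linear _).
  exact: ksgn_linear.
move=> p x hx; rewrite !(ksgnH _ hx) (linZ (ksgn_linear _)) (ksgnH _ hx).
by rewrite scalerA mulrDl ksignD mulrC.
Qed.

Lemma ksgn0 V (x : V) : ksgn 0 x = x.
Proof.
move: x; apply: (@homog_ext _ _ _ id) => // [|p x hx]; first exact: ksgn_linear.
by rewrite (ksgnH _ hx) mul0r ksign_0 scale1r.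
Qed.

Lemma ksgn_parity V e e' (x : V) : odd `|e - e'| = false ->
  ksgn e x = ksgn e' x.
Proof.
move=> h; move: x; apply: homog_ext => [||p x hx]; try exact: ksgn_linear.
rewrite !(ksgnH _ hx); congr (_ *: _); apply: ksign_odd.
by rewrite -mulrBl abszM oddM h.
Qed.

Lemma ksgnK V e (x : V) : ksgn e (ksgn e x) = x.
Proof. by rewrite ksgnD -[RHS]ksgn0; apply: ksgn_parity; lia. Qed.

Lemma homog_ksgn V e p (x : V) : homog p x -> homog p (ksgn e x).
Proof. by move=> hx; rewrite (ksgnH _ hx); apply: homogZ. Qed.

(** The sign rule for moving a map of degree d past the sign operator. *)
Lemma ksgn_deg V W d (f : V -> W) e x : linear f -> has_degree d f ->
  f (ksgn e x) = ksign (e * d) *: ksgn e (f x).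
Proof.
move=> lf df; move: x; apply: homog_ext => [||p x hx].
- exact: lin_comp lf (ksgn_linear _).
- by apply: lin_scale; apply: lin_comp lf; apply: ksgn_linear.
rewrite (ksgnH _ hx) (ksgnH _ (df _ _ hx)) (linZ lf) scalerA mulrDr ksignD.
by rewrite mulrCA ksignK mulr1.
Qed.

Lemma ksgn_deg0 V W (f : V -> W) e x : linear f -> has_degree 0 f ->
  f (ksgn e x) = ksgn e (f x).
Proof. by move=> lf df; rewrite (ksgn_deg _ _ lf df) mulr0 ksign_0 scale1r. Qed.

Lemma wsgnD V e e' (w : seq V) : wsgn e (wsgn e' w) = wsgn (e + e') w.
Proof. by rewrite /wsgn -map_comp; apply: eq_map => x; apply: ksgnD. Qed.

Lemma size_wsgn V e (w : seq V) : size (wsgn e w) = size w.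
Proof. exact: size_map. Qed.

Lemma fin_sum_uniq (W : nmodType) (u : nat -> W) x y :
  fin_sum u x -> fin_sum u y -> x = y.
Proof.
move=> [N hN ->] [M hM ->]; case: (leqP N M) => [NM|/ltnW MN].
  by rewrite (sum_cut NM hN).
by rewrite (sum_cut MN hM).
Qed.

End Graded.

Arguments ksign {k} e.

(** ** The shift *)

Section Shift.
Variables (k : comPzRingType) (A : gmod k).

Lemma shift_gprojE p q (x : A) : gproj A (p + 1) (gproj A (q + 1) x) =
  if p == q then gproj A (q + 1) x else 0.
Proof. by rewrite gprojE (inj_eq (addIr 1)). Qed.

Lemma shift_gproj_sum (x : A) : exists s : seq int,
  uniq s /\ x = \sum_(p <- s) gproj A (p + 1) x.
Proof.
have [us hx] := gsuppP x; exists [seq p - 1 | p <- gsupp x]; split.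
  by rewrite map_inj_uniq //; apply: addIr.
by rewrite big_map {1}hx; apply: eq_bigr => p _; rewrite subrK.
Qed.

Definition shift : gmod k :=
  @GMod k A (fun p => gproj A (p + 1)) shift_gprojE shift_gproj_sum.

Lemma homog_shift p (x : A) : @homog k shift p x = @homog k A (p + 1) x.
Proof. by []. Qed.

(** Degrees in A exceed those in the shift by one. *)
Lemma ksgn_shift e (x : A) : @ksgn k A e x = ksign e *: @ksgn k shift e x.
Proof.
move: x; apply: homog_ext => [||p x hx].
- exact: ksgn_linear.
- by apply: lin_scale; apply: (@ksgn_linear _ shift).
have hx' : @homog k shift (p - 1) x by rewrite homog_shift subrK.
rewrite (ksgnH _ hx) (ksgnH (V := shift) _ hx') scalerA -ksignD.
by congr (ksign _ *: _); rewrite mulrBr mulr1 addrC subrK.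
Qed.

End Shift.

(** * The grading of the tensor coalgebra *)

Section TensGraded.
Variables (k : comPzRingType) (V : gmod k).

(** The first letter is split into its homogeneous components of degree q,
which leave degree p - q for the remainder. *)
Fixpoint word_proj (w : seq V) (p : int) : tens V :=
  if w is x :: w' then gsum (fun q a => wcons a (word_proj w' (p - q))) x
  else if p == 0 then word [::] else 0.

Lemma word_proj_mlin p : mlin (word_proj^~ p).
Proof.
move=> s; elim: s p => [|u s IH] p t a x y /=.
  by apply: gsum_linear => q; apply: wconsl.
rewrite /gsum scaler_sumr -big_split; apply: eq_bigr => q _ /=.
by rewrite IH wconsr.
Qed.

Definition tens_proj p : tens V -> tens V := wlift (word_proj^~ p).

Lemma tens_proj_linear p : linear (tens_proj p). Proof.
  exact/wlift_is_linear/word_proj_mlin. Qed.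

Lemma tens_proj_word p w : tens_proj p (word w) = word_proj w p.
Proof. exact: (wlift_word (word_proj_mlin p)). Qed.

Lemma tens_proj_nil p : tens_proj p (word [::]) =
  if p == 0 then word [::] else 0.
Proof. exact: tens_proj_word. Qed.

Lemma tens_proj_cons p x y :
  tens_proj p (wcons x y) = gsum (fun q a => wcons a (tens_proj (p - q) y)) x.
Proof.
move: y; apply: tens_ext => [||w].
- exact: lin_comp (tens_proj_linear p) (wconsr x).
- apply: lin_bigsum => q.
  exact: lin_comp (wconsr _) (tens_proj_linear _).
- rewrite wcons_word tens_proj_word; apply: eq_bigr => q _.
  by rewrite tens_proj_word.
Qed.

Lemma tens_proj_consH p q x y : homog q x ->
  tens_proj p (wcons x y) = wcons x (tens_proj (p - q) y).
Proof. by move=> hx; rewrite tens_proj_cons (gsum_homog _ hx) // => r;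
  apply: wconsl. Qed.

Lemma tens_projE p q y : tens_proj p (tens_proj q y) =
  if p == q then tens_proj q y else 0.
Proof.
have l1 p' q' : linear (fun y => tens_proj p' (tens_proj q' y)).
  exact: lin_comp (tens_proj_linear _) (tens_proj_linear _).
have l2 (p' q' : int) : linear (fun y => if p' == q' then tens_proj q' y else
  0).
  by case: eqP => _; [apply: tens_proj_linear | apply: lin_zero].
move: y; apply: tens_ext => // w; elim: w p q => [|x w IH] p q.
  rewrite !tens_proj_nil; case: (q =P 0) => [->|].
    by rewrite tens_proj_nil; case: eqP.
  by rewrite (lin0 (tens_proj_linear _)); case: eqP.
rewrite -wcons_word; move: x; apply: homog_ext => [||r x hx].
- exact: lin_comp (l1 _ _) (wconsl _).
- exact: lin_comp (l2 _ _) (wconsl _).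
rewrite !(tens_proj_consH _ _ hx) IH (inj_eq (addIr _)).
by case: eqP => // _; rewrite (lin0 (wconsr x)).
Qed.

Lemma tens_proj_linear_sum (y : tens V) :
  exists s : seq int, uniq s /\ y = \sum_(p <- s) tens_proj p y.
Proof.
pose fin y := exists s : seq int, uniq s /\ y = \sum_(p <- s) tens_proj p y.
have sup y0 s t : uniq s -> uniq t -> y0 = \sum_(p <- s) tens_proj p y0 ->
    {subset s <= t} -> y0 = \sum_(p <- t) tens_proj p y0.
  move=> us ut hs st; rewrite [RHS](bigID (mem s)) /= [X in _ + X]big1 ?addr0.
    rewrite -big_filter {1}hs; apply: perm_big; apply: uniq_perm => // [|p].
      exact: filter_uniq.
    by rewrite mem_filter; apply/idP/andP => [hp|[]//]; split=> //; apply: st.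
  move=> p ps; rewrite hs (lin_sum (tens_proj_linear p)) big_seq big1 // => q
    qs.
  by rewrite tens_projE; case: eqP => // pq; rewrite pq qs in ps.
have finP a y1 y2 : fin y1 -> fin y2 -> fin (a *: y1 + y2).
  move=> [s [us hs]] [t [ut ht]]; exists (undup (s ++ t)); split.
    exact: undup_uniq.
  under eq_bigr do rewrite tens_proj_linear.
  rewrite big_split -scaler_sumr /=; congr (_ *: _ + _).
    apply: sup (undup_uniq _) hs _ => // p ps.
    by rewrite mem_undup mem_cat ps.
  apply: sup (undup_uniq _) ht _ => // p ps.
  by rewrite mem_undup mem_cat ps orbT.
have fin0 : fin 0 by exists [::]; rewrite big_nil.
have finS I (r : seq I) (F : I -> tens V) :
    (forall i, fin (F i)) -> fin (\sum_(i <- r) F i).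
  move=> hF; elim/big_rec: _ => // i y1 _ h1.
  by rewrite -[F i]scale1r; apply: finP.
have finZ a y1 : fin y1 -> fin (a *: y1).
  by move=> h; rewrite -[_ *: _]addr0; apply: finP.
have finH p y1 : tens_proj p y1 = y1 -> fin y1.
  by move=> h; exists [:: p]; rewrite big_seq1 h.
rewrite (tens_sum y); apply: (finS) => u; apply: finZ;
  elim: u.2 => [|x w [s [us hs]]].
  by apply: (finH 0); rewrite tens_proj_nil.
rewrite -wcons_word; have [_ ->] := gsuppP x.
rewrite (lin_sum (wconsl (word w))); apply: (finS) => q; rewrite hs.
rewrite (lin_sum (wconsr _)); apply: finS => p; apply: (finH (q + p)).
by rewrite (tens_proj_consH _ _ (homog_gproj _ _)) (addrC q) addrK tens_projE
  eqxx.
Qed.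

Definition tens_projL p : {linear tens V -> tens V} :=
  mklin (tens_proj_linear p).

Definition tensg : gmod k :=
  @GMod k (tens V) tens_projL tens_projE tens_proj_linear_sum.

Lemma homog_nil : @homog k tensg 0 (word [::]).
Proof. by rewrite /homog /= tens_proj_nil. Qed.

Lemma homog_wcons p q x (y : tens V) : homog p x -> @homog k tensg q y ->
  @homog k tensg (p + q) (wcons x y).
Proof.
move=> hx /eqP hy; rewrite /homog /= (tens_proj_consH _ _ hx) (addrC p) addrK.
by move: hy => /= ->.
Qed.

(** Projecting a linear combination of words shows that homogeneous tensors
are spanned by the words of homogeneous letters of the same total degree. *)
Lemma tens_homog_ind (P : int -> tens V -> Prop) :
  (forall p, P p 0) ->
  (forall p a x y, P p x -> P p y -> P p (a *: x + y)) ->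
  P 0 (word [::]) ->
  (forall p q x y, homog p x -> @homog k tensg q y -> P q y ->
     P (p + q) (wcons x y)) ->
  forall p y, @homog k tensg p y -> P p y.
Proof.
move=> P0 PP Pnil PS p y /eqP <- /=.
have PZ q a x : P q x -> P q (a *: x).
  by move=> h; rewrite -[_ *: _]addr0; apply: PP.
have PSum q I (r : seq I) (F : I -> tens V) :
    (forall i, P q (F i)) -> P q (\sum_(i <- r) F i).
  move=> hF; elim/big_rec: _ => // i y1 _ h1.
  by rewrite -[F i]scale1r; apply: PP.
rewrite (tens_sum y) (lin_sum (tens_proj_linear p)); apply: (PSum) => u.
rewrite (linZ (tens_proj_linear p)); apply: (PZ); elim: u.2 p => [|x w IH] p.
  by rewrite tens_proj_nil; case: eqP => [->|].
rewrite -wcons_word tens_proj_cons; apply: (PSum) => q.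
have -> : p = q + (p - q) by rewrite addrC subrK.
rewrite (addrC q) addrK addrC; apply: PS => //; first exact: homog_gproj.
exact: (@homog_gproj _ tensg).
Qed.

Lemma ksgn_nil e : @ksgn k tensg e (word [::]) = word [::].
Proof. by rewrite (ksgnH _ homog_nil) mulr0 ksign_0 scale1r. Qed.

Lemma ksgn_wcons e x (y : tens V) :
  @ksgn k tensg e (wcons x y) = wcons (ksgn e x) (@ksgn k tensg e y).
Proof.
move: x; apply: homog_ext => [||p x hx].
- exact: lin_comp (@ksgn_linear _ tensg e) (wconsl y).
- exact: lin_comp (wconsl _) (ksgn_linear e).
move: y; apply: (@homog_ext _ tensg) => [||q y hy].
- exact: lin_comp (@ksgn_linear _ tensg e) (wconsr x).
- exact: lin_comp (wconsr _) (@ksgn_linear _ tensg e).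
rewrite (ksgnH _ (homog_wcons hx hy)) (ksgnH _ hx) (ksgnH _ hy).
by rewrite (linZ (wconsl _)) (linZ (wconsr _)) scalerA mulrDr ksignD.
Qed.

Lemma ksgn_word e (w : seq V) : @ksgn k tensg e (word w) = word (wsgn e w).
Proof.
by elim: w => [|x w IH];
  rewrite ?ksgn_nil // -wcons_word ksgn_wcons IH wcons_word.
Qed.

Lemma homog_word (w : seq (int * V)) : all (fun y => homog y.1 y.2) w ->
  @homog k tensg (\sum_(y <- w) y.1) (word [seq y.2 | y <- w]).
Proof.
elim: w => [|y w IH] /=; first by rewrite big_nil => _; apply: homog_nil.
by case/andP=> hy hw; rewrite big_cons -wcons_word; apply: homog_wcons (IH hw).
Qed.

(** A linear map has a degree as soon as it does on words of homogeneous
letters, because these span each component. *)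
Lemma has_degree_words (W : gmod k) (f : tens V -> W) d : linear f ->
  (forall w : seq (int * V), all (fun y => homog y.1 y.2) w ->
     homog (\sum_(y <- w) y.1 + d) (f (word [seq y.2 | y <- w]))) ->
  has_degree d (f : tensg -> W).
Proof.
move=> lf hf.
pose R p (y : tens V) := exists2 s : seq (k * seq (int * V)),
  y = \sum_(u <- s) u.1 *: word [seq z.2 | z <- u.2] &
  forall u, u \in s -> all (fun y => homog y.1 y.2) u.2 /\ \sum_(y <- u.2) y.1
    = p.
suff hR p y : @homog k tensg p y -> R p y.
  move=> p y /hR[s -> hs]; rewrite (lin_sum lf) big_seq;
    apply: homog_sum => u us.
  by rewrite (linZ lf); apply: homogZ; have [h <-] := hs _ us; apply: hf.
move: p y; apply: tens_homog_ind =>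
  [p|p a x y [s -> hs] [t -> ht]||p q x y hx _ [s -> hs]].
- by exists [::]; rewrite // big_nil.
- exists ([seq (a * u.1, u.2) | u <- s] ++ t).
    rewrite big_cat big_map scaler_sumr; congr (_ + _).
    by apply: eq_bigr => u _; rewrite scalerA.
  move=> u; rewrite mem_cat => /orP[/mapP[v /hs hv ->] //|]; exact: ht.
- exists [:: (1, [::])]; first by rewrite big_seq1 scale1r.
  by move=> u; rewrite inE => /eqP ->; rewrite big_nil.
exists [seq (u.1, (p, x) :: u.2) | u <- s].
  rewrite (lin_sum (wconsr x)) big_map; apply: eq_bigr => u _.
  by rewrite (linZ (wconsr x)) wcons_word.
move=> u /mapP[v /hs[hv hq] ->] /=; split; first by apply/andP.
by rewrite big_cons hq.
Qed.

End TensGraded.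

(** * Iterated comultiplications *)

Section Tuples.
Variables (k : comPzRingType) (V : lmodType k).

Lemma tset_cat n (t : n.-tuple V) (i : 'I_n) x :
  val (tset t i x) = take i t ++ x :: drop i.+1 t.
Proof.
have hi : (i <= size t)%N by rewrite size_tuple ltnW.
apply: (@eq_from_nth _ 0) => [|j].
  rewrite size_cat /= size_takel // size_drop !size_tuple card_ord.
  by rewrite addnS -addSn subnKC.
rewrite size_tuple => hj'.
rewrite -[LHS](tnth_nth _ (tset t i x) (Ordinal hj')).
rewrite tnth_mktuple nth_cat size_takel // -val_eqE /=.
case: (ltngtP j i) => [ji|ij|->]; last by rewrite subnn.
  by rewrite nth_take // (tnth_nth 0).
rewrite -(subnSK ij) /= nth_drop (tnth_nth 0) /=; congr (nth _ _ _); lia.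
Qed.

Lemma mlin_tuple n (W : lmodType k) (g : seq V -> W) :
  mlin g -> tmultilinear (fun t : n.-tuple V => g t).
Proof. by move=> hg t i a x y; rewrite !tset_cat hg. Qed.

Lemma mlin0 (W : lmodType k) (g : seq V -> W) s t : mlin g ->
  g (s ++ 0 :: t) = 0.
Proof.
by move=> hg; have := hg s t (-1) 0 0; rewrite scaler0 addr0 scaleN1r addNr.
Qed.

Lemma mlin_map (U W : lmodType k) (f : U -> V) (g : seq V -> W) :
  linear f -> mlin g -> mlin (fun s => g (map f s)).
Proof. by move=> hf hg s t a x y; rewrite !map_cat /= hf hg. Qed.

Lemma mlin_cons (W : lmodType k) (g : seq V -> W) x :
  mlin g -> mlin (fun s => g (x :: s)).
Proof. by move=> hg s t a u v; rewrite -!cat_cons hg. Qed.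

(** [tpure] as a function of words: extended by 0 to the words of any other
length, it is multilinear on all words. *)
Definition wpure n (s : seq V) : tpow V n :=
  if insub s is Some t then tpure t else 0.

Lemma wpure_tuple n (t : n.-tuple V) : wpure n t = tpure t.
Proof. by rewrite /wpure valK. Qed.

Lemma wpure_mlin n : mlin (wpure n).
Proof.
move=> s t a x y; rewrite /wpure.
have [hn|hn] := boolP (size s + (size t).+1 == n)%N; last first.
  by rewrite !insubN ?size_cat //= scaler0 addr0.
have hs z : size (s ++ z :: t) == n by rewrite size_cat.
rewrite !(insubT (fun s : seq V => size s == n) (hs _)) /=.
have hi : (size s < n)%N by rewrite -(eqP hn) -addSnnS leq_addr.
pose i := Ordinal hi.
pose T z : n.-tuple V := Tuple (hs z).
have e z z' : T z = tset (T z') i z.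
  apply: val_inj; rewrite tset_cat /= take_size_cat //.
  by rewrite -[s ++ z' :: t]cat_rcons drop_size_cat ?size_rcons.
change (tpure (T (a *: x + y)) = a *: tpure (T x) + tpure (T y)).
by rewrite (e (a *: x + y) x) tpure_multilinear -!e.
Qed.

End Tuples.

Arguments mlin_tuple {k V} n {W g}.

Section Iter.
Variables (k : comPzRingType) (C : lmodType k) (D : C -> tpow C 2).
Hypothesis hD : linear D.

(** The Sweedler sum of the g(c_1, ..., c_(n+1)). *)
Definition iter_lift (W : lmodType k) (g : seq C -> W) n (c : C) : W :=
  tlift (fun t : n.+1.-tuple C => g t) (iter_comul D n c).

(** Applying D to the first letter before g. *)
Definition comul_head (W : lmodType k) (g : seq C -> W) (s : seq C) : W :=
  if s is x :: s' then lift2 (fun a b => g (a :: b :: s')) (D x) else 0.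

Lemma comul_head_bil (W : lmodType k) (g : seq C -> W) s :
  mlin g -> bilinear_map (fun a b => g (a :: b :: s)).
Proof.
move=> hg; split=> [b|a] z x y; first exact: (hg [::]).
exact: (hg [:: a]).
Qed.

Lemma comul_head_mlin (W : lmodType k) (g : seq C -> W) :
  mlin g -> mlin (comul_head g).
Proof.
move=> hg [|u s] t a x y /=.
  rewrite hD; exact/lift2_is_linear/comul_head_bil.
apply: (lift2_param (g :=
  fun x a b => g (a :: b :: s ++ x :: t))) => b b' z v w.
by rewrite -!cat_cons hg.
Qed.

Lemma comul_lE_head n x :
  comul_l D (n := n) x =
  tlift (fun t : n.+1.-tuple C => comul_head (@wpure k C n.+2) t) x.
Proof.
apply: tlift_eq => t.
transitivity (comul_head (@wpure k C n.+2) (thead t :: behead t)); last first.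
  by congr comul_head; rewrite [RHS](congr1 val (tuple_eta t)).
apply: tlift_eq => u; rewrite -wpure_tuple; congr wpure => /=.
by rewrite {1}(tuple2_eta u).
Qed.

Lemma comul_l_linear n : linear (comul_l D (n := n)).
Proof.
move=> a x y; rewrite !comul_lE_head.
exact/tlift_is_linear/mlin_tuple/comul_head_mlin/wpure_mlin.
Qed.

Lemma tlift_comul_l (W : lmodType k) (g : seq C -> W) n x : mlin g ->
  tlift (fun t : n.+2.-tuple C => g t) (comul_l D x) =
  tlift (fun t : n.+1.-tuple C => comul_head g t) x.
Proof.
move=> hg; have ht := mlin_tuple n.+2 hg.
rewrite comul_lE_head (tlift_lin _ _ (tlift_is_linear ht)).
apply: tlift_eq => t; case/tupleP: t => z t /=.
rewrite (lift2_lin _ _ (tlift_is_linear ht)); apply: lift2_eq => a b.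
by rewrite (wpure_tuple [tuple of a :: b :: t]) tlift_pure.
Qed.

Lemma iter_comul_linear n : linear (iter_comul D n).
Proof.
elim: n => [|n IH] /=; last exact: (lin_comp (@comul_l_linear n) IH).
move=> a x y; have := wpure_mlin 1 [::] [::] a x y.
by rewrite /= !(wpure_tuple [tuple _]).
Qed.

Lemma iter_lift_linear (W : lmodType k) (g : seq C -> W) n :
  mlin g -> linear (iter_lift g n).
Proof.
by move=> hg; apply: (lin_comp (tlift_is_linear (mlin_tuple n.+1 hg)));
  apply: iter_comul_linear.
Qed.

Lemma iter_lift0 (W : lmodType k) (g : seq C -> W) c : mlin g ->
  iter_lift g 0 c = g [:: c].
Proof. by move=> hg; rewrite /iter_lift /= tlift_pure //;
  apply: mlin_tuple. Qed.

Lemma iter_lift_S_l (W : lmodType k) (g : seq C -> W) n c : mlin g ->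
  iter_lift g n.+1 c = iter_lift (comul_head g) n c.
Proof. exact: tlift_comul_l. Qed.

Hypothesis hA : coassociative D.

(** [iter_comul] keeps splitting the first factor. By coassociativity one may
instead split c once and iterate on the second half, which is the form suited
to recursion on words. *)
Lemma iter_liftS (W : lmodType k) (g : seq C -> W) n c : mlin g ->
  iter_lift g n.+1 c = lift2 (fun a b => iter_lift (fun s => g (a :: s)) n b)
    (D c).
Proof.
elim: n g c => [|n IH] g c hg.
  rewrite iter_lift_S_l // iter_lift0 /=; last exact: comul_head_mlin.
  by apply: lift2_eq => a b; rewrite iter_lift0 //; apply: mlin_cons.
rewrite iter_lift_S_l // IH; last exact: comul_head_mlin.
pose h a1 a2 b := iter_lift (fun s => g (a1 :: a2 :: s)) n b.
transitivity (lift2 (fun a b => lift2 (fun a1 a2 => h a1 a2 b) (D a)) (D c)).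
  by apply: lift2_eq => a b; rewrite /iter_lift /= /lift2 tlift_exchange.
rewrite hA.
  by apply: lift2_eq => a b; rewrite IH //; apply: mlin_cons.
split=> [y z|x z|x y].
- by apply: tlift_param => t a u v; apply: (hg [::]).
- by apply: tlift_param => t a u v; apply: (hg [:: x]).
- exact: (iter_lift_linear n (mlin_cons y (mlin_cons x hg))).
Qed.

End Iter.

Section IterNatural.
Variables (k : comPzRingType) (C C' : lmodType k).
Variables (D : C -> tpow C 2) (D' : C' -> tpow C' 2) (f : {linear C -> C'}).
Hypotheses (hD : linear D) (hD' : linear D').
Hypothesis hf : forall c, D' (f c) = tmap f (D c).

Lemma iter_comul_natural n c :
  iter_comul D' n (f c) = tmap f (iter_comul D n c).
Proof.
elim: n c => [|n IH] c /=.
  by rewrite tmap_pure; congr tpure; apply: val_inj.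
rewrite IH; move: (iter_comul D n c) => x.
have l1 := lin_comp (comul_l_linear hD' (n :=
  n)) (linearP (@tmap k n.+1 _ _ f)).
have l2 := lin_comp (linearP (@tmap k n.+2 _ _ f)) (comul_l_linear hD (n := n)).
apply: (@tpow_ext _ _ _ _ (mklin l1) (mklin l2)) => t /=.
rewrite tmap_pure !comul_lE_head !tlift_pure;
  try (by apply/mlin_tuple/comul_head_mlin => //; apply: wpure_mlin).
case/tupleP: t => z t /=; rewrite hf (lift2_lin _ _ (linearP _)) lift2_tmap;
  last first.
  exact/comul_head_bil/wpure_mlin.
apply: lift2_eq => a b; rewrite (wpure_tuple [tuple of a :: b :: t]).
by rewrite [RHS]tmap_pure -wpure_tuple.
Qed.

End IterNatural.

(** ** The reduced coalgebra *)

Section Reduced.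
Variables (k : comPzRingType) (C : lmodType k) (D : {linear C -> tpow C 2}).
Variable e : {linear k^o -> C}.
Hypothesis De : D (e 1) = tens2 (e 1) (e 1).

Lemma coker_pi_linear : linear (coker_pi e).
Proof. by move=> a x y; rewrite coker_piD -coker_pi_scale. Qed.

Definition cpi : {linear C -> coker e} := mklin coker_pi_linear.

Lemma cpi_eps a : cpi (e a) = 0.
Proof.
rewrite -[0](linear0 cpi); apply/eqP/coker_piP; exists a.
by rewrite subr0.
Qed.

Lemma eps_scale a : e a = a *: e 1.
Proof. by rewrite -linearZ /= /GRing.scale /= mulr1. Qed.

(** The induced map does not depend on the chosen representative: two of them
differ by a multiple of e 1, and D (e 1) dies in the tensor square of the
cokernel. *)
Lemma red_comul_pi c : red_comul D (cpi c) = tmap cpi (D c).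
Proof.
rewrite /red_comul.
have /eqP/coker_piP[u hu] := coker_reprK (cpi c).
have -> : repr (cpi c) = c + u *: e 1 by rewrite -eps_scale -hu addrC subrK.
have hL : linear (@tmap k 2 _ _ cpi) by exact: linearP.
rewrite linearD linearZ /= De.
rewrite -[LHS]/(@tmap k 2 _ _ cpi _) (linD hL) (linZ hL) /tens2 tmap_pure.
have -> : map_tuple cpi [tuple e 1; e 1] = [tuple 0; 0].
  by apply: val_inj; congr [:: _; _]; exact: cpi_eps.
have [hl _] := tens2_bilinear (coker e).
by rewrite -/(tens2 0 0) (lin0 (hl 0)) scaler0 addr0.
Qed.

Lemma red_comul_linear : linear (red_comul D (e := e)).
Proof.
move=> a x y; rewrite -[x]coker_reprK -[y]coker_reprK.
change (red_comul D (e := e) (a *: cpi (repr x) + cpi (repr y)) =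
  a *: red_comul D (cpi (repr x)) + red_comul D (cpi (repr y))).
by rewrite -linearP !red_comul_pi !linearP.
Qed.

Lemma iter_red n c :
  iter_comul (red_comul D (e := e)) n (cpi c) = tmap cpi (iter_comul D n c).
Proof.
by apply: iter_comul_natural;
  [exact: linearP|exact: red_comul_linear|exact: red_comul_pi].
Qed.

Lemma iter_lift_red (W : lmodType k) (G : seq (coker e) -> W) n c : mlin G ->
  iter_lift D (fun s => G (map cpi s)) n c =
  iter_lift (red_comul D (e := e)) G n (cpi c).
Proof.
move=> hG; rewrite /iter_lift iter_red /tmap.
rewrite (tlift_lin _ _ (tlift_is_linear (mlin_tuple n.+1 hG))).
by apply: tlift_eq => t; rewrite tlift_pure //; apply: mlin_tuple.
Qed.

Lemma iter_red_vanish n m x : (n <= m)%N ->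
  iter_comul (red_comul D (e := e)) n x = 0 ->
  iter_comul (red_comul D (e := e)) m x = 0.
Proof.
move=> /subnK <- h; elim: (m - n)%N => [//|d IH] /=.
by rewrite IH (lin0 (comul_l_linear red_comul_linear (n := d + n))).
Qed.

End Reduced.

(** ** Homogeneous tensors *)

Section Thomog.
Variables (k : comPzRingType) (V : gmod k).

Lemma thomog_pure p q (x y : V) : homog p x -> homog q y ->
  thomog (p + q) (tens2 x y).
Proof.
move=> hx hy; exists [:: (1, [tuple x; y])]; first by rewrite big_seq1 scale1r.
move=> u; rewrite inE => /eqP ->.
exists (fun i : 'I_2 => if i == ord0 then p else q).
  by rewrite big_ord_recl big_ord1.
by case=> [[|[|i]] hi].
Qed.

Lemma thomog0 n p : @thomog k V n p 0.
Proof. by exists [::]; rewrite ?big_nil. Qed.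

Lemma thomogP n p a (x y : tpow V n) : thomog p x -> thomog p y ->
  thomog p (a *: x + y).
Proof.
move=> [s -> hs] [t -> ht]; exists ([seq (a * u.1, u.2) | u <- s] ++ t).
  rewrite big_cat big_map scaler_sumr; congr (_ + _).
  by apply: eq_bigr => u _; rewrite scalerA.
move=> u; rewrite mem_cat => /orP[/mapP[v /hs hv ->] //|]; exact: ht.
Qed.

(** Homogeneous tensors are spanned by pure tensors of homogeneous vectors. *)
Lemma thomog2_ind p (P : tpow V 2 -> Prop) : P 0 ->
  (forall a x y, P x -> P y -> P (a *: x + y)) ->
  (forall q r x y, homog q x -> homog r y -> q + r = p -> P (tens2 x y)) ->
  forall x, thomog p x -> P x.
Proof.
move=> P0 PP Pt _ [s -> hs]; rewrite big_seq; elim/big_rec: _ => // u x us hx.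
apply: PP => //; have [e he h] := hs _ us; rewrite (tuple2_eta u.2).
apply: Pt (h ord0) (h ord_max) _; rewrite -he big_ord_recl big_ord1.
by congr (_ + e _); apply: val_inj.
Qed.

Lemma lift2_homog (W : gmod k) p d (h : V -> V -> W) x : bilinear_map h ->
  (forall q r u v, homog q u -> homog r v -> homog (q + r + d) (h u v)) ->
  thomog p x -> homog (p + d) (lift2 h x).
Proof.
move=> hh hd; have hl := lift2_is_linear hh; move: x; apply: thomog2_ind.
- by rewrite (lin0 hl); apply: homog0.
- by move=> a x y hx hy; rewrite hl; apply: homogP.
by move=> q r u v hu hv <-; rewrite lift2_pure //; apply: hd.
Qed.

End Thomog.

Section TensorCoalgebra.
Variables (k : comPzRingType) (V : gmod k).
Let T := tensg V.

Lemma wdelta_degree p (y : T) : homog p y -> thomog p (wdelta y : tpow T 2).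
Proof.
move=> hy; suff [] : homog p y /\ thomog p (wdelta y : tpow T 2) by [].
have hh x : bilinear_map (fun u v : tens V => tens2 (wcons x u) v).
  exact: (bilin_comp (tens2_bilinear _) (wconsr x) (@lin_id _ _)).
move: p y hy; apply: tens_homog_ind => [p|p a x y [hx dx] [hy dy]||p q x y hx
  hy [_ dy]].
- by split; [apply: homog0 | rewrite (lin0 (@wdelta_linear _ V));
    apply: thomog0].
- split; first exact: (@homogP k T).
  by rewrite wdelta_linear; apply: (@thomogP k T).
- split; first exact: homog_nil.
  by rewrite wdelta_nil -[0]addr0; apply: (@thomog_pure k T); apply: homog_nil.
split; first exact: homog_wcons.
rewrite -[wdelta _]lift2_id lift2_wdelta_cons; last exact: tens2_bilinear.
rewrite -[tens2 _ _]scale1r; apply: (@thomogP k T).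
  by rewrite -[p + q]add0r; apply: (@thomog_pure k T);
    [apply: homog_nil | apply: homog_wcons].
have hl := lift2_is_linear (hh x).
move: dy; move: (wdelta y); apply: (@thomog2_ind k T).
- by rewrite (lin0 hl); apply: (@thomog0 k T).
- by move=> a u v hu hv; rewrite hl; apply: (@thomogP k T).
move=> r s u v hu hv <-; rewrite lift2_pure // addrA.
by apply: (@thomog_pure k T) => //; apply: homog_wcons.
Qed.

Lemma wcounit_degree p (y : T) : homog p y -> p != 0 -> wcounit y = 0.
Proof.
move: p y; apply: tens_homog_ind.
- by move=> p _; apply: lin0 (@wcounit_linear _ V).
- by move=> p a x y hx hy p0; rewrite wcounit_linear hx ?hy ?scaler0 ?addr0.
- by rewrite eqxx.
- by move=> p q x y _ _ _ _; apply: wcounit_cons.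
Qed.

Definition wunit : k^o -> tens V := fun a => (a : k) *: word [::].

Lemma wunit_linear : linear wunit.
Proof. by move=> a x y; rewrite /wunit scalerDl scalerA. Qed.

Lemma wunit1 : wunit 1 = word [::]. Proof. exact: scale1r. Qed.

Definition wdeltaL : {linear tens V ->
  tpow (tens V) 2} := mklin (@wdelta_linear _ V).
Definition wunitL : {linear k^o -> tens V} := mklin wunit_linear.

(** When a word of length at most n is cut into n + 1 pieces, one piece is
empty. *)
Lemma iter_lift_short (W : lmodType k) (G : seq (tens V) -> W) n w : mlin G ->
  (forall s, word [::] \in s -> G s = 0) -> (size w <= n)%N ->
  iter_lift (@wdelta _ V) G n (word w) = 0.
Proof.
elim: n G w => [|n IH] G w hG hG0.
  by rewrite leqn0 => /nilP ->; rewrite iter_lift0 // hG0 // inE.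
move=> hw; rewrite iter_liftS //; [|exact: wdelta_linear|exact: wdelta_coassoc].
rewrite lift2_wdelta_word; last first.
  split=> [v|u]; first by apply: tlift_param => t a x y; apply: (hG [::]).
  exact: (iter_lift_linear (@wdelta_linear _ V) n (mlin_cons u hG)).
rewrite big1 // => -[[|i] hi] _ /=.
  rewrite take0 /iter_lift /tlift /fsum_eval big1 // => t _.
  by rewrite hG0 ?scaler0 // inE eqxx.
apply: IH; first exact: mlin_cons.
  by move=> s hs; rewrite hG0 // inE hs orbT.
by rewrite size_drop; lia.
Qed.

(** The empty word spans the augmentation, so cutting a word into more pieces
than it has letters gives 0 in the reduced coalgebra. *)
Lemma wdelta_cocomplete (x : coker wunitL) :
  exists2 n, (2 <= n)%N & iter_comul (red_comul wdeltaL (e :=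
    wunitL)) n.-1 x = 0.
Proof.
have De : wdeltaL (wunitL 1) = tens2 (wunitL 1) (wunitL 1).
  by rewrite /= wunit1 wdelta_nil.
rewrite -[x]coker_reprK -[coker_pi _ _]/(cpi wunitL _); move: (repr x) => {x} y.
have [N hN] : exists N, forall n, (N <= n)%N ->
    tmap (cpi wunitL) (iter_comul wdeltaL n y) = 0.
  have lt n := lin_comp (linearP (@tmap k n.+1 _ _ (cpi wunitL)))
    (iter_comul_linear (@wdelta_linear _ V) n).
  rewrite (tens_sum y); move: (repr y : seq (k * seq V)) => s.
  elim: s => [|u s [N IH]].
    by exists 0%N => n _; rewrite big_nil; apply: (lin0 (lt n)).
  exists (maxn N (size u.2)) => n; rewrite geq_max => /andP[nN nu].
  rewrite big_cons [LHS](linD (lt n)) [X in _ + X]IH // addr0 (linZ (lt n)).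
  transitivity (u.1 *: (0 : tpow (coker wunitL) n.+1)); last by rewrite scaler0.
  congr (_ *: _).
  pose G (s' : seq (tens V)) :=
    @wpure k (coker wunitL) n.+1 (map (cpi wunitL) s').
  have hG : mlin G by exact: (mlin_map (linearP (cpi wunitL)) (@wpure_mlin _ _
    _)).
  rewrite -(iter_lift_short (G := G) hG _ nu).
    by apply: tlift_eq => t; rewrite /G -wpure_tuple.
  move=> s' hs'; case/splitPr: hs' => s1 s2.
  rewrite /G map_cat /= -[X in X :: _]/(cpi wunitL (word [::])) -wunit1
    (cpi_eps wunitL).
  exact/mlin0/wpure_mlin.
exists N.+2 => //=; rewrite -[LHS]/(iter_comul (red_comul wdeltaL (e:=wunitL))
  N.+1 _).
by rewrite (iter_red De) hN.
Qed.

End TensorCoalgebra.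

(** * Coderivations of the tensor coalgebra *)

Section Coder.
Variables (k : comPzRingType) (V : gmod k).
Let T := tensg V.
Variable b : tens V -> V.
Hypothesis hb : linear b.
Hypothesis db : has_degree 1 (b : T -> V).

(** The part of the coderivation in which b is applied to an initial subword.
*)
Definition cofirst (y : tens V) : tens V :=
  lift2 (fun u v => wcons (b u) v) (wdelta y).

Lemma cofirst_bil : bilinear_map (fun u v => wcons (b u) v).
Proof. exact: (bilin_comp (@wcons_bilinear _ V) hb (@lin_id _ _)). Qed.

Lemma cofirst_linear : linear cofirst.
Proof. exact/lift2_wdelta_linear/cofirst_bil. Qed.

Let cstep x y r := cofirst (wcons x y) + wcons (ksgn 1 x) r.

(** The coderivation with letter component b: either b consumes an initial
subword, or it acts beyond the first letter, which then receives the Koszul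
sign for b. *)
Definition coder : tens V -> tens V := wpara (cofirst (word [::])) cstep.

Let cstep_l y r : linear (fun x => cstep x y r).
Proof.
apply: lin_add; first exact: lin_comp cofirst_linear (wconsl y).
exact: lin_comp (wconsl r) (ksgn_linear 1).
Qed.

Let cstep_r x a y r y' r' :
  cstep x (a *: y + y') (a *: r + r') = a *: cstep x y r + cstep x y' r'.
Proof. by rewrite /cstep wconsr cofirst_linear wconsr scalerDr addrACA. Qed.

Lemma coder_linear : linear coder. Proof. exact: wpara_linear. Qed.

Lemma coder_nil : coder (word [::]) = cofirst (word [::]).
Proof. exact: wpara_nil. Qed.

Lemma coder_cons x y :
  coder (wcons x y) = cofirst (wcons x y) + wcons (ksgn 1 x) (coder y).
Proof. exact: wpara_cons. Qed.

Lemma coder_degree : has_degree 1 (coder : T -> T).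
Proof.
have hE p (y : T) : homog p y -> @homog k T (p + 1) (cofirst y).
  move=> /wdelta_degree hy; apply: (@lift2_homog k T T) hy;
    first exact: cofirst_bil.
  move=> q r u v hu hv; rewrite addrAC; apply: homog_wcons => //.
  exact: db.
move=> p y hy; suff [] : homog p y /\ @homog k T (p + 1) (coder y) by [].
move: p y hy; apply: tens_homog_ind.
- by move=> p; rewrite (lin0 coder_linear); split; apply: homog0.
- move=> p a x y [hx dx] [hy dy]; rewrite coder_linear.
  by split; apply: (@homogP k T).
- by split; [apply: homog_nil | rewrite coder_nil; apply/hE/homog_nil].
move=> p q x y hx hy [_ dy]; have hxy := homog_wcons hx hy; split=> //.
rewrite coder_cons; apply: (@homogD k T); first exact: hE.
by rewrite -addrA; apply: homog_wcons => //; apply: homog_ksgn.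
Qed.

(** The cut is in front of everything or after the new letter; by
coassociativity the latter cuts amount to applying [cofirst] to the left
factor. *)
Lemma cofirst_wdelta (W : lmodType k) (h : tens V -> tens V -> W) y :
  bilinear_map h -> lift2 h (wdelta (cofirst y)) =
    h (word [::]) (cofirst y) + lift2 (fun u v => h (cofirst u) v) (wdelta y).
Proof.
move=> hh; have [hl hr] := hh.
rewrite (lift2_lin _ _ (lift2_wdelta_linear hh)).
under [LHS]lift2_eq => u v do rewrite lift2_wdelta_cons //.
rewrite lift2_add -(lift2_lin _ _ (hr (word [::]))); congr (_ + _).
rewrite -(@wdelta_coassoc k V W (fun u v1 v2 => h (wcons (b u) v1) v2)).
  by apply: lift2_eq => u v; rewrite -(lift2_lin _ _ (hl v)).
split=> [y' z|x z|x y']; last exact: hr.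
- exact: lin_comp (hl z) (lin_comp (wconsl y') hb).
- exact: lin_comp (hl z) (wconsr _).
Qed.

Lemma coder_coderivation (W : lmodType k) (h : tens V -> tens V -> W) y :
  bilinear_map h -> lift2 h (wdelta (coder y)) =
    lift2 (fun u v => h (coder u) v + h (@ksgn k T 1 u) (coder v)) (wdelta y).
Proof.
have lD := coder_linear; have lS := @ksgn_linear k T 1.
have bilR (h' : tens V -> tens V -> W) : bilinear_map h' ->
    bilinear_map (fun u v => h' (coder u) v + h' (@ksgn k T 1 u) (coder v)).
  move=> hh; have [hl hr] := hh; split=> [v|u].
    exact: lin_add (lin_comp (hl v) lD) (lin_comp (hl _) lS).
  exact: lin_add (hr _) (lin_comp (hr _) lD).
move=> hh; move: y; apply: tens_ext => [||w].
- exact: lin_comp (lift2_wdelta_linear hh) lD.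
- exact/lift2_wdelta_linear/bilR.
elim: w h hh => [|x w IH] h hh.
  rewrite coder_nil cofirst_wdelta // lift2_wdelta_nil; last first.
    exact: (bilin_comp hh cofirst_linear (@lin_id _ _)).
  rewrite lift2_wdelta_nil; last exact: bilR.
  by rewrite ksgn_nil coder_nil addrC.
have [hl hr] := hh.
have hcx x' : bilinear_map (fun u v => h (wcons x' u) v).
  exact: (bilin_comp hh (wconsr x') (@lin_id _ _)).
rewrite -wcons_word coder_cons (linD (lift2_wdelta_linear hh)).
rewrite cofirst_wdelta // lift2_wdelta_cons; last first.
  exact: (bilin_comp hh cofirst_linear (@lin_id _ _)).
rewrite lift2_wdelta_cons // [in RHS]lift2_wdelta_cons; last exact: bilR.
rewrite (IH _ (hcx _)) ksgn_nil coder_nil coder_cons (linD (hr _)).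
rewrite addrACA -[(_ + _) + lift2 _ _ in LHS]addrA addrA -[in RHS]addrA.
rewrite [in LHS](addrC _ (h (cofirst _) _)) -[in LHS]addrA.
congr (_ + _); rewrite -[in RHS]addrA -[in LHS]addrA; congr (_ + (_ + _)).
rewrite -lift2_add; apply: lift2_eq => u v.
by rewrite coder_cons ksgn_wcons (linD (hl v)) -addrA.
Qed.

Lemma wcounit_cofirst y : wcounit (cofirst y) = 0.
Proof.
rewrite /cofirst (lift2_lin _ _ (@wcounit_linear _ V)) -[RHS](lift2_0 _ (wdelta
  y)).
by apply: lift2_eq => u v; rewrite wcounit_cons.
Qed.

Lemma wletter_cofirst y : wletter (cofirst y) = b y.
Proof.
rewrite /cofirst (lift2_lin _ _ (@wletter_linear _ V)) -[in
  RHS](wdelta_counit_r y).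
rewrite (lift2_lin _ _ hb); apply: lift2_eq => u v.
by rewrite wletter_cons (linZ hb).
Qed.

Lemma wcounit_coder y : wcounit (coder y) = 0.
Proof.
move: y; apply: (@tens_ind_ext _ _ _ _ (fun=> 0)).
- exact: (lin_comp (@wcounit_linear _ V) coder_linear).
- exact: lin_zero.
- by rewrite coder_nil wcounit_cofirst.
- move=> x y _; rewrite coder_cons (linD (@wcounit_linear _ V)).
  by rewrite wcounit_cofirst wcounit_cons addr0.
Qed.

Lemma wletter_coder y : wletter (coder y) = b y.
Proof.
move: y; apply: (@tens_ind_ext _ _ _ _ b).
- exact: (lin_comp (@wletter_linear _ V) coder_linear).
- exact: hb.
- by rewrite coder_nil wletter_cofirst.
- move=> x y _; rewrite coder_cons (linD (@wletter_linear _ V)).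
  by rewrite wletter_cofirst wletter_cons wcounit_coder scale0r addr0.
Qed.

(** The square is again a coderivation: the mixed terms cancel, since [coder],
being of degree 1, anticommutes with the sign operator. It therefore solves
the recursion of [corec_uniq1] once its letter component vanishes. *)
Lemma coderK : (forall y, b (coder y) = 0) -> forall y, coder (coder y) = 0.
Proof.
move=> bD; have lD := coder_linear; have lS := @ksgn_linear k T 1.
apply: (@corec_uniq1 _ V _ (@wdelta _ V) (@wletter _ V)) => c.
have hb1 := @wletter_bil _ V.
rewrite [LHS]wdecomp wcounit_coder scale0r add0r coder_coderivation //.
rewrite coder_coderivation; last first.
  split=> [v|u].
    exact: lin_add (lin_comp (hb1.1 v) lD) (lin_comp (hb1.1 _) lS).
  exact: lin_add (hb1.2 _) (lin_comp (hb1.2 _) lD).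
apply: lift2_eq => u v; have [hl hr] := hb1.
rewrite wletter_coder bD wcons0 add0r (ksgnK (V := T)).
rewrite (@ksgn_deg k T T 1 coder 1 u lD coder_degree) mulr1 ksign_1 scaleN1r.
by rewrite (linN (@wletter_linear _ V)) (linN (wconsl _)) addNKr.
Qed.

End Coder.

(** * Desuspension of words *)

Section Desuspension.
Variables (k : comPzRingType) (A : gmod k).
Let SA := shift A.

(** The map omega (x) ... (x) omega on words of the shift, for the identity
omega : SA -> A regarded as a map of degree 1: each letter passes the copies
of omega on its right. *)
Fixpoint desusp (w : seq A) : seq A :=
  if w is x :: w' then @ksgn k SA (size w')%:Z x :: desusp w' else [::].

Lemma size_desusp w : size (desusp w) = size w.
Proof. by elim: w => //= x w ->. Qed.

Lemma desuspK w : desusp (desusp w) = w.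
Proof. by elim: w => //= x w IH; rewrite IH size_desusp (ksgnK (V := SA)). Qed.

Lemma desusp_cat u v : desusp (u ++ v) =
  @wsgn k SA (size v)%:Z (desusp u) ++ desusp v.
Proof.
elim: u => [|x u IH] /=; first by rewrite /wsgn.
rewrite IH size_cat (ksgnD (V := SA)); congr cons.
by rewrite PoszD addrC.
Qed.

Lemma desusp_wsgn e w : desusp (@wsgn k SA e w) = @wsgn k SA e (desusp w).
Proof.
by elim: w => //= x w ->;
  rewrite (size_wsgn (V := SA)) !(ksgnD (V := SA)) addrC.
Qed.

Lemma desusp_mlin (W : lmodType k) (g : seq A -> W) :
  mlin g -> mlin (fun w => g (desusp w)).
Proof.
by move=> hg s t a x y; rewrite !desusp_cat /= (@ksgn_linear k SA) hg.
Qed.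

(** The operation g composed with the desuspension of words. *)
Definition ohat (W : lmodType k) (g : seq A -> W) : tens SA -> W :=
  wlift (fun w => g (desusp w)).

Lemma ohat_linear (W : lmodType k) (g : seq A -> W) : mlin g -> linear (ohat g).
Proof. by move=> hg; exact: wlift_is_linear (desusp_mlin hg). Qed.

Lemma ohat_word (W : lmodType k) (g : seq A -> W) w : mlin g ->
  ohat g (word w) = g (desusp w).
Proof. by move=> hg; exact: (wlift_word (desusp_mlin hg)). Qed.

(** Each of the n letters has lost one degree in the shift, which compensates
the -n in the degree of the n-ary operation. *)
Lemma ohat_degree (A' : gmod k) (g : seq A -> A') (d : int) : multilinear g ->
  multi_degree (fun n => d - n%:Z) g -> has_degree d (ohat g : tensg SA -> A').
Proof.
move=> hg dg; apply: has_degree_words; first exact: ohat_linear.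
move=> w hw; rewrite ohat_word //.
have [w' [e sz hw' ->]] : exists w' : seq (int * A), [/\
    \sum_(y <- w') y.1 = \sum_(y <- w) y.1 + (size w)%:Z, size w' = size w,
    all (fun y => homog y.1 y.2) w' & desusp [seq y.2 | y <- w] =
      [seq y.2 | y <- w']].
  elim: w hw => [_|y w IH /= /andP[hy /IH[w' [e sz hw' eo]]]].
    by exists [::]; rewrite !big_nil.
  exists ((y.1 + 1, @ksgn k SA (size w)%:Z y.2) :: w'); split=> /=.
  - by rewrite !big_cons e /= intS; ring.
  - by rewrite sz.
  - by rewrite hw' andbT; exact: (@homog_ksgn k SA).
  - by rewrite size_map eo.
have := dg _ hw'; rewrite e sz; congr homog; ring.
Qed.

Lemma ohat_multi_degree (A' : gmod k) (f : tens SA -> A') (d : int) :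
  has_degree d (f : tensg SA -> A') ->
  multi_degree (fun n => d - n%:Z) (fun w => f (word (desusp w))).
Proof.
move=> df w hw.
have [w' [e hw' ->]] : exists w' : seq (int * SA), [/\
    \sum_(y <- w') y.1 = \sum_(y <- w) y.1 - (size w)%:Z,
    all (fun y => homog y.1 y.2) w' & desusp [seq y.2 | y <- w] =
      [seq y.2 | y <- w']].
  elim: w hw => [_|y w IH /= /andP[hy /IH[w' [e hw' eo]]]].
    by exists [::]; rewrite !big_nil.
  exists ((y.1 - 1, @ksgn k SA (size w)%:Z y.2) :: w'); split=> /=.
  - by rewrite !big_cons e /= intS; ring.
  - rewrite hw' andbT; apply: (@homog_ksgn k SA).
    by rewrite homog_shift subrK.
  - by rewrite size_map eo.
have := df _ _ (homog_word hw'); rewrite e; congr homog; ring.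
Qed.

(** Each letter contributes the discrepancy of [ksgn_shift] between the signs
of A and of its shift. *)
Lemma mlin_wsgn_shift (W : lmodType k) (g : seq A -> W) e s : mlin g ->
  g (@wsgn k A e s) = ksign (e * (size s)%:Z) *: g (@wsgn k SA e s).
Proof.
elim: s g => [|x s IH] g hg /=; first by rewrite mulr0 ksign_0 scale1r.
rewrite ksgn_shift; have := hg [::] (wsgn e s) (ksign e) (@ksgn k SA e x) 0.
rewrite addr0 /= => ->; rewrite (mlin0 [::] _ hg) addr0.
rewrite (IH (fun s => g (_ :: s))); last exact: mlin_cons.
by rewrite scalerA -ksignD intS mulrDr mulr1.
Qed.

End Desuspension.

Arguments desusp {k} A w.
Arguments ohat {k} A {W} g x.

(** ** The coderivation of a family of operations *)

Section CoderWord.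
Variables (k : comPzRingType) (V : gmod k) (b : tens V -> V).
Hypothesis hb : linear b.

Lemma cofirst_word w : cofirst b (word w) =
  \sum_(n < (size w).+1) word (b (word (take n w)) :: drop n w).
Proof.
rewrite /cofirst lift2_wdelta_word; last exact: cofirst_bil.
by apply: eq_bigr => n _; rewrite wcons_word.
Qed.

(** Here j counts the letters in front of the subword consumed by b, and n its
length. *)
Lemma coder_word w : coder b (word w) =
  \sum_(j < (size w).+1) \sum_(n < (size w).+1 | (j + n <= size w)%N)
    word (wsgn 1 (take j w) ++ b (word (take n (drop j w))) :: drop (j + n) w).
Proof.
pose F w j n :=
  word (wsgn 1 (take j w) ++ b (word (take n (drop j w))) :: drop (j + n) w).
transitivity (\sum_(j < (size w).+1) \sum_(n < (size w - j).+1) F w j n).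
  elim: w => [|x w IH].
    by rewrite coder_nil // cofirst_word !big_ord_recl !big_ord0 /= !addr0.
  rewrite -wcons_word coder_cons // wcons_word cofirst_word IH
    [RHS]big_ord_recl.
  congr (_ + _).
  rewrite (lin_sum (wconsr _)); apply: eq_bigr => j _.
  rewrite (lin_sum (wconsr _)); apply: eq_bigr => n _.
  by rewrite /F /= wcons_word.
apply: eq_bigr => -[j hj] _ /=.
have hle : ((size w - j).+1 <= (size w).+1)%N by rewrite ltnS leq_subr.
rewrite (big_ord_widen _ (fun n => F w j n) hle).
by apply: eq_bigl => n; rewrite /= ltnS leq_subRL // -ltnS.
Qed.

End CoderWord.

Section Insert.
Variables (k : comPzRingType) (A : ainf k) (W : gmod k) (g : seq A -> W).
Hypothesis hg : multilinear g.
Let SA := shift A.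

(** The letter component of the bar differential. Its sign is the one for
which the letter projection satisfies the twisting equation m(tau) + tau d =
0. *)
Definition bar_op (y : tens SA) : SA := - ohat A (amul A) y.

Lemma bar_op_linear : linear bar_op.
Proof.
have h := ohat_linear (@amul_multilinear k A).
exact: (lin_opp h).
Qed.

Lemma bar_op_degree : has_degree 1 (bar_op : tensg SA -> SA).
Proof.
move=> p y hy; rewrite homog_shift /bar_op -scaleN1r; apply: homogZ.
rewrite -addrA.
exact: (ohat_degree (@amul_multilinear _ A) (@amul_degree _ A) hy).
Qed.

Lemma bar_op_word (w : seq A) : bar_op (word w) = - amul A (desusp A w).
Proof. exact: (congr1 -%R (ohat_word w (@amul_multilinear k A))). Qed.

(** With l letters on its right, the inserted value of b passes l
desuspensions, whence (-1)^l; moving m_n past the desuspensions of the j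
letters on its left gives (-1)^(jn). These are the signs of [insert_sum]. *)
Lemma ohat_coder (w : seq A) :
  ohat A g (coder bar_op (word w)) = - insert_sum g (amul A) (desusp A w).
Proof.
have lg : linear (ohat A g) by exact: ohat_linear.
rewrite (coder_word bar_op_linear) /insert_sum size_desusp (lin_sum lg) -sumrN.
apply: eq_bigr => -[j hj] _; rewrite (lin_sum lg) -sumrN.
apply: eq_bigr => -[n hn] /= hjn.
(* u and z are the letters on the left and on the right of the subword v. *)
set u := take j w; set v := take n (drop j w); set z := drop (j + n) w.
have ew : w = u ++ v ++ z by rewrite /u /v /z addnC -drop_drop !cat_take_drop.
have su : size u = j by rewrite size_takel.
have sv : size v = n by rewrite size_takel // size_drop leq_subRL.
have -> : (size w - j - n = size z)%N by rewrite size_drop subnDA.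
clearbody u v z.
have eo : desusp A w = @wsgn k SA (n%:Z + (size z)%:Z) (desusp A u) ++
    @wsgn k SA (size z)%:Z (desusp A v) ++ desusp A z.
  by rewrite ew !desusp_cat size_cat sv PoszD.
have su' e : size (@wsgn k SA e (desusp A u)) = j.
  exact: (etrans (@size_wsgn k SA e (desusp A u)) (etrans (@size_desusp k A u)
    su)).
have sv' e : size (@wsgn k SA e (desusp A v)) = n.
  exact: (etrans (@size_wsgn k SA e (desusp A v)) (etrans (@size_desusp k A v)
    sv)).
have -> : take j (desusp A w) = @wsgn k SA (n%:Z + (size z)%:Z) (desusp A u).
  by rewrite eo take_size_cat.
have -> : take n (drop j (desusp A w)) = @wsgn k SA (size z)%:Z (desusp A v).
  by rewrite eo drop_size_cat // take_size_cat.
have -> : drop (j + n) (desusp A w) = desusp A z.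
  by rewrite eo addnC -drop_drop !drop_size_cat.
rewrite ohat_word // desusp_cat /= desusp_wsgn (wsgnD (V := SA)).
have -> : @ksgn k SA (size z)%:Z (bar_op (word v)) =
    ksign (size z)%:Z *: - amul A (@wsgn k SA (size z)%:Z (desusp A v)).
  rewrite -desusp_wsgn -bar_op_word -(ksgn_word (V := SA)).
  rewrite (@ksgn_deg k (tensg SA) SA 1 bar_op _ _ bar_op_linear bar_op_degree)
    mulr1.
  by rewrite scalerA ksignK scale1r.
set a := amul A _; set r := desusp A z.
have hr : mlin (fun s : seq A => g (s ++ a :: r)).
  by move=> s t c x y; rewrite -!catA /= hg.
rewrite (mlin_wsgn_shift _ _ hr) su' (wsgnD (V := SA)).
have -> (s : seq A) c : g (s ++ (c *: - a : A) :: r) = - (c *: g (s ++ a :: r)).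
  rewrite scalerN -[- (c *: a)]scaleNr.
  by have := hg s r (- c) a 0; rewrite addr0 mlin0 // addr0 => ->;
    rewrite scaleNr.
rewrite scalerA; congr (- (_ *: g (_ ++ _))).
  rewrite -[(-1) ^+ _]/(ksign (j * n + size z)%N%:Z) -ksignD.
  (* j n + l + (2 - n) j and l differ by 2 j. *)
  apply: ksign_odd; rewrite (_ : _ - _ = - (2 * j%:Z)); first by lia.
  by rewrite PoszD PoszM; ring.
apply: (congr1 (fun e => @wsgn k SA e (desusp A u))); rewrite ?intS; ring.
Qed.

End Insert.

(** ** Block decompositions *)

Section Phi.
Variables (k : comPzRingType) (C V : lmodType k) (D : C -> tpow C 2).
Variables (eta : C -> k^o) (tau : C -> V).

(** The component of length n of the coalgebra map with letter component tau:
n copies of tau applied to the n-fold comultiplication, in recursive form. *)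
Fixpoint phin (n : nat) (c : C) : tens V :=
  if n is m.+1 then lift2 (fun a b => wcons (tau a) (phin m b)) (D c)
  else (eta c : k) *: word [::].

End Phi.

Section PhiWord.
Variables (k : comPzRingType) (V W : lmodType k) (tau : tens V -> W).
Hypotheses (ltau : linear tau) (tau0 : tau (word [::]) = 0).
Let ph := phin (@wdelta _ V) (@wcounit _ V) tau.

Lemma phin_tens_linear n : linear (ph n).
Proof.
elim: n => [|n IH] /=; first by move=> a x y;
  rewrite wcounit_linear scalerDl scalerA.
by apply: lift2_wdelta_linear; apply: (bilin_comp (@wcons_bilinear _ W)).
Qed.

(** On words the n-fold comultiplication enumerates the cuts into n blocks,
and tau kills the empty ones. P is any bound exceeding the length of w;
keeping it fixed lets the induction pass to the remainder of w. *)
Lemma phin_word P r w : (size w < P)%N ->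
  ph r (word w) = \sum_(t : r.-tuple 'I_P |
      all (fun i : 'I_P => 0 < i)%N t && (sumn (map val t) == size w))
    word [seq tau (word s) | s <- reshape (map val t) w].
Proof.
elim: r w => [|r IH] w hw.
  rewrite big_mkcond (big_pred1 [tuple]); last first.
    by move=> t; apply/esym/eqP/tuple0.
  rewrite /=; case: w {hw} => [|x w]; first by rewrite wcounit_nil scale1r.
  by rewrite -wcons_word wcounit_cons scale0r.
rewrite [ph _ _]lift2_wdelta_word; last first.
  exact: (bilin_comp (@wcons_bilinear _ W) ltau (@phin_tens_linear r)).
(* i is the length of the first block. *)
pose F i := wcons (tau (word (take i w))) (ph r (word (drop i w))).
rewrite (big_ord_widen _ F hw).
rewrite (reindex (fun p : 'I_P * r.-tuple 'I_P => [tuple of p.1 :: p.2])) /=;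
  last first.
  exists (fun t => (thead t, [tuple of behead t])) => [[i t] _|t _].
    by congr (_, _); apply: val_inj.
  by rewrite [RHS]tuple_eta.
pose G (i : 'I_P) (t : r.-tuple 'I_P) :=
  word (tau (word (take i w)) ::
        [seq tau (word s) | s <- reshape (map val t) (drop i w)]).
pose Q (i : 'I_P) (t : r.-tuple 'I_P) :=
  all (fun i : 'I_P => 0 < i)%N t && (i + sumn (map val t) == size w)%N.
transitivity (\sum_(p : 'I_P * r.-tuple 'I_P | (0 < p.1)%N && Q p.1 p.2)
    G p.1 p.2); last by apply: eq_big => [[i t]|[i t] _] //=; rewrite andbA.
rewrite -(pair_big_dep (fun i : 'I_P => (0 < i)%N) Q G) /=.
rewrite big_mkcond [RHS]big_mkcond; apply: eq_bigr => i _.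
rewrite ltnS; case: posnP => [i0|ipos].
  by case: ifP => // _; rewrite /F i0 take0 tau0 wcons0.
case: leqP => [iw|wi]; last first.
  rewrite big1 // => t /andP[_ /eqP e]; move: wi.
  by rewrite -e ltnNge leq_addr.
rewrite /F IH; last by rewrite size_drop; apply: leq_ltn_trans hw;
  apply: leq_subr.
rewrite (lin_sum (wconsr _)); apply: eq_big => t; last by rewrite wcons_word.
by rewrite size_drop -(eqn_add2l i) subnKC.
Qed.

Lemma phin_vanish r w : (size w < r)%N -> ph r (word w) = 0.
Proof.
move=> hr; rewrite (@phin_word (size w).+1) // big1 // => t /andP[ht /eqP e].
suff : (size t <= sumn (map val t))%N by rewrite e size_tuple leqNgt hr.
elim: (val t) ht {e} => //= i s IH /andP[i0 /IH h].
by apply: leq_trans (leq_add i0 h); rewrite add1n.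
Qed.

End PhiWord.

Section Block.
Variables (k : comPzRingType) (A A' : gmod k) (W : gmod k).
Variables (f : seq A -> A') (g : seq A' -> W).
Hypotheses (hf : multilinear f) (hg : multilinear g) (f0 : f [::] = 0).
Hypothesis df : multi_degree (fun n => 1 - n%:Z) f.
Let SA := shift A.
Let SA' := shift A'.

(** [ohat] with values in the shift, where it has degree 0 for f_i of degree
1 - i. *)
Definition ohatS : tens SA -> SA' := ohat A f.

Lemma ohatS_linear : linear ohatS. Proof. exact: (ohat_linear hf). Qed.

Lemma ohatS_degree : has_degree 0 (ohatS : tensg SA -> SA').
Proof.
move=> p y hy; rewrite homog_shift addr0.
exact: (ohat_degree hf df hy).
Qed.

Lemma ohatS_word (w : seq A) : ohatS (word w) = f (desusp A w).
Proof. exact: (ohat_word w hf). Qed.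

Lemma ohatS0 : ohatS (word [::]) = 0. Proof. by rewrite ohatS_word. Qed.

Lemma ksgn_ohatS e (w : seq A) :
  @ksgn k SA' e (f (desusp A w)) = f (@wsgn k SA e (desusp A w)).
Proof.
rewrite -desusp_wsgn -!ohatS_word -(ksgn_word (V := SA)).
by rewrite (@ksgn_deg0 k (tensg SA) SA' ohatS _ _ ohatS_linear ohatS_degree).
Qed.

(** The first block, of length n, meets the maps on its right, whose total
degree is size i - sumn i. *)
Lemma block_sign_cons n i : block_sign (n :: i) =
  n%:Z * ((size i)%:Z - (sumn i)%:Z) + block_sign i.
Proof.
have sE : (size i)%:Z - (sumn i)%:Z = \sum_(u < size i) (1 - (nth 0%N i u)%:Z).
  elim: i => [|m i IH] /=; first by rewrite big_ord0.
  by rewrite big_ord_recl /= -IH intS PoszD; ring.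
rewrite sE /block_sign big_ord_recl /= mulr0 add0r mulr_sumr -big_split.
by apply: eq_bigr => u _ /=; rewrite PoszD; ring.
Qed.

(** Going from A to its shift, each f_i passes the desuspensions of the blocks
on its left; the total exponent is [block_sign]. *)
Lemma block_term (i : seq nat) (w : seq A) (h : seq A' -> W) : multilinear h ->
  sumn i = size w ->
  ksign (block_sign i) *:
    h (ktens (@wsgn k A) [seq (1 - n%:Z, f) | n <- i]
         (reshape i (desusp A w))) =
  h (desusp A' [seq f (desusp A s) | s <- reshape i w]).
Proof.
elim: i w h => [|n i IH] w h hh hw.
  by rewrite /= /block_sign big_ord0 ksign_0 scale1r.
set u := take n w; set v := drop n w.
have ew : w = u ++ v by rewrite cat_take_drop.
have su : size u = n by rewrite size_takel // -hw leq_addr.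
have sv : size v = sumn i by rewrite size_drop -hw addKn.
clearbody u v.
have sz : size [seq f (desusp A s) | s <- reshape i v] = size i.
  by rewrite size_map size_reshape.
have su' e : size (@wsgn k SA e (desusp A u)) = n.
  exact: (etrans (@size_wsgn k SA e (desusp A u)) (etrans (@size_desusp k A u)
    su)).
rewrite ew desusp_cat /= !take_size_cat // !drop_size_cat //= sz ksgn_ohatS.
rewrite (mlin_wsgn_shift _ _ hf) su' (wsgnD (V := SA)).
(* The total degree of the maps f_i applied to the remaining blocks. *)
have -> : \sum_(g0 <- [seq (1 - n0%:Z, f) | n0 <- i]) g0.1 =
  (size i)%:Z - (sumn i)%:Z.
  rewrite big_map; elim: (i) => [|m i' IH'] /=; first by rewrite big_nil.
  by rewrite big_cons IH' /= intS PoszD; ring.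
set x := f (@wsgn k SA (size i)%:Z (desusp A u)).
have hx : multilinear (fun s => h (x :: s)) by exact: (mlin_cons x hh).
rewrite sv subrK -(IH v _ hx (esym sv)).
have := hh [::]
   (ktens (@wsgn k A) [seq (1 - n%:Z, f) | n <- i] (reshape i (desusp A v)))
   (ksign (((size i)%:Z - (sumn i)%:Z) * n%:Z)) x 0.
rewrite addr0 (mlin0 [::]) // addr0 /= => ->.
rewrite block_sign_cons ksignD scalerA -mulrA [_ * ksign _]mulrC mulrA.
by rewrite [n%:Z * _]mulrC ksignK mul1r.
Qed.

Lemma block_sumE (w : seq A) : block_sum g f (desusp A w) =
  \sum_(r < (size w).+1)
    ohat A' g (phin (@wdelta _ SA) (@wcounit _ SA) ohatS r (word w)).
Proof.
have lg := ohat_linear hg.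
rewrite /block_sum size_desusp; apply: eq_bigr => r _.
rewrite (phin_word ohatS_linear ohatS0 r (ltnSn (size w))) (lin_sum lg).
apply: eq_bigr => t /andP[_ /eqP ht].
rewrite -[X in X *: _]/(ksign _) block_term // ohat_word //.
congr (g (desusp A' _)); apply: eq_map => s; exact/esym/ohatS_word.
Qed.

End Block.

(** * Maps into the tensor coalgebra *)

Section CoalgebraFacts.
Variables (k : comPzRingType) (C : cgacdg k).

Lemma comul_linear : linear (comul C). Proof. exact: linearP. Qed.

Lemma comul_coassoc : coassociative (comul C).
Proof. by apply/coassocP => c; apply: comulA. Qed.

Lemma counitl c : lift2 (fun u v => (ceta C u : k) *: v) (comul C c) = c.
Proof. exact: counit_l. Qed.

Lemma counitr c : lift2 (fun u v => (ceta C v : k) *: u) (comul C c) = c.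
Proof. exact: counit_r. Qed.

Lemma comul_eps : comul C (ceps C 1) = tens2 (ceps C 1) (ceps C 1).
Proof. exact: ceps_comul. Qed.

Lemma ceta_ksgn e c : ceta C (ksgn e c) = ceta C c.
Proof.
have l1 : linear (fun c => ceta C (ksgn e c)).
  exact: (lin_comp (@linearP _ _ _ _ (ceta C)) (ksgn_linear e)).
move: c; apply: homog_ext; [exact: l1 | exact: linearP |].
move=> p c hc; rewrite (ksgnH _ hc) linearZ /=.
have [->|p0] := eqVneq p 0; first by rewrite mulr0 ksign_0 scale1r.
by rewrite (ceta_degree hc p0) scaler0.
Qed.

Lemma comul_cdif (W : lmodType k) (h : C -> C -> W) c : bilinear_map h ->
  lift2 h (comul C (cdif C c)) =
  lift2 (fun u v => h (cdif C u) v + h (ksgn 1 u) (cdif C v)) (comul C c).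
Proof.
move=> hh; rewrite cdif_coder (tlift_lin _ _ (lift2_is_linear hh)).
apply: tlift_eq => t; rewrite (linD (lift2_is_linear hh)).
by rewrite -!/(tens2 _ _) !lift2_pure.
Qed.

(** Applying the counit to both factors of the coderivation rule gives eta d =
eta d + eta d. *)
Lemma ceta_cdif c : ceta C (cdif C c) = 0.
Proof.
have le := @linearP _ _ _ _ (ceta C).
have hb := bilin_scale (k^o : lmodType k) le.
have hh : bilinear_map (fun u v => (ceta C u : k) *: (ceta C v : k^o)).
  exact: (bilin_comp hb (@lin_id _ _) le).
have hc x : lift2 (fun u v => (ceta C u : k) *: (ceta C v : k^o)) (comul C x) =
  ceta C x.
  rewrite -[in RHS](counitl x) (lift2_lin _ _ le); apply: lift2_eq => u v.
  by rewrite linearZ.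
have led : linear (fun x => ceta C (cdif C x)) by move=> a x y;
  rewrite !linearP.
have := hc (cdif C c); rewrite comul_cdif // lift2_add.
have -> : lift2 (fun u v => (ceta C (cdif C u) : k) *: (ceta C v : k^o))
    (comul C c) = ceta C (cdif C c).
  rewrite -[in RHS](counitr c) (lift2_lin _ _ led); apply: lift2_eq => u v.
  by rewrite (linZ led); apply: mulrC.
have -> : lift2
    (fun u v => (ceta C (ksgn 1 u) : k) *: (ceta C (cdif C v) : k^o))
    (comul C c) = ceta C (cdif C c).
  rewrite -[in RHS](counitl c) (lift2_lin _ _ led); apply: lift2_eq => u v.
  by rewrite (linZ led) ceta_ksgn.
by move/eqP; rewrite -subr_eq0 addrK => /eqP.
Qed.

End CoalgebraFacts.

Section Phi.
Variables (k : comPzRingType) (C : cgacdg k) (V : gmod k) (tau : C -> V).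
Hypotheses (ltau : linear tau) (tau_eps : forall a, tau (ceps C a) = 0).
Let T := tensg V.
Let D := comul C.
Let ph := phin D (ceta C) tau.

Lemma phin_lin n : linear (ph n).
Proof.
elim: n => [|n IH] /=; first by move=> a x y; rewrite linearP scalerDl scalerA.
have hb := bilin_comp (@wcons_bilinear _ V) ltau IH.
exact: (lin_comp (lift2_is_linear hb) (@comul_linear _ C)).
Qed.

Lemma phin_bil n : bilinear_map (fun a b => wcons (tau a) (ph n b)).
Proof. exact: (bilin_comp (@wcons_bilinear _ V) ltau (phin_lin n)). Qed.

Lemma word_tau_mlin : mlin (fun s => word (map tau s)).
Proof. exact: (mlin_map ltau (@word_mlin _ V)). Qed.

Lemma phin_iter_lift n c : ph n.+1 c =
  iter_lift D (fun s => word (map tau s)) n c.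
Proof.
elim: n c => [|n IH] c.
  rewrite iter_lift0; last exact: word_tau_mlin.
  transitivity (wcons (tau c) (word [::])); last by rewrite wcons_word.
  have l1 : linear (fun x => wcons (tau x) (word [::])).
    exact: (lin_comp (@wconsl _ V _) ltau).
  rewrite -[in RHS](counitr c) (lift2_lin _ _ l1); apply: lift2_eq => a b.
  by rewrite (linZ l1) (linZ (wconsr _)).
rewrite iter_liftS; [|exact: comul_linear|exact: comul_coassoc|exact:
  word_tau_mlin].
transitivity (lift2 (fun a b => wcons (tau a) (ph n.+1 b)) (D c)); first by [].
apply: lift2_eq => a b; rewrite IH.
rewrite /iter_lift (tlift_lin _ _ (wconsr (tau a))); apply: tlift_eq => t /=.
by rewrite wcons_word.
Qed.

(** By cocompleteness: tau factors through the cokernel of the augmentation,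
where the iterated comultiplications of a given element eventually vanish. *)
Lemma phin_finite c : exists N, forall n, (N <= n)%N -> ph n c = 0.
Proof.
have [N _ hN] := ccocomplete (cpi (ceps C) c).
exists N.+1 => -[|n] // hn; rewrite phin_iter_lift.
(* The factorization of tau through the cokernel. *)
pose taub (x : coker (ceps C)) := tau (repr x).
have taubE x : taub (cpi (ceps C) x) = tau x.
  have /eqP/coker_piP[u hu] := coker_reprK (cpi (ceps C) x).
  by rewrite /taub -[repr _](subrK x) hu (linD ltau) tau_eps add0r.
have ltaub : linear taub.
  move=> a x y; rewrite -[x]coker_reprK -[y]coker_reprK.
  pose p := cpi (ceps C).
  change (taub (a *: p (repr x) + p (repr y)) =
    a *: taub (p (repr x)) + taub (p (repr y))).
  by rewrite -linearP !taubE ltau.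
have hG := mlin_map ltaub (@word_mlin _ V).
transitivity (iter_lift D (fun s => word (map taub (map (cpi (ceps C)) s))) n
  c).
  apply: tlift_eq => t; congr word; rewrite -map_comp.
  by apply: eq_map => x /=; apply/esym/taubE.
rewrite (iter_lift_red (comul_eps C) n c hG) /iter_lift (iter_red_vanish
  (comul_eps C) _ hN).
  exact: (lin0 (tlift_is_linear (mlin_tuple n.+1 hG))).
exact: leq_trans (leq_pred N) hn.
Qed.

Lemma wlen_phin m n c : wlen m (ph n c) = if m == n then ph n c else 0.
Proof.
elim: n m c => [|n IH] m c /=.
  by rewrite (linZ (wlen_linear m)) wlen_nil; case: eqP; rewrite ?scaler0.
rewrite (lift2_lin _ _ (wlen_linear m)); case: m => [|m] /=.
  rewrite -[RHS](lift2_0 _ (D c)); apply: lift2_eq => a b; exact: wlen_cons0.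
rewrite eqSS; case: (m =P n) => [->|/eqP/negbTE mn].
  by apply: lift2_eq => a b; rewrite wlen_consS IH eqxx.
rewrite -[RHS](lift2_0 _ (D c)); apply: lift2_eq => a b.
by rewrite wlen_consS IH mn (lin0 (wconsr _)).
Qed.

Lemma Phi_ex c : exists y : tens V, forall n, wlen n y = ph n c.
Proof.
have [N hN] := phin_finite c; exists (\sum_(i < N) ph i c) => n.
rewrite (lin_sum (wlen_linear n)); case: (ltnP n N) => hn.
  rewrite (bigD1 (Ordinal hn)) //= wlen_phin eqxx big1 ?addr0 // => i /negP hi.
  by rewrite wlen_phin; case: eqP => // e; case: hi; apply/eqP/val_inj.
rewrite hN // big1 // => i _; rewrite wlen_phin; case: eqP => // e.
by have := ltn_ord i; rewrite -e ltnNge hn.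
Qed.

(** The tensor with the prescribed components of each length. *)
Definition Phi (c : C) : tens V := sval (cid (Phi_ex c)).

Lemma wlen_Phi n c : wlen n (Phi c) = ph n c.
Proof. by rewrite /Phi; case: cid. Qed.

Lemma wlen_inj (y z : tens V) : (forall n, wlen n y = wlen n z) -> y = z.
Proof.
move=> h; apply/eqP; rewrite -subr_eq0; apply/eqP/wlen_eq0 => n.
by rewrite (linD (wlen_linear n)) (linN (wlen_linear n)) h subrr.
Qed.

Lemma Phi_fin_sum c : fin_sum (ph^~ c) (Phi c).
Proof.
have [N hN] := phin_finite c; exists N => //.
rewrite [LHS](@wlen_sum _ V _ N); first by apply: eq_bigr => i _;
  rewrite wlen_Phi.
by move=> n /hN; rewrite wlen_Phi.
Qed.

Lemma Phi_linear : linear Phi.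
Proof.
move=> a x y; apply: wlen_inj => n.
by rewrite wlen_linear !wlen_Phi phin_lin.
Qed.

Lemma Phi_rec c :
  Phi c = (ceta C c : k) *: word [::] +
    lift2 (fun a b => wcons (tau a) (Phi b)) (D c).
Proof.
apply: wlen_inj => n;
  rewrite wlen_Phi (linD (wlen_linear n)) (linZ (wlen_linear n)).
rewrite wlen_nil (lift2_lin _ _ (wlen_linear n)); case: n => [|n] /=.
  rewrite (lift2_eq (h := fun _ _ => 0)) ?lift2_0 ?addr0 // => a b.
  exact: wlen_cons0.
rewrite scaler0 add0r; apply: lift2_eq => a b.
by rewrite wlen_consS wlen_Phi.
Qed.

Lemma Phi_uniq (psi : C -> tens V) : linear psi ->
  (forall c, psi c = (ceta C c : k) *: word [::] +
     lift2 (fun a b => wcons (tau a) (psi b)) (D c)) -> psi =1 Phi.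
Proof.
move=> lpsi hpsi c; apply: wlen_inj => n; rewrite wlen_Phi.
elim: n c => [|n IH] c;
  rewrite hpsi (linD (wlen_linear _)) (linZ (wlen_linear _)).
  rewrite wlen_nil (lift2_lin _ _ (wlen_linear _)) /=.
  rewrite (lift2_eq (h := fun _ _ => 0)) ?lift2_0 ?addr0 // => a b.
  exact: wlen_cons0.
rewrite wlen_nil scaler0 add0r (lift2_lin _ _ (wlen_linear _)).
by apply: lift2_eq => a b; rewrite wlen_consS IH.
Qed.

Lemma wcounit_Phi c : wcounit (Phi c) = ceta C c.
Proof.
have lc := @wcounit_linear _ V.
rewrite Phi_rec (linD lc) (linZ lc) wcounit_nil (lift2_lin _ _ lc).
rewrite (lift2_eq (h := fun _ _ => 0)) ?lift2_0 ?addr0; last first.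
  by move=> a b; apply: wcounit_cons.
by rewrite /GRing.scale /= mulr1.
Qed.

Lemma wletter_Phi c : wletter (Phi c) = tau c.
Proof.
have ll := @wletter_linear _ V.
rewrite Phi_rec (linD ll) (linZ ll) wletter_nil scaler0 add0r (lift2_lin _ _
  ll).
rewrite -[in RHS](counitr c) (lift2_lin _ _ ltau); apply: lift2_eq => a b.
by rewrite wletter_cons wcounit_Phi (linZ ltau).
Qed.

Lemma Phi_eps a : Phi (ceps C a) = wunit V a.
Proof.
have e1 : Phi (ceps C 1) = word [::].
  rewrite Phi_rec ceps_counit scale1r [D _]comul_eps lift2_pure; last first.
    exact: (bilin_comp (@wcons_bilinear _ V) ltau Phi_linear).
  by rewrite tau_eps wcons0 addr0.
have -> : ceps C a = (a : k) *: ceps C 1 by apply: eps_scale.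
by rewrite (linZ Phi_linear) e1.
Qed.

Lemma Phi_bil : bilinear_map (fun a b => wcons (tau a) (Phi b)).
Proof. exact: (bilin_comp (@wcons_bilinear _ V) ltau Phi_linear). Qed.

(** Both sides satisfy X c = [] (x) Phi c + sum tau(c_1) :: X c_2, the letter
being put in front of the left factor; for the right-hand side this is
coassociativity of C. So [corec_uniq2] applies to their difference. *)
Lemma Phi_comul c : wdelta (Phi c) =
  lift2 (fun a b => tens2 (Phi a) (Phi b)) (D c).
Proof.
have ht := tens2_bilinear (tens V); have [htl htr] := ht.
pose K x := lift2 (fun u v : tens V => tens2 (wcons x u) v).
have hK x : bilinear_map (fun u v : tens V => tens2 (wcons x u) v).
  exact: (bilin_comp ht (wconsr x) (@lin_id _ _)).
have lK x : linear (K x) by exact: lift2_is_linear.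
(* K x puts x in front of the left factor; L and R are the recursions for the
two sides. *)
have L c' : wdelta (Phi c') = tens2 (word [::]) (Phi c') +
    lift2 (fun a b => K (tau a) (wdelta (Phi b))) (D c').
  rewrite {1}Phi_rec (linD (@wdelta_linear _ V)) (linZ (@wdelta_linear _ V)).
  rewrite wdelta_nil (lift2_lin _ _ (@wdelta_linear _ V)).
  rewrite [in RHS]Phi_rec (linD (htr _)) (linZ (htr _)) -addrA; congr (_ + _).
  rewrite (lift2_lin _ _ (htr _)) -lift2_add; apply: lift2_eq => a b.
  by rewrite -[wdelta (wcons _ _)]lift2_id lift2_wdelta_cons.
have R c' : lift2 (fun a b => tens2 (Phi a) (Phi b)) (D c') =
  tens2 (word [::]) (Phi c') +
    lift2 (fun a b =>
      K (tau a) (lift2 (fun a b => tens2 (Phi a) (Phi b)) (D b))) (D c').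
  transitivity (lift2 (fun a b => tens2 (word [::]) ((ceta C a : k) *: Phi b) +
     lift2 (fun a1 a2 => tens2 (wcons (tau a1) (Phi a2)) (Phi b)) (D a))
     (D c')).
    apply: lift2_eq => a b; rewrite {1}Phi_rec (linD (htl _)) (linZ (htl _)).
    by rewrite (linZ (htr _)) (lift2_lin _ _ (htl _)).
  rewrite lift2_add; congr (_ + _).
    rewrite -(lift2_lin _ _ (htr _)) -[in RHS](counitl c') (lift2_lin _ _
      Phi_linear).
    by congr tens2; apply: lift2_eq => a b; rewrite (linZ Phi_linear).
  rewrite (@comul_coassoc _ C _ (fun a1 a2 b => tens2 (wcons (tau a1) (Phi a2))
    (Phi b))).
    apply: lift2_eq => a b; rewrite (lift2_lin _ _ (lK _));
      apply: lift2_eq => u v.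
    by rewrite /K lift2_pure.
  split=> [y z|x z|x y].
  - exact: (lin_comp (htl _) (lin_comp (wconsl _) ltau)).
  - exact: (lin_comp (htl _) (lin_comp (wconsr _) Phi_linear)).
  - exact: (lin_comp (htr _) Phi_linear).
pose delta c' :=
  wdelta (Phi c') - lift2 (fun a b => tens2 (Phi a) (Phi b)) (D c').
apply/eqP; rewrite -subr_eq0; apply/eqP.
apply: (@corec_uniq2 _ V _ D tau delta) => c'.
rewrite {1}/delta L R opprD addrACA subrr add0r.
rewrite -lift2_sub.
by apply: lift2_eq => a b;
  rewrite -/(K _ _) -[RHS]/(K _ _) (linD (lK _)) (linN (lK _)).
Qed.

Hypothesis dtau : has_degree 0 tau.

Lemma Phi_degree : has_degree 0 (Phi : C -> T).
Proof.
have hn n p c : homog p c -> @homog k T p (ph n c).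
  elim: n p c => [|n IH] p c hc /=.
    have [->|p0] := eqVneq p 0; first by apply: (@homogZ k T); apply: homog_nil.
    by rewrite (ceta_degree hc p0) scale0r; apply: homog0.
  rewrite -[p]addr0; apply: (@lift2_homog k C T p 0 _ _ (phin_bil n)).
    move=> q r u v hu hv; rewrite addr0; apply: homog_wcons; last exact: IH.
    by rewrite -[q]addr0; apply: dtau.
  exact: comul_degree.
move=> p c hc; have [N _ ->] := Phi_fin_sum c.
by apply: (@homog_sum k T) => i _; rewrite addr0; apply: hn.
Qed.

(** Both composites Phi d and d Phi are coderivations along Phi, so their
difference solves the recursion of [corec_uniq1], with a sign operator on the
letter, once the letter components agree. *)
Lemma Phi_dif (b : tens V -> V) : linear b -> has_degree 1 (b : T -> V) ->
  (forall c, b (Phi c) = tau (cdif C c)) <->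
  (forall c, Phi (cdif C c) = coder b (Phi c)).
Proof.
move=> lb db; split=> h c; last by rewrite -wletter_Phi h wletter_coder.
have lD := coder_linear lb; have hl := @wletter_bil _ V; have [hll hlr] := hl.
pose delta c := Phi (cdif C c) - coder b (Phi c).
apply/eqP; rewrite -subr_eq0; apply/eqP.
apply: (@corec_uniq1 _ V _ D (fun a => tau (ksgn 1 a)) delta) => {}c.
rewrite {1}/delta [Phi _]Phi_rec ceta_cdif scale0r add0r.
rewrite [coder _ _]wdecomp wcounit_coder // scale0r add0r.
rewrite (comul_cdif _ Phi_bil) coder_coderivation // Phi_comul.
have hc : bilinear_map (fun u v : tens V =>
    wcons (wletter (coder b u)) v +
      wcons (wletter (@ksgn k T 1 u)) (coder b v)).
  split=> [v|u].
    apply: lin_add; first exact: (lin_comp (hll v) lD).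
    exact: (lin_comp (hll _) (@ksgn_linear k T 1)).
  exact: (lin_add (hlr _) (lin_comp (hlr _) lD)).
rewrite (lift2_lin _ _ (lift2_is_linear hc)).
rewrite -lift2_sub; apply: lift2_eq => u v;
  rewrite lift2_pure // wletter_coder // h.
rewrite -(@ksgn_deg0 k C T Phi 1 u Phi_linear Phi_degree) wletter_Phi.
rewrite opprD addrACA subrr add0r /delta (linD (wconsr _)).
by rewrite (linN (wconsr _)).
Qed.

End Phi.

(** * The bar construction *)

Section Bar.
Variables (k : comPzRingType) (A : ainf k).
Let SA := shift A.
Let T := tensg SA.
Let bA : tens SA -> SA := @bar_op k A.
Let lb : linear bA := @bar_op_linear k A.
Let db : has_degree 1 (bA : T -> SA) := @bar_op_degree k A.

(** The A-infinity relation, through [ohat_coder]. *)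
Lemma bar_op_coder y : bA (coder bA y) = 0.
Proof.
move: y; apply: (@tens_ext _ _ _ _ (fun=> 0)).
- exact: (lin_comp lb (coder_linear lb)).
- exact: lin_zero.
move=> w.
have h := ohat_coder (@amul_multilinear k A) w.
rewrite -[LHS]/(- ohat A (amul A) (coder (@bar_op k A) (word w))) h.
by rewrite opprK amul_rel.
Qed.

Definition bar : cgacdg k.
Proof.
refine (@CgaCdg k T (mklin (coder_linear lb)) (wdeltaL SA) (wunitL SA)
  (mklin (@wcounit_linear _ SA)) _ _ _ _ _ _ _ _ _ _ _ _).
- exact: wdelta_degree.
- exact: wcounit_degree.
- by rewrite /= wunit1; apply: homog_nil.
- exact: (coder_degree lb db).
- move=> c; exact: (coassocP (@wdelta _ SA)).1 (@wdelta_coassoc _ SA) c.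
- exact: wdelta_counit_l.
- exact: wdelta_counit_r.
- exact: (coderK lb db bar_op_coder).
- move=> c; rewrite -[LHS]lift2_id.
  exact: (coder_coderivation lb c (tens2_bilinear (tens SA))).
- by rewrite /= wunit1 wdelta_nil.
- by rewrite /= wunit1 wcounit_nil.
- exact: wdelta_cocomplete.
Defined.

(** A coalgebra map into the bar construction satisfies the recursion that
determines it from its letter component. *)
Lemma cga_bar_rec (C : cgacdg k) (phi : cga_hom C bar) c :
  phi c = (ceta C c : k) *: word [::] +
    lift2 (fun a b => wcons (wletter (phi a)) (phi b)) (comul C c) :> tens SA.
Proof.
rewrite [LHS]wdecomp -[wcounit _]/(ceta bar _) chom_eta; congr (_ + _).
rewrite -[wdelta _]/(comul bar (phi c)) chom_comul.
by rewrite (lift2_tmap _ _ (@wletter_bil _ SA)).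
Qed.

End Bar.

Section CgaHomEq.
Variable k : comPzRingType.

Lemma cga_hom_eq (C D : cgacdg k) (f g : cga_hom C D) : f =1 g -> f = g.
Proof.
case: f g => [f h1 h2 h3 h4 h5] [g g1 g2 g3 g4 g5] /= /linear_eq_fun fg.
by subst g; congr CgaHom; apply: Prop_irrelevance.
Qed.

Lemma tw_eqP (C : cgacdg k) (A : ainf k) (s t : tw C A) : s =1 t -> s = t.
Proof.
case: s t => [f h1 h2 h3] [g g1 g2 g3] /= /linear_eq_fun fg.
by subst g; congr Tw; apply: Prop_irrelevance.
Qed.

Lemma ainf_hom_eq (A A' : ainf k) (f g : ainf_hom A A') : f =1 g -> f = g.
Proof.
case: f g => [f h1 h2 h3 h4] [g g1 g2 g3 g4] /= /funext fg.
by subst g; congr AInfHom; apply: Prop_irrelevance.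
Qed.

Lemma inj_surj_bij (T U : Type) (f : T -> U) :
  injective f -> (forall y, exists x, f x = y) -> bijective f.
Proof.
move=> fi fs; exists (fun y => sval (cid (fs y))) => [x|y]; last by case: cid.
by apply: fi; case: cid.
Qed.

End CgaHomEq.

(** ** Twisting cochains *)

Section Twisting.
Variables (k : comPzRingType) (A : ainf k) (C : cgacdg k).
Let SA := shift A.
Variable tau : C -> A.
Hypotheses (ltau : linear tau) (dtau : has_degree 1 tau).
Hypothesis tau_eps : forall a, tau (ceps C a) = 0.

Lemma tau_ksgn e c : tau (ksgn e c) = @ksgn k SA e (tau c).
Proof.
rewrite (ksgn_deg _ _ ltau dtau) mulr1 ksgn_shift scalerA ksignK.
exact: scale1r.
Qed.

Lemma tau_degree0 : has_degree 0 (tau : C -> SA).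
Proof. by move=> p x hx; rewrite homog_shift addr0; apply: dtau. Qed.

(** Since tau has degree 0 as a map to the shift, the Koszul signs can be
moved from C to A. *)
Lemma ktens_desusp (s : seq C) :
  ktens (@ksgn k C) (nseq (size s) (1%:Z, tau)) s = desusp A (map tau s).
Proof.
elim: s => //= x s ->; rewrite tau_ksgn size_map; congr cons.
by rewrite big_nseq iter_addr addr0 [_ *+ _]natz.
Qed.

Lemma ohat_phin (A' : gmod k) (g : seq A -> A') n c : multilinear g ->
  ohat A g (phin (comul C) (ceta C) (tau : C -> SA) n.+1 c) =
  tlift (fun t : n.+1.-tuple C =>
    g (ktens (@ksgn k C) (nseq n.+1 (1%:Z, tau)) t)) (iter_comul (comul C) n c).
Proof.
move=> hg; have lt : linear (tau : C -> SA) by exact: ltau.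
rewrite (phin_iter_lift lt) /iter_lift (tlift_lin _ _ (ohat_linear hg)).
apply: tlift_eq => t; rewrite ohat_word // -ktens_desusp.
by rewrite size_tuple.
Qed.

(** The term tau d belongs to the operation b_1. *)
Lemma hom_mulE n c : hom_mul (nseq n (1%:Z, tau)) c =
  ohat A (amul A) (phin (comul C) (ceta C) (tau : C -> SA) n c) +
  (if n == 1%N then tau (cdif C c) else 0).
Proof.
have hm := @amul_multilinear k A; have lm := ohat_linear hm.
case: n => [|[|n]].
- rewrite addr0 /= (linZ lm) -[word [::]]/(@word k SA [::]).
  by rewrite (ohat_word [::] hm).
- rewrite (ohat_phin _ _ hm) /= expr1 scaleN1r opprK; congr (_ + _).
  rewrite tlift_pure; last first.
    pose g (s : seq C) := amul A (desusp A (map tau s)).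
    have hg : mlin g by exact: (mlin_map ltau (desusp_mlin hm)).
    move=> t i a x y; have := mlin_tuple 1 hg t i a x y.
    by rewrite /g -!ktens_desusp !size_tuple.
  by rewrite /= big_nil ksgn0.
rewrite addr0 (ohat_phin _ _ hm) /=.
by move: (size (nseq n (1%:Z, tau))) (size_nseq n (1%:Z, tau)) => m ->.
Qed.

Lemma hom_mul_sum c : fin_sum (fun n => hom_mul (nseq n (1%:Z, tau)) c)
  (ohat A (amul A) (Phi (V := SA) ltau tau_eps c) + tau (cdif C c)).
Proof.
have lm := ohat_linear (@amul_multilinear k A).
have [N hN hP] := Phi_fin_sum (V := SA) ltau tau_eps c.
exists (maxn N 2) => [n|].
  rewrite geq_max => /andP[nN n2]; rewrite hom_mulE hN // (lin0 lm) add0r.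
  by case: eqP n2 => // ->.
rewrite (eq_bigr _ (fun (n : 'I__) _ => hom_mulE n c)) big_split /=;
  congr (_ + _).
  by rewrite -(lin_sum lm) hP (sum_cut (leq_maxl N 2) hN).
have h1 : (1 < maxn N 2)%N by rewrite leq_max orbT.
by rewrite -big_mkcond (big_pred1 (Ordinal h1)).
Qed.

(** The left-hand side of the twisting equation sums to m(Phi c) + tau(d c).
*)
Lemma tw_eqE :
  (forall c, fin_sum (fun n => hom_mul (nseq n (1%:Z, tau)) c) 0) <->
  (forall c, @bar_op k A (Phi (V := SA) ltau tau_eps c) = tau (cdif C c)).
Proof.
split=> h c.
  have /eqP := fin_sum_uniq (hom_mul_sum c) (h c).
  by rewrite addrC addr_eq0 => /eqP ->.
have := hom_mul_sum c; rewrite -h.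
by rewrite [X in fin_sum _ X](_ : _ = 0) // subrr.
Qed.

End Twisting.

(** ** Representability *)

Section Represent.
Variables (k : comPzRingType) (A : ainf k).
Let SA := shift A.
Let lb := @bar_op_linear k A.
Let db := @bar_op_degree k A.

Section ThetaDef.
Variables (C : cgacdg k) (phi : cga_hom C (bar A)).

(** The composite of phi with the universal twisting cochain of the bar
construction. *)
Definition bar_tau (c : C) : A := wletter (phi c : tens SA).

Lemma bar_tau_linear : linear bar_tau.
Proof. exact: (lin_comp (@wletter_linear _ SA) (@linearP _ _ _ _ phi)). Qed.

Lemma wletter_degree : has_degree 0 (@wletter _ SA : tensg SA -> SA).
Proof.
move=> p y hy; rewrite addr0; move: p y hy; apply: tens_homog_ind.
- by move=> p; rewrite (lin0 (@wletter_linear _ SA)); apply: homog0.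
- by move=> p a x y hx hy; rewrite wletter_linear; apply: (@homogP k SA).
- by rewrite wletter_nil; apply: homog0.
move=> p q x y hx hy _; rewrite wletter_cons.
have [->|q0] := eqVneq q 0; first by rewrite addr0; apply: (@homogZ k SA).
by rewrite (wcounit_degree hy q0) scale0r; apply: homog0.
Qed.

Lemma bar_tau_degree : has_degree 1 bar_tau.
Proof.
move=> p c hc.
have h := wletter_degree (chom_degree phi hc).
by move: h; rewrite homog_shift !addr0.
Qed.

Lemma bar_tau_eps a : bar_tau (ceps C a) = 0.
Proof.
rewrite /bar_tau chom_eps /= /wunit (linZ (@wletter_linear _ SA)).
by rewrite wletter_nil scaler0.
Qed.

Lemma bar_tau_Phi : phi =1 Phi (V := SA) bar_tau_linear bar_tau_eps.
Proof.
apply: Phi_uniq; first exact: (@linearP _ _ _ _ phi).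
exact: cga_bar_rec.
Qed.

Lemma bar_tau_eq c : fin_sum (fun n => hom_mul (nseq n (1%:Z, bar_tau)) c) 0.
Proof.
move: c; apply/(tw_eqE bar_tau_linear bar_tau_degree bar_tau_eps) => c.
rewrite -bar_tau_Phi /bar_tau chom_dif.
exact/esym/(wletter_coder lb).
Qed.

Definition bar_tw : tw C A :=
  @Tw k C A (mklin bar_tau_linear) bar_tau_degree bar_tau_eps bar_tau_eq.

End ThetaDef.

Lemma bar_tw_inj C : injective (@bar_tw C).
Proof.
move=> phi psi e; apply: cga_hom_eq => c.
have et : bar_tau phi =1 bar_tau psi by move=> x;
  exact: (congr1 (fun t : tw C A => t x) e).
rewrite bar_tau_Phi; apply/esym; move: c; apply: Phi_uniq.
  exact: (@linearP _ _ _ _ psi).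
move=> c; rewrite [LHS]cga_bar_rec; congr (_ + _); apply: lift2_eq => a b.
by rewrite et.
Qed.

(** The coalgebra map is Phi; the twisting equation makes it compatible with
codifferentials. *)
Lemma bar_tw_surj C (t : tw C A) : exists phi, bar_tw phi = t.
Proof.
have lt := @linearP _ _ _ _ (twf t).
pose P := Phi (V := SA) lt (tw_eps t).
have lP : linear P by exact: Phi_linear.
have dP : forall c, P (cdif C c) = coder (@bar_op k A) (P c).
  have dt := tau_degree0 (tw_degree t).
  apply: (@Phi_dif k C SA t lt (tw_eps t) dt (@bar_op k A) lb db).1.
  exact/(tw_eqE lt (tw_degree t) (tw_eps t))/(tw_eq t).
have h1 := @Phi_degree k C SA t lt (tw_eps t) (tau_degree0 (tw_degree t)).
have h2 c : wdelta (P c) = tmap (mklin lP) (comul C c).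
  rewrite /P Phi_comul -[RHS]lift2_id lift2_tmap //; exact: tens2_bilinear.
have h3 := @wcounit_Phi k C SA t lt (tw_eps t).
have h4 := @Phi_eps k C SA t lt (tw_eps t).
pose phi : cga_hom C (bar A) := @CgaHom k C (bar A) (mklin lP) h1 h2 h3 h4 dP.
exists phi; apply: tw_eqP => c; exact: (@wletter_Phi k C SA t lt (tw_eps t) c).
Qed.

Lemma bar_represents : represents_tw (B := bar A) (fun C => @bar_tw C).
Proof.
split=> // C; apply: inj_surj_bij; [exact: bar_tw_inj | exact: bar_tw_surj].
Qed.

End Represent.

(** * Morphisms *)

Section MorphismFamilies.
Variables (k : comPzRingType) (A A' : ainf k) (f : seq A -> A').
Hypotheses (hf : multilinear f) (f0 : f [::] = 0).
Hypothesis df : multi_degree (fun n => 1 - n%:Z) f.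
Let SA := shift A.
Let SA' := shift A'.
Let tau : tens SA -> SA' := ohatS f.
Let lt : linear tau := ohatS_linear hf.

Lemma tau_bar_eps a : tau (ceps (bar A) a) = 0.
Proof. by rewrite /= /wunit (linZ lt) /tau (ohatS0 hf f0) scaler0. Qed.

Lemma Phi_word_sum (w : seq A) :
  Phi (C := bar A) lt tau_bar_eps (word w) =
  \sum_(r < (size w).+1) phin (@wdelta _ SA) (@wcounit _ SA) tau r (word w).
Proof.
apply: (fin_sum_uniq (Phi_fin_sum (C := bar A) lt tau_bar_eps (word w))).
exists (size w).+1 => // n hn; exact: (phin_vanish lt (ohatS0 hf f0) hn).
Qed.

(** The components of Phi on a word are the block decompositions, so block
sums compute composites with Phi; this covers both the relation of a morphism
and composition. *)
Lemma ohat_Phi_word (W : gmod k) (g : seq A' -> W) (w : seq A) :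
  multilinear g ->
  ohat A' g (Phi (C := bar A) lt tau_bar_eps (word w)) =
    block_sum g f (desusp A w).
Proof.
move=> hg; rewrite Phi_word_sum (lin_sum (ohat_linear hg)).
exact/esym/(block_sumE hf hg f0 df).
Qed.

(** On words the left-hand side of the second equation is minus the block sum
and the right-hand side minus the insertion sum. *)
Lemma ainf_relE :
  (forall s, insert_sum f (amul A) s = block_sum (amul A') f s) <->
  (forall y : bar A, @bar_op k A' (Phi (C := bar A) lt tau_bar_eps y) =
     tau (cdif (bar A) y)).
Proof.
have lP := Phi_linear (C := bar A) lt tau_bar_eps.
have hm' := @amul_multilinear k A'.
split=> h.
  apply: tens_ext.
  - exact: (lin_comp (@bar_op_linear k A') lP).
  - exact: (lin_comp lt (coder_linear (@bar_op_linear k A))).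
  move=> w; rewrite -[LHS]/(- ohat A' (amul A') _) (ohat_Phi_word w hm') -h.
  exact/esym/(ohat_coder hf w).
move=> s; rewrite -(desuspK s) -(ohat_Phi_word _ hm').
apply: oppr_inj; rewrite -(ohat_coder hf); exact/esym/h.
Qed.

End MorphismFamilies.

Section Functor.
Variables (k : comPzRingType) (A A' : ainf k).
Let SA := shift A.
Let SA' := shift A'.

Section AinfTw.
Variable f : ainf_hom A A'.
Let hf := @ahom_multilinear _ _ _ f.
Let f0 := @ahom_nil _ _ _ f.
Let df := @ahom_degree _ _ _ f.
Let lt : linear (ohat A f : bar A -> A') := ohatS_linear hf.
Let dt : has_degree 1 (ohat A f : bar A -> A') := ohat_degree hf df.
Let et : forall a, ohat A f (ceps (bar A) a) = 0 := tau_bar_eps hf f0.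

Lemma ainf_tw_eq c :
  fin_sum (fun n => hom_mul (nseq n (1%:Z, ohat A f : bar A -> A')) c) 0.
Proof.
move: c; apply/(tw_eqE lt dt et).
exact: ((ainf_relE hf f0 df).1 (@ahom_rel _ _ _ f)).
Qed.

Definition ainf_tw : tw (bar A) A' :=
  @Tw k (bar A) A' (mklin lt) dt et ainf_tw_eq.

End AinfTw.

Lemma ainf_tw_inj : injective ainf_tw.
Proof.
move=> f g e; apply: ainf_hom_eq => s.
have := congr1 (fun t : tw (bar A) A' => t (word (desusp A s) : tens SA)) e.
have hw (h : ainf_hom A A') : ohat A h (word (desusp A s)) = h s.
  by rewrite (ohat_word _ (@ahom_multilinear _ _ _ h)) desuspK.
by rewrite /= !hw.
Qed.

(** A twisting cochain t on the bar construction comes from the family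
t(desusp s): desuspension is an involution on words. *)
Lemma ainf_tw_surj (t : tw (bar A) A') : exists f, ainf_tw f = t.
Proof.
pose f (s : seq A) : A' := t (word (desusp A s) : tens SA).
have ltt : linear (t : tens SA -> A') by exact: (@linearP _ _ _ _ (twf t)).
have hf : multilinear f.
  have hw : @mlin k A A' (fun w => t (@word k SA w : tens SA)).
    move=> s u a x y; rewrite -ltt; congr (twf t _).
    exact: (@word_mlin k SA).
  exact: (@desusp_mlin k A A' _ hw).
have f0 : f [::] = 0.
  by rewrite -(tw_eps t 1) /f /= wunit1.
have df : multi_degree (fun n => 1 - n%:Z) f.
  exact: (ohat_multi_degree (f := t : tens SA -> A') (tw_degree t)).
have ft : ohat A f = t :> (tens SA -> A').
  apply/funext/tens_ext => //; first exact: (ohat_linear hf).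
  by move=> w; rewrite (ohat_word _ hf) /f desuspK.
have hr : forall s, insert_sum f (amul A) s = block_sum (amul A') f s.
  have lt2 := @linearP _ _ _ _ (twf t).
  have ht := (tw_eqE lt2 (tw_degree t) (tw_eps t)).1 (tw_eq t).
  apply/(ainf_relE hf f0 df) => y; rewrite /ohatS.
  move: (ohatS_linear hf) (tau_bar_eps hf f0); rewrite /ohatS ft => l1 e1.
  by rewrite -ht; congr (@bar_op k A' _); congr (Phi _ _ _);
    apply: Prop_irrelevance.
exists (@AInfHom k A A' f f0 hf df hr); apply: tw_eqP => y.
exact: (congr1 (fun g => g y) ft).
Qed.

Definition bar_map (f : ainf_hom A A') : cga_hom (bar A) (bar A') :=
  sval (cid (bar_tw_surj (ainf_tw f))).

Lemma bar_mapE f : bar_tw (bar_map f) = ainf_tw f.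
Proof. by rewrite /bar_map; case: cid. Qed.

Lemma wletter_bar_map f (y : tens SA) :
  wletter (bar_map f y : tens SA') = ohat A f y.
Proof. exact: (congr1 (fun t : tw (bar A) A' => t y) (bar_mapE f)). Qed.

Lemma bar_map_inj : injective bar_map.
Proof. by move=> f g e; apply: ainf_tw_inj; rewrite -!bar_mapE e. Qed.

Lemma bar_map_surj phi : exists f, bar_map f = phi.
Proof.
have [f hf] := ainf_tw_surj (bar_tw phi); exists f.
by apply: bar_tw_inj; rewrite bar_mapE.
Qed.

Lemma bar_map_word (W : gmod k) (g : seq A' ->
  W) f (w : seq A) : multilinear g ->
  ohat A' g (bar_map f (word w : tens SA)) = block_sum g f (desusp A w).
Proof.
move=> hg; have hf := @ahom_multilinear _ _ _ f.
rewrite -(ohat_Phi_word hf (@ahom_nil _ _ _ f) (@ahom_degree _ _ _ f) _ hg).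
congr ohat; rewrite bar_tau_Phi.
have e : bar_tau (bar_map f) = ohat A f.
  by apply/funext => y; apply: wletter_bar_map.
move: (bar_tau_linear (bar_map f)) (bar_tau_eps (bar_map f));
  rewrite e => l1 e1.
by congr (Phi _ _ _); apply: Prop_irrelevance.
Qed.

End Functor.

(** [tw_push] indexes the term of length i by i - 1. *)
Lemma fin_sum_shift (V : nmodType) (u : nat -> V) x :
  u 0%N = 0 -> fin_sum u x -> fin_sum (fun n => u n.+1) x.
Proof.
move=> u0 [N hN ->]; exists N => [n Nn|]; first exact/hN/leqW.
have : \sum_(n < N.+1) u n =
  \sum_(n < N) u n.+1 by rewrite big_ord_recl u0 add0r.
by rewrite big_ord_recr /= hN // addr0.
Qed.

(** As t is the letter component of psi, the i-th summand of its image is f_i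
applied to the component of length i of psi. *)
Lemma bar_push (k : comPzRingType) (A A' : ainf k) (f : ainf_hom A A')
    (C : cgacdg k) (psi : cga_hom C (bar A)) (t : tw C A) (t' : tw C A') :
  bar_tw psi = t -> (forall c, t' c = ohat A f (psi c)) -> tw_push f t t'.
Proof.
move=> <- ht' c; have hf := @ahom_multilinear _ _ _ f; rewrite ht' bar_tau_Phi.
set u := fun n => _.
have -> : u = fun n => ohat A f (phin (comul C) (ceta C)
    (bar_tau psi : C -> shift A) n.+1 c).
  apply/funext => n.
  by rewrite (ohat_phin (bar_tau_linear psi) (bar_tau_degree psi) _ _ hf).
apply: (@fin_sum_shift _ (fun n => ohat A f (phin (comul C) (ceta C)
    (bar_tau psi : C -> shift A) n c))).
  rewrite /= (linZ (ohat_linear hf)) -[word [::]]/(@word k (shift A) [::]).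
  by rewrite (ohat_word [::] hf) /= ahom_nil scaler0.
have [N hN ->] := Phi_fin_sum (V :=
  shift A) (bar_tau_linear psi) (bar_tau_eps psi) c.
exists N => [n /hN ->|]; first exact: (lin0 (ohat_linear hf)).
by rewrite (lin_sum (ohat_linear hf)).
Qed.

(** ** Transport to an arbitrary representative *)

Section Transport.
Variables (k : comPzRingType) (B : ainf k -> cgacdg k).
Variable theta : forall (A : ainf k) (C : cgacdg k), cga_hom C (B A) -> tw C A.
Hypothesis htheta : forall A : ainf k, represents_tw (@theta A).

Lemma theta_inj A C : injective (@theta A C).
Proof. exact: bij_inj (proj1 (htheta A) C). Qed.

Lemma theta_surj A C t : exists phi, @theta A C phi = t.
Proof. by case: (proj1 (htheta A) C) => g _ h; exists (g t). Qed.

(** The map classified by the universal twisting cochain of [B A]. *)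
Definition to_bar A : cga_hom (B A) (bar A) :=
  sval (cid (bar_tw_surj (@theta A _ (cga_id (B A))))).

(** The map classified by the universal twisting cochain of [bar A]. *)
Definition of_bar A : cga_hom (bar A) (B A) :=
  sval (cid (theta_surj (bar_tw (cga_id (bar A))))).

Lemma theta_of_bar A C (phi : cga_hom C (bar A)) :
  @theta A C (cga_comp (of_bar A) phi) = bar_tw phi.
Proof.
apply: tw_eqP => c; rewrite (proj2 (htheta A)).
have -> : @theta A _ (of_bar A) = bar_tw (cga_id (bar A)).
  by rewrite /of_bar; case: cid.
by [].
Qed.

Lemma bar_tw_to_bar A C (phi : cga_hom C (B A)) :
  bar_tw (cga_comp (to_bar A) phi) = @theta A C phi.
Proof.
apply: tw_eqP => c.
have -> : bar_tw (cga_comp (to_bar A) phi) c = bar_tw (to_bar A) (phi c) by [].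
have -> : bar_tw (to_bar A) = @theta A _ (cga_id (B A)).
  by rewrite /to_bar; case: cid.
rewrite -(proj2 (htheta A)); congr (twf (@theta A C _) c).
exact: cga_hom_eq.
Qed.

Lemma to_barK A c : of_bar A (to_bar A c) = c.
Proof.
suff e : cga_comp (of_bar A) (to_bar A) = cga_id (B A).
  exact: (congr1 (fun g : cga_hom (B A) (B A) => g c) e).
apply: theta_inj; rewrite theta_of_bar -bar_tw_to_bar; congr bar_tw.
exact: cga_hom_eq.
Qed.

Lemma of_barK A c : to_bar A (of_bar A c) = c.
Proof.
suff e : cga_comp (to_bar A) (of_bar A) = cga_id (bar A).
  exact: (congr1 (fun g : cga_hom (bar A) (bar A) => g c) e).
apply: bar_tw_inj; rewrite bar_tw_to_bar -theta_of_bar; congr (@theta A _ _).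
exact: cga_hom_eq.
Qed.

Definition bar_functor A A' (f : ainf_hom A A') : cga_hom (B A) (B A') :=
  cga_comp (of_bar A') (cga_comp (bar_map f) (to_bar A)).

Lemma bar_functor_is_functor : is_ainf_functor bar_functor.
Proof.
split=> [A|A A' A'' f' f].
  have [h hh] := bar_map_surj (cga_id (bar A)); exists h; last first.
    by apply: cga_hom_eq => c /=; rewrite hh /= to_barK.
  move=> s; have := wletter_bar_map h (word (desusp A s)).
  rewrite (ohat_word _ (@ahom_multilinear _ _ _ h)) desuspK hh => <- /=.
  case: s => [|x [|y s]] /=; first exact: wletter_nil.
    rewrite -wcons_word wletter_cons wcounit_nil scale1r.
    exact: (@ksgn0 k (shift A)).
  by rewrite -!wcons_word wletter_cons wcounit_cons scale0r.
have [h hh] := bar_map_surj (cga_comp (bar_map f') (bar_map f)); exists h;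
  last first.
  by apply: cga_hom_eq => c /=; rewrite hh /= of_barK.
move=> s; have hf' := @ahom_multilinear _ _ _ f'.
rewrite -[in RHS](desuspK s) -(bar_map_word f _ hf') -wletter_bar_map.
have := wletter_bar_map h (word (desusp A s)).
by rewrite (ohat_word _ (@ahom_multilinear _ _ _ h)) desuspK hh => <-.
Qed.

Lemma bar_functor_fully_faithful : fully_faithful bar_functor.
Proof.
move=> A A'; apply: inj_surj_bij => [f g e|phi].
  apply/bar_map_inj/cga_hom_eq => c.
  have := congr1 (fun h : cga_hom (B A) (B A') => to_bar A' (h (of_bar A c))) e.
  by rewrite /= !of_barK.
have [f hf] := bar_map_surj (cga_comp (to_bar A') (cga_comp phi (of_bar A))).
by exists f; apply: cga_hom_eq => c /=; rewrite hf /= !to_barK.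
Qed.

Lemma bar_functor_natural : natural_in_ainf (@theta) bar_functor.
Proof.
move=> A A' f C phi; apply: (bar_push (bar_tw_to_bar phi)) => c.
have -> : cga_comp (bar_functor f) phi =
    cga_comp (of_bar A') (cga_comp (bar_map f) (cga_comp (to_bar A) phi)).
  exact: cga_hom_eq.
rewrite theta_of_bar; exact: wletter_bar_map.
Qed.

End Transport.

Theorem mainTheorem3 (k : comPzRingType) :
  (forall A : ainf k, exists (B : cgacdg k)
     (theta : forall C : cgacdg k, cga_hom C B -> tw C A),
     represents_tw theta) /\
  (forall (B : ainf k -> cgacdg k)
     (theta : forall (A : ainf k) (C : cgacdg k), cga_hom C (B A) -> tw C A),
     (forall A : ainf k, represents_tw (theta A)) ->
     exists F : forall A A' : ainf k, ainf_hom A A' -> cga_hom (B A) (B A'),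
       is_ainf_functor F /\ fully_faithful F /\ natural_in_ainf theta F).
Proof.
split=> [A|B theta htheta].
  by exists (bar A), (fun C => @bar_tw k A C); apply: bar_represents.
exists (bar_functor htheta); split; first exact: bar_functor_is_functor.
by split; [apply: bar_functor_fully_faithful | apply: bar_functor_natural].
Qed.
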